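(* Algorithm for constructing $q(x)$ from the Weyl-type function $N(\lambda)$, where the kernel $M(x,t)$ is known a priori and $q$ is assumed analytic on $[0,\pi]$. Let the Weyl-type function $N(\lambda)$ be given. Then: (i) We calculate $q_k=q^{(k)}(0)$, $k\ge 0$. For this purpose we successively perform the following operations for $k=0,1,2,\ldots$: we construct a model potential $\tilde q(x)$, analytic on $[0,\pi]$, such that $\tilde q_j=q_j$ for $j=0,\ldots,k-1$ (where $\tilde q_j:=\tilde q^{(j)}(0)$) and arbitrary in the rest, and we calculate $q_k=q^{(k)}(0)$ by the formula $$ \hat q_k=-\lim_{|\rho|\to\infty,\ \rho\in Q}(-2i\rho)^{k+1}\hat N(\lambda),\qquad \lambda=\rho^2, $$ where $\hat q_k:=q_k-\tilde q_k$, $\hat N(\lambda):=N(\lambda)-\tilde N(\lambda)$, and $\tilde N(\lambda)$ is the Weyl-type function for the same kernel $M$ and the potential $\tilde q$. (ii) We construct the function $q(x)$ by the formula $$ q(x)=\sum_{k=0}^{\infty}q_k\frac{x^k}{k!},\qquad 0<x<R, $$ where $$ R=\Bigl(\limsup_{k\to\infty}\Bigl(\frac{|q_k|}{k!}\Bigr)^{1/k}\Bigr)^{-1}. $$ If $R<\pi$, then for $R<x<\pi$ the function $q(x)$ is constructed by analytic continuation.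
   Context: Consider the integro-differential equation $$\ell y:=-y''(x)+q(x)y(x)+\int_0^x M(x,t)y(t)\,dt=\lambda y(x),\qquad x\in[0,\pi],$$ where $q(x)$ and $M(x,t)$ are integrable complex-valued functions and $\lambda$ is the spectral parameter. Let $C(x,\lambda)$ and $S(x,\lambda)$ be the solutions with $C(0,\lambda)=S'(0,\lambda)=1$, $C'(0,\lambda)=S(0,\lambda)=0$, and put $\Delta_1(\lambda)=S(\pi,\lambda)$, $\Delta_2(\lambda)=C(\pi,\lambda)$. Let $\Phi(x,\lambda)$ be the solution of the equation under the conditions $\Phi(0,\lambda)=1$, $\Phi(\pi,\lambda)=0$. The Weyl-type function for $\ell$ is $N(\lambda):=\Phi'(0,\lambda)=-\Delta_2(\lambda)/\Delta_1(\lambda)$; it is meromorphic in $\lambda$. Fix $\delta\in(0,\pi/2)$ and let $Q=\{\rho\in\mathbb{C}:\arg\rho\in[\delta,\pi-\delta]\}$. *)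

(* Defs.v *)
(* MathComp-Analysis, over an arbitrary R : realType, with R[i] as the field of
   complex numbers. *)
From HB Require Import structures.
From mathcomp Require Import all_boot all_order all_algebra complex.
From mathcomp Require Import all_classical all_reals all_analysis.

Set Implicit Arguments.
Unset Strict Implicit.
Unset Printing Implicit Defensive.
Import Order.TTheory GRing.Theory Num.Theory.
Import numFieldNormedType.Exports.
Local Open Scope classical_set_scope.
Local Open Scope ring_scope.
Local Open Scope complex_scope.

Section ComplexValued.
Context {R : realType}.
Implicit Types f g : R -> R[i].

Definition cabs (z : R[i]) : R := ComplexField.Normc.normc z.

Definition cintegrable d (T : measurableType d) (mu : {measure set T -> \bar R})
    (D : set T) (f : T -> R[i]) : Prop :=
  mu.-integrable D (EFin \o (fun x => complex.Re (f x))) /\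
  mu.-integrable D (EFin \o (fun x => complex.Im (f x))).

Definition cintegral (D : set R) f : R[i] :=
  (\int[lebesgue_measure]_(x in D) complex.Re (f x)) +i*
  (\int[lebesgue_measure]_(x in D) complex.Im (f x)).

(* R[i] carries no normed module structure over R, hence the derivative of a
   function of a real variable is taken componentwise. *)
Definition cderive1n (k : nat) f (x : R) : R[i] :=
  derive1n k (fun t => complex.Re (f t)) x +i* derive1n k (fun t => complex.Im (f t)) x.

(* The regular module R[i]^o bears the topology of the complex plane. *)
Definition has_csum (u : nat -> R[i]) (s : R[i]) : Prop :=
  (series u : nat -> R[i]^o) @ \oo --> (s : R[i]^o).

Definition analytic_at f (x0 : R) : Prop :=
  exists (a : nat -> R[i]) (r : R), 0 < r /\
    forall x, `|x - x0| < r ->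
      has_csum (fun n => a n * ((x - x0)%:C) ^+ n) (f x).

(* At the endpoints of a closed interval this asks for analyticity on a
   two-sided neighbourhood. *)
Definition analytic_on (A : set R) f : Prop := forall x, A x -> analytic_at f x.

(* The radius of convergence of \sum_k c_k x^k / k!; the inverse is that of the
   extended reals, with 0^-1 = +oo and +oo^-1 = 0. *)
Definition taylor_radius (c : nat -> R[i]) : \bar R :=
  ((limn_esup (fun k : nat =>
      (powR (cabs (c k) / k`!%:R) (k%:R^-1))%:E))^-1)%E.

Definition taylor_term (c : nat -> R[i]) (x : R) (k : nat) : R[i] :=
  c k * (x%:C) ^+ k / k`!%:R.

(* The filter "|rho| --> oo with rho in Q". *)
Definition cinfty_in (Q : set R[i]) : set_system R[i] :=
  filter_from [set: R] (fun A => [set rho | Q rho /\ A < cabs rho]).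

(* arg rho in [delta, pi - delta] *)
Definition sector (delta : R) : set R[i] :=
  [set rho | exists r theta : R,
    [/\ 0 < r, delta <= theta <= pi - delta &
        rho = r%:C * (cos theta +i* sin theta)]].

End ComplexValued.

Section IntegroDifferential.
Context {R : realType}.
Implicit Types (M : R -> R -> R[i]) (q y : R -> R[i]).

Definition integrable_kernel M : Prop :=
  cintegrable (lebesgue_measure \x lebesgue_measure)%E
    [set p : R * R | 0 <= p.2 /\ p.2 <= p.1 /\ p.1 <= pi]
    (fun p => M p.1 p.2).

(* f is absolutely continuous on [0, pi], and g is its (a.e.) derivative. *)
Definition ac_derivative (f g : R -> R[i]) : Prop :=
  cintegrable lebesgue_measure `[0, pi] g /\
  forall x : R, x \in `[0, pi] -> f x = f 0 + cintegral `[0, x] g.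

(* y solves
     - y'' + q y + \int_0^x M(x, t) y(t) dt = lam y   on [0, pi],
     y(0) = a, y'(0) = b,
   i.e. y and y' are absolutely continuous and the equation holds almost
   everywhere, as is usual for integrable coefficients.  Being continuous, y1
   is y' everywhere on [0, pi]; y2 is y''. *)
Definition cauchy_solution M q (lam a b : R[i]) y : Prop :=
  exists y1 y2 : R -> R[i],
    [/\ ac_derivative y y1, ac_derivative y1 y2, y 0 = a, y1 0 = b &
        {ae lebesgue_measure, forall x : R, x \in `[0, pi] ->
          - y2 x + q x * y x + cintegral `[0, x] (fun t => M x t * y t)
            = lam * y x}].

(* N = - Delta_2 / Delta_1, where Delta_1 lam = S pi lam and
   Delta_2 lam = C pi lam.  It is meromorphic, and its values at the zeros of
   Delta_1 are left unconstrained.  Where Delta_1 does not vanish,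
   Phi = C + N S is the solution with Phi 0 = 1, Phi pi = 0, so that N is
   Phi' 0. *)
Definition weyl_function M q (N : R[i] -> R[i]) : Prop :=
  exists C S : R[i] -> R -> R[i],
    (forall lam, cauchy_solution M q lam 1 0 (C lam)) /\
    (forall lam, cauchy_solution M q lam 0 1 (S lam)) /\
    (forall lam, S lam pi != 0 -> N lam = - C lam pi / S lam pi).

(* A model potential for step k: analytic, with the same k first Taylor
   coefficients at 0 as q. *)
Definition model_potential q (k : nat) (qt : R -> R[i]) : Prop :=
  analytic_on `[0, pi] qt /\
  forall j, (j < k)%N -> cderive1n j qt 0 = cderive1n j q 0.

End IntegroDifferential.

(* Main.v *)
Require Import Defs.
From HB Require Import structures.
From mathcomp Require Import all_boot all_order all_algebra complex.
From mathcomp Require Import all_classical all_reals all_analysis.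
From mathcomp Require Import measurable_realfun ring lra.

Set Implicit Arguments.
Unset Strict Implicit.
Unset Printing Implicit Defensive.
Import Order.TTheory GRing.Theory Num.Theory.
Import numFieldNormedType.Exports.
Local Open Scope classical_set_scope.
Local Open Scope ring_scope.
Local Open Scope complex_scope.

(** The difference w of the Weyl solutions for q and for the model potential qt
    vanishes at 0 and pi, has w'(0) = N - Nt, and solves the equation for qt with
    right-hand side (q - qt) Phi. For al = i rho the operator D^2 - al^2 splits
    into the first-order factors D - al and D + al, and integrating these up to
    pi and back expresses w'(0), up to exponentially small terms, as minus the
    integral of e^(al s) F(s), where F collects (q - qt) Phi, qt w and the Volterra
    term. The Volterra term does not decay exponentially, so only polynomial
    weights (1 + |rho| s)^k survive: they are preserved by the kernels
    e^(-tau |x - s|), which gives |w| = O(|rho|^(-k-1) (1 + |rho| s)^k), and by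
    dominated convergence the contribution of qt w and of the Volterra term is
    o(|rho|^(-k-1)). What remains is the Laplace integral of s^k e^(2 i rho s) / k!,
    that is (-2 i rho)^(-k-1). No adjoint equation and no existence theorem enter:
    the bounds are a priori ones, obtained by absorbing the supremum of |w|.

    The recovery of q from its Taylor coefficients is the identity theorem for real
    analytic functions, applied to the real and imaginary parts. *)

(** * Real power series *)

(** The kernel is merely integrable, so all that is kept of it is an integrable majorant [m] of s ->
    int_0^s |M(s,t)| dt. At s the Volterra term sees w on the whole of [0, s], hence the weight must
    increase with s; (1 + |rho| s)^k fits because q - qt = O(s^k) and s^k <= |rho|^(-k) (1 + |rho|
    s)^k. The remaining power of |rho| comes from the two first-order factors, whose values differ
    by 2 al w. The supremum of |w| is absorbed once the integral of Q + m, divided by |rho|, is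
    small. The weight constants depend only on k and on a lower bound of Im rho / |rho| in the
    sector, so every threshold is uniform in arg rho. Up to the weight, the terms qt w and Volterra
    already have order |rho|^(-k-1) (Q + m); only the factor e^(al s) makes them negligible. Since m
    is merely integrable, this gives a limit without a rate. Half of the decay pays for the
    polynomial weight, the other half drives dominated convergence. [N] is unconstrained at the
    zeros of Delta_1; the same a priori bound shows that large rho in the sector avoid them. *)

Section RealPowerSeries.
Context {R : realType}.
Implicit Types (a b : nat -> R) (f g : R -> R).

Lemma geometric_tail_le (C t : R) m n : 0 <= C -> 0 <= t < 1 ->
  \sum_(m <= i < n) C * t ^+ i <= C * t ^+ m / (1 - t).
Proof.
move=> C0 /andP[t0 t1].
have t1' : 0 < 1 - t by rewrite subr_gt0.
have [mn|nm] := leqP m n; last first.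
  by rewrite big_geq ?(ltnW nm)// divr_ge0 ?(ltW t1')// mulr_ge0// exprn_ge0.
rewrite -(subnKC mn); elim: (n - m)%N => [|k IH].
  by rewrite addn0 big_geq// divr_ge0 ?(ltW t1')// mulr_ge0// exprn_ge0.
suff : \sum_(m <= i < m + k.+1) C * t ^+ i = C * (t ^+ m - t ^+ (m + k.+1)) / (1 - t).
  move=> ->; rewrite ler_pM2r ?invr_gt0// ler_wpM2l// lerBlDr lerDl exprn_ge0//.
elim: k.+1 => [|j IHj]; first by rewrite addn0 big_geq// subrr mulr0 mul0r.
rewrite addnS big_nat_recr ?leq_addr//= IHj exprS.
by field; rewrite gt_eqF.
Qed.

Lemma pseries_term_le a (C r h : R) n : 0 < r -> `|a n| * r ^+ n <= C ->
  `|a n * h ^+ n| <= C * (`|h| / r) ^+ n.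
Proof.
move=> r0 aC; rewrite normrM normrX expr_div_n mulrCA mulrC ler_wpM2l ?exprn_ge0//.
by rewrite ler_pdivlMr ?exprn_gt0.
Qed.

Lemma coef_bound_cvg a (C r h : R) : 0 < r -> (forall n, `|a n| * r ^+ n <= C) ->
  `|h| < r -> cvgn (pseries a h).
Proof.
move=> r0 aC hr.
have C0 : 0 <= C by apply: le_trans (aC 0%N); rewrite expr0 mulr1.
have t1 : `|(`|h| / r)| < 1.
  by rewrite ger0_norm ?divr_ge0 ?(ltW r0)// ltr_pdivrMr// mul1r.
apply: normed_cvg.
apply: (@series_le_cvg _ _ (fun n => geometric C (`|h| / r) n)) => /= [n|n|n|].
- exact: normr_ge0.
- by rewrite mulr_ge0// exprn_ge0// divr_ge0// ltW.
- exact: pseries_term_le.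
- apply/cvg_ex; exists (C / (1 - `|h| / r)); exact: cvg_geometric_series.
Qed.

Lemma pseries_coef_bound a (r : R) : 0 < r -> cvgn (pseries a r) ->
  exists2 C, 0 <= C & forall n, `|a n| * r ^+ n <= C.
Proof.
move=> r0 /cvg_series_bounded [K [Kreal Kf]].
have aK n : `|a n| * r ^+ n <= `|K| + 1.
  have /= := Kf (`|K| + 1) _ n I; rewrite normrM normrX (gtr0_norm r0); apply.
  by rewrite (le_lt_trans (ler_norm _)) ?ltrDl.
by exists (`|K| + 1); first exact: addr_ge0.
Qed.

Lemma pseries_tail a (C r h s : R) m : 0 < r ->
  (forall n, `|a n| * r ^+ n <= C) -> `|h| < r -> pseries a h @ \oo --> s ->
  `|s - \sum_(0 <= i < m) a i * h ^+ i| <= C * (`|h| / r) ^+ m / (1 - `|h| / r).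
Proof.
move=> r0 aC hr cs.
have C0 : 0 <= C by apply: le_trans (aC 0%N); rewrite expr0 mulr1.
have t01 : 0 <= `|h| / r < 1.
  by rewrite divr_ge0 ?(ltW r0)//= ltr_pdivrMr// mul1r.
have {}cs : `|pseries a h n - \sum_(0 <= i < m) a i * h ^+ i| @[n --> \oo] -->
     `|s - \sum_(0 <= i < m) a i * h ^+ i|.
  by apply: cvg_norm; apply: cvgB => //; exact: cvg_cst.
rewrite -(cvg_lim _ cs)//; apply: limr_le; first by apply/cvg_ex; eexists; exact: cs.
exists m => //= n /= mn; rewrite /pseries /series/=.
rewrite (big_cat_nat (leq0n m) mn)/= addrAC subrr add0r.
apply: le_trans (geometric_tail_le m n C0 t01).
rewrite (le_trans (ler_norm_sum _ _ _))//; apply: ler_sum => i _.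
exact: pseries_term_le.
Qed.

Definition real_analytic f (x0 : R) := exists a r, 0 < r /\
  forall x, `|x - x0| < r -> pseries a (x - x0) @ \oo --> f x.

(** Convergence is known only inside the open interval, so the radius is halved: at r / 2 the series
    converges and its terms are bounded. *)
Lemma real_analytic_bound f x0 : real_analytic f x0 -> exists a r C, [/\ 0 < r, 0 <= C,
  forall n, `|a n| * r ^+ n <= C &
  forall x, `|x - x0| < r -> pseries a (x - x0) @ \oo --> f x].
Proof.
move=> [a [r [r0 af]]]; exists a, (r / 2).
have r20 : 0 < r / 2 by rewrite divr_gt0.
have [|C C0 aC] := @pseries_coef_bound a (r / 2) r20.
  apply/cvg_ex; exists (f (x0 + r / 2)).
  have := af (x0 + r / 2); rewrite addrAC subrr add0r; apply.
  by rewrite gtr0_norm// ltr_pdivrMr// ltr_pMr// ltr1n.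
exists C; split => // x xr; apply: af; apply: lt_trans xr _.
by rewrite ltr_pdivrMr// ltr_pMr// ltr1n.
Qed.

(** Up to half the radius the geometric ratio is at most 1/2, whence the factor 2. *)
Lemma pseries_taylor a (C r : R) f x0 m : 0 < r ->
  (forall n, `|a n| * r ^+ n <= C) ->
  (forall x, `|x - x0| < r -> pseries a (x - x0) @ \oo --> f x) ->
  forall x, `|x - x0| <= r / 2 ->
  `|f x - \sum_(0 <= i < m) a i * (x - x0) ^+ i| <= 2 * C / r ^+ m * `|x - x0| ^+ m.
Proof.
move=> r0 aC af x xr.
have C0 : 0 <= C by apply: le_trans (aC 0%N); rewrite expr0 mulr1.
have xr' : `|x - x0| < r.
  by rewrite (le_lt_trans xr)// ltr_pdivrMr// ltr_pMr// ltr1n.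
apply: le_trans (pseries_tail m r0 aC xr' (af _ xr')) _.
have -> : 2 * C / r ^+ m * `|x - x0| ^+ m = C * (`|x - x0| / r) ^+ m * 2.
  by rewrite expr_div_n; ring.
rewrite ler_wpM2l ?mulr_ge0 ?exprn_ge0 ?divr_ge0 ?(ltW r0)//.
have xr2 : `|x - x0| / r <= 2^-1 by rewrite ler_pdivrMr// mulrC.
rewrite -[leRHS]invrK lef_pV2 ?posrE//; first by lra.
lra.
Qed.

Lemma real_analytic_continuous f x0 : real_analytic f x0 -> {for x0, continuous f}.
Proof.
move=> /real_analytic_bound[a [r [C [r0 C0 aC af]]]].
have f0 : f x0 = a 0%N.
  have := af x0; rewrite subrr normr0 => /(_ r0) fx0.
  apply/esym/(cvg_unique _ _ fx0) => //; apply: cvg_near_cst.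
  exists 1%N => //= n /= n1; rewrite /pseries /series/= big_ltn//= expr0 mulr1.
  rewrite big_nat_cond big1 ?addr0// => i /andP[/andP[i1 _] _].
  by rewrite expr0n gtn_eqF// mulr0.
have tl := @pseries_taylor a C r f x0 1%N r0 aC af.
apply/cvgrPdist_le => e e0.
have K0 : 0 < 2 * C / r + 1 by rewrite ltr_wpDl// divr_ge0 ?mulr_ge0// ltW.
near=> x.
rewrite distrC f0; have := tl x; rewrite big_nat1 expr0 mulr1 !expr1 => tlx.
apply: (le_trans (tlx _)).
  near: x; apply/nbhs_ballP; exists (r / 2) => /=; first by rewrite divr_gt0.
  by move=> x; rewrite /ball/= distrC => /ltW.
apply: (@le_trans _ _ ((2 * C / r + 1) * `|x - x0|)).
  by rewrite ler_wpM2r// lerDl.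
rewrite mulrC -ler_pdivlMr//.
near: x; apply/nbhs_ballP; exists (e / (2 * C / r + 1)) => /=; first by rewrite divr_gt0.
by move=> x; rewrite /ball/= distrC => /ltW.
Unshelve. all: by end_near. Qed.

Lemma real_analyticB f g x0 : real_analytic f x0 -> real_analytic g x0 -> real_analytic (fun x => f x - g x) x0.
Proof.
move=> [a [r [r0 af]]] [b [s [s0 bg]]]; exists (fun n => a n - b n), (Num.min r s).
split; first by rewrite lt_min r0.
move=> x; rewrite lt_min => /andP[xr xs].
rewrite [X in X @ _](_ : _ = pseries a (x - x0) \- pseries b (x - x0)).
  exact: cvgB (af x xr) (bg x xs).
apply/funext => n; rewrite /pseries /series/= -sumrB.
by apply: eq_bigr => i _; rewrite mulrBl.
Qed.

End RealPowerSeries.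

(** * Termwise differentiation, recentring and the identity theorem *)

Section RealAnalytic.
Context {R : realType}.
Implicit Types (a b : nat -> R) (f g : R -> R).

(** With t = 1 / (1 + s), Bernoulli's inequality gives t^n <= 1 / (1 + n s). This absorbs the factor
    n + 1 produced by differentiating a power series. *)
Lemma natr_expr_bound (t : R) n : 0 < t < 1 -> n.+1%:R * t ^+ n <= 1 + (t^-1 - 1)^-1.
Proof.
move=> /andP[t0 t1]; set s := t^-1 - 1.
have s0 : 0 < s by rewrite subr_gt0 invf_gt1.
have ts : t = (1 + s)^-1 by rewrite /s addrC subrK invrK.
have bern m : 1 + m%:R * s <= (1 + s) ^+ m.
  elim: m => [|m IH]; first by rewrite mul0r addr0 expr0.
  rewrite exprS; apply: (@le_trans _ _ ((1 + s) * (1 + m%:R * s))); last first.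
    by rewrite ler_wpM2l// addr_ge0// ltW.
  have : 0 <= m%:R * s * s :> R by rewrite !mulr_ge0 ?ler0n ?(ltW s0).
  by rewrite -natr1; nra.
have p0 : 0 < 1 + n%:R * s by rewrite ltr_wpDr// mulr_ge0// ltW.
apply: (@le_trans _ _ (n.+1%:R / (1 + n%:R * s))).
  rewrite ler_wpM2l// ts exprVn lef_pV2 ?posrE//.
  by rewrite exprn_gt0// addr_gt0.
rewrite ler_pdivrMr// -natr1.
have -> : (1 + s^-1) * (1 + n%:R * s) = 1 + n%:R * s + s^-1 + n%:R.
  by field; rewrite gt_eqF.
have : 0 <= s^-1 by rewrite invr_ge0 ltW.
have : 0 <= n%:R * s by rewrite mulr_ge0// ltW.
by move=> ? ?; lra.
Qed.

(** The radius of convergence is at least r. Quantifying over all smaller s makes the notion stable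
    under termwise differentiation, which a single bound at r is not. *)
Definition radius_ge a (r : R) := forall s, 0 < s < r -> exists C, forall n, `|a n| * s ^+ n <= C.

Lemma bound_radius_ge a (C r : R) : (forall n, `|a n| * r ^+ n <= C) -> radius_ge a r.
Proof.
move=> aC s /andP[s0 sr]; exists C => n; apply: le_trans (aC n).
by rewrite ler_wpM2l// lerXn2r ?nnegrE ?(ltW sr) ?(ltW s0) ?(ltW (lt_trans s0 sr)).
Qed.

Lemma radius_ge_diffs a r : radius_ge a r -> radius_ge (pseries_diffs a) r.
Proof.
move=> ar s /andP[s0 sr].
have [t st tr] : exists2 t, s < t & t < r by exists ((s + r) / 2); lra.
have t0 : 0 < t by apply: lt_trans st.
have [|C aC] := ar t; first by rewrite t0.
have C0 : 0 <= C by apply: le_trans (aC 0%N); rewrite expr0 mulr1.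
exists (C / t * (1 + ((s / t)^-1 - 1)^-1)) => n.
have st1 : 0 < s / t < 1 by rewrite divr_gt0//= ltr_pdivrMr// mul1r.
apply: (@le_trans _ _ (C / t * (n.+1%:R * (s / t) ^+ n))); last first.
  by rewrite (ler_wpM2l (divr_ge0 C0 (ltW t0)))// natr_expr_bound.
rewrite /pseries_diffs normrM normr_nat expr_div_n.
have -> : C / t * (n.+1%:R * (s ^+ n / t ^+ n)) = n.+1%:R * (C / t ^+ n.+1) * s ^+ n.
  by rewrite exprS invfM; ring.
rewrite ler_wpM2r ?exprn_ge0 ?(ltW s0)// ler_wpM2l// ler_pdivlMr ?exprn_gt0//.
Qed.

Lemma radius_ge_cvg a r x : radius_ge a r -> `|x| < r -> cvgn (pseries a x).
Proof.
move=> ar xr; have x0 := normr_ge0 x.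
have [|C aC] := ar ((`|x| + r) / 2); first by lra.
by apply: (@coef_bound_cvg _ a C ((`|x| + r) / 2)) => //; lra.
Qed.

Lemma radius_ge_derive a r x : radius_ge a r -> `|x| < r ->
  is_derive x (1 : R) (fun x => limn (pseries a x)) (limn (pseries (pseries_diffs a) x)).
Proof.
move=> ar xr; have x0 := normr_ge0 x.
have Kr : `|(`|x| + r) / 2| < r by rewrite ger0_norm; lra.
apply: (@pseries_snd_diffs _ a ((`|x| + r) / 2)).
- exact: radius_ge_cvg Kr.
- exact: radius_ge_cvg (radius_ge_diffs ar) Kr.
- exact: radius_ge_cvg (radius_ge_diffs (radius_ge_diffs ar)) Kr.
- by rewrite [ltRHS]ger0_norm; lra.
Qed.

Lemma radius_ge_iter_diffs a r k : radius_ge a r -> radius_ge (iter k (@pseries_diffs R) a) r.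
Proof. by move=> ar; elim: k => //= k; exact: radius_ge_diffs. Qed.

Lemma iter_diffsE a k n :
  iter k (@pseries_diffs R) a n * n`!%:R = (n + k)`!%:R * a (n + k)%N.
Proof.
elim: k n => [|k IH] n; first by rewrite addn0 mulrC.
rewrite iterS /pseries_diffs mulrAC -natrM mulrC -factS IH addSnnS//.
Qed.

(** The formula is proved on the whole interval and not only at x0, since the next derivative
    depends on the values near the point. *)
Lemma derive1n_pseries f x0 a r : radius_ge a r ->
  (forall x, `|x - x0| < r -> pseries a (x - x0) @ \oo --> f x) ->
  forall k x, `|x - x0| < r ->
  derive1n k f x = limn (pseries (iter k (@pseries_diffs R) a) (x - x0)).
Proof.
move=> ar af; elim=> [|k IH] x xr; first by apply/esym/cvg_lim => //; exact: af.
rewrite derive1nS derive1E.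
rewrite (@near_eq_derive _ _ _ _
   (fun x => limn (pseries (iter k (@pseries_diffs R) a) (x - x0)))); last first.
  have : 0 < r - `|x - x0| by rewrite subr_gt0.
  move=> d0; near=> y; apply: IH.
  have -> : y - x0 = (y - x) + (x - x0) by ring.
  rewrite (le_lt_trans (ler_normD _ _))// -ltrBrDr.
  near: y; apply/nbhs_ballP; exists (r - `|x - x0|) => //= y.
  by rewrite /ball/= distrC.
have D := radius_ge_derive (radius_ge_iter_diffs k ar) xr.
have D2 : is_derive x (1 : R) (fun y : R => y - x0) 1.
  by apply: is_derive_eq; rewrite subr0.
have D1 : is_derive ((fun y => y - x0) x) (1 : R)
  (fun y => limn (pseries (iter k (@pseries_diffs R) a) y))
  (limn (pseries (pseries_diffs (iter k (@pseries_diffs R) a)) (x - x0))) := D.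
by have := @is_derive1_comp _ _ (fun y => y - x0) x _ _ D1 D2; rewrite mulr1 => /@derive_val.
Unshelve. all: by end_near. Qed.

Lemma real_analytic_derive1n f x0 a r C : 0 < r -> (forall n, `|a n| * r ^+ n <= C) ->
  (forall x, `|x - x0| < r -> pseries a (x - x0) @ \oo --> f x) ->
  forall k, derive1n k f x0 = k`!%:R * a k.
Proof.
move=> r0 aC af k.
rewrite (derive1n_pseries (bound_radius_ge aC) af) subrr ?normr0//.
have := iter_diffsE a k 0; rewrite fact0 mulr1 add0n => <-.
apply/cvg_lim => //; apply: cvg_near_cst.
exists 1%N => //= n /= n1; rewrite /pseries /series/= big_ltn//= expr0 mulr1.
rewrite big_nat_cond big1 ?addr0// => i /andP[/andP[i1 _] _].
by rewrite expr0n gtn_eqF// mulr0.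
Qed.

Lemma triangular_sum (G : nat -> nat -> R) K :
  \sum_(0 <= k < K) \sum_(0 <= n < k.+1) G n (k - n)%N =
  \sum_(0 <= n < K) \sum_(0 <= j < K - n) G n j.
Proof.
elim: K => [|K IH]; first by rewrite !big_geq.
rewrite big_nat_recr//= IH [RHS]big_nat_recr//= subSnn big_nat1.
rewrite big_nat_recr//= subnn addrA -big_split/=; congr (_ + _).
rewrite !big_nat; apply: eq_bigr => n /andP[_ nK].
by rewrite subSn ?(ltnW nK)// big_nat_recr.
Qed.

(** Makes the Taylor series at 0 analytic at every point inside its radius, so that the identity
    theorem can compare it with q. Powers of x = s + h are expanded by the binomial formula; partial
    sums are rearranged exactly, as finite triangles, and only then compared with the limit. *)
Lemma pseries_recenter a r s : radius_ge a r -> `|s| < r -> real_analytic (fun x => limn (pseries a x)) s.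
Proof.
move=> ar sr; have s0 := normr_ge0 s.
(* Two margins d: the first is the new radius, the second makes the ratio t = (|s| + d) / (|s| + 2
   d) smaller than 1. *)
have [d [d0 dr]] : exists d, 0 < d /\ `|s| + 2 * d < r.
  by exists ((r - `|s|) / 3); lra.
have [e eE] : exists e, e = `|s| + 2 * d by exists (`|s| + 2 * d).
have e0 : 0 < e by lra.
have [|C aC] := ar e; first by rewrite e0/= eE.
have C0 : 0 <= C by apply: le_trans (aC 0%N); rewrite expr0 mulr1.
have [t tE] : exists t, t = (`|s| + d) / e by eexists.
have t01 : 0 <= t < 1.
  by rewrite tE divr_ge0 ?(ltW e0)/= ?addr_ge0 ?(ltW d0)// ltr_pdivrMr//; lra.
have t1 : 0 < 1 - t by move: t01; lra.
(* The contribution of the term of degree n + j to the coefficient of h^n. A single binomial term is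
   at most the full power (|s| + d)^(n + j), which gives a doubly geometric bound. *)
pose G n j : R := 'C(n + j, n)%:R * a (n + j)%N * s ^+ j.
have Gle n j : `|G n j| <= C / d ^+ n * t ^+ n * t ^+ j.
  rewrite /G !normrM normr_nat normrX -(mulrA (C / _)) -exprD tE expr_div_n.
  have CS : 'C(n + j, n)%:R * `|s| ^+ j * d ^+ n <= (`|s| + d) ^+ (n + j).
    rewrite exprDn (bigD1 (Ordinal (leq_addr j n : n < (n + j).+1)%N))//=.
    rewrite addKn -[X in _ <= X + _]mulr_natl mulrA ler_wpDr// sumr_ge0// => i _.
    by rewrite mulrn_wge0// mulr_ge0// exprn_ge0// ltW.
  have -> : C / d ^+ n * ((`|s| + d) ^+ (n + j) / e ^+ (n + j)) =
      (C / e ^+ (n + j)) * ((`|s| + d) ^+ (n + j) / d ^+ n) by ring.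
  have -> : 'C(n + j, n)%:R * `|a (n + j)%N| * `|s| ^+ j =
      `|a (n + j)%N| * ('C(n + j, n)%:R * `|s| ^+ j) by ring.
  apply: ler_pM => //.
    by rewrite ler_pdivlMr ?exprn_gt0.
  by rewrite ler_pdivlMr ?exprn_gt0.
have K0 n : 0 <= C / d ^+ n * t ^+ n.
  by rewrite mulr_ge0 ?divr_ge0 ?exprn_ge0 ?(ltW d0)//; case/andP: t01.
have cG n : cvgn (series (G n)).
  apply: normed_cvg; apply: (@series_le_cvg _ _
    (fun j => geometric (C / d ^+ n * t ^+ n) t j)) => /= [j|j|j|].
  - exact: normr_ge0.
  - by rewrite mulr_ge0// exprn_ge0//; case/andP: t01.
  - exact: Gle.
  - apply/cvg_ex; eexists; apply: cvg_geometric_series.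
    by rewrite ger0_norm; case/andP: t01.
have Gtail n m : `|limn (series (G n)) - \sum_(0 <= j < m) G n j| <=
    C / d ^+ n * t ^+ n * t ^+ m / (1 - t).
  have cn : `|series (G n) l - \sum_(0 <= j < m) G n j| @[l --> \oo] -->
     `|limn (series (G n)) - \sum_(0 <= j < m) G n j|.
    by apply: cvg_norm; apply: cvgB; [exact: cG|exact: cvg_cst].
  rewrite -(cvg_lim _ cn)//; apply: limr_le; first by apply/cvg_ex; eexists; exact: cn.
  exists m => //= l /= ml; rewrite /series/= (big_cat_nat (leq0n m) ml)/= addrAC subrr add0r.
  apply: le_trans (geometric_tail_le m l (K0 n) t01).
  by rewrite (le_trans (ler_norm_sum _ _ _))//; apply: ler_sum => i _; exact: Gle.
exists (fun n => limn (series (G n))), d; split => // x xd.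
have xr : `|x| < e.
  have -> : x = s + (x - s) by ring.
  by rewrite (le_lt_trans (ler_normD _ _))// eE; lra.
set h := x - s.
have cx : pseries a x @ \oo --> limn (pseries a x) by exact: coef_bound_cvg aC xr.
have PE K : pseries a x K = \sum_(0 <= n < K) (\sum_(0 <= j < K - n) G n j) * h ^+ n.
  rewrite /pseries /series/=.
  transitivity (\sum_(0 <= k < K) \sum_(0 <= n < k.+1) (G n (k - n)%N * h ^+ n)).
    apply: eq_bigr => k _; have -> : x = s + h by rewrite /h; ring.
    rewrite exprDn big_mkord mulr_sumr; apply: eq_bigr => i _.
    have ik : (i <= k)%N by rewrite -ltnS.
    by rewrite /G subnKC// -[X in _ * X]mulr_natl; ring.
  rewrite (triangular_sum (fun n j => G n j * h ^+ n)).
  by apply: eq_bigr => n _; rewrite mulr_suml.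
have [u uE] : exists u, u = `|h| / d by eexists.
have u01 : 0 <= u < 1 by rewrite uE divr_ge0 ?(ltW d0)//= ltr_pdivrMr// mul1r.
have u1 : 0 < 1 - u by move: u01; lra.
pose B := C / (1 - t) / (1 - u).
(* In the K-th partial sum the inner series n is cut at K - n; its tail is of order t^n t^(K - n) =
   t^K for every n, and summing over n costs a geometric series in u. *)
have diffle K : `|pseries a x K - pseries (fun n => limn (series (G n))) h K| <= B * t ^+ K.
  rewrite PE /pseries /series/= -sumrB (le_trans (ler_norm_sum _ _ _))//.
  apply: (@le_trans _ _ (\sum_(0 <= n < K) C / (1 - t) * t ^+ K * u ^+ n)).
    rewrite !big_nat; apply: ler_sum => n /andP[_ nK].
    rewrite -mulrBl normrM normrX distrC.
    apply: (@le_trans _ _ (C / d ^+ n * t ^+ n * t ^+ (K - n) / (1 - t) * `|h| ^+ n)).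
      by apply: ler_wpM2r; [rewrite exprn_ge0|exact: Gtail].
    rewrite -(mulrA (C / _)) -exprD subnKC ?(ltnW nK)// uE expr_div_n le_eqVlt; apply/orP; left.
    by apply/eqP; ring.
  have B0 : 0 <= C / (1 - t) * t ^+ K.
    by rewrite mulr_ge0 ?divr_ge0 ?exprn_ge0 ?(ltW t1)//; case/andP: t01.
  apply: le_trans (geometric_tail_le 0 K B0 u01) _.
  by rewrite expr0 mulr1 /B le_eqVlt; apply/orP; left; apply/eqP; ring.
rewrite [X in X @ _](_ : _ = pseries a x \-
   (pseries a x \- pseries (fun n => limn (series (G n))) h)); last first.
  by apply/funext => n /=; rewrite opprB addrC subrK.
rewrite -[X in _ --> X]subr0; apply: cvgB => //.
apply/norm_cvg0P.
apply: (@squeeze_cvgr _ _ _ _ (cst 0) (fun K => B * t ^+ K)).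
- by near=> n; rewrite normr_ge0 diffle.
- exact: cvg_cst.
- rewrite -[X in _ --> X](mulr0 B); apply: cvgM; first exact: cvg_cst.
  by apply: cvg_expr; rewrite ger0_norm; case/andP: t01.
Unshelve. all: by end_near. Qed.

(** If [a n] were the first nonzero coefficient, f(x0 - h) = 0 would give |a n| h^n <= B h^(n+1),
    which fails for small h. *)
Lemma real_analytic_zero_left f x0 e : real_analytic f x0 -> 0 < e ->
  (forall x, x0 - e < x < x0 -> f x = 0) ->
  exists2 d, 0 < d & forall x, `|x - x0| < d -> f x = 0.
Proof.
move=> /real_analytic_bound[a [r [C [r0 C0 aC af]]]] e0 fz.
have a0 n : a n = 0.
  elim/ltn_ind: n => n IH; apply/eqP/negPn/negP => an0.
  have an : 0 < `|a n| by rewrite normr_gt0.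
  pose B := 2 * C / r ^+ n.+1.
  have B0 : 0 <= B by rewrite /B divr_ge0 ?mulr_ge0 ?exprn_ge0 ?(ltW r0).
  pose h := Num.min (Num.min (e / 2) (r / 2)) (`|a n| / (B + 1) / 2).
  have B1 : 0 < B + 1 by lra.
  have h0 : 0 < h by rewrite !lt_min !divr_gt0.
  have he : h <= e / 2 by rewrite /h !ge_min lexx.
  have hr : h <= r / 2 by rewrite /h !ge_min lexx orbT.
  have hB : h <= `|a n| / (B + 1) / 2 by rewrite /h !ge_min lexx orbT.
  have xx0 : x0 - h - x0 = - h by ring.
  have := pseries_taylor n.+1 r0 aC af (x := x0 - h).
  rewrite xx0 normrN (gtr0_norm h0) => /(_ hr).
  rewrite fz; last by apply/andP; split; lra.
  rewrite sub0r normrN big_nat_recr//= big_nat big1 ?add0r; last first.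
    by move=> i /andP[_ ni]; rewrite IH// mul0r.
  rewrite normrM normrX normrN (gtr0_norm h0) -/B exprS mulrA ler_pM2r ?exprn_gt0//.
  apply/negP; rewrite -ltNge (@le_lt_trans _ _ ((B + 1) * h))//; first by nra.
  by rewrite mulrC -ltr_pdivlMr// (le_lt_trans hB)// ltr_pdivrMr// ltr_pMr ?ltr1n// divr_gt0.
exists r => // x xr; have := af x xr.
rewrite [X in X @ _](_ : _ = cst 0) => [c|]; last first.
  by apply/funext => n; rewrite /pseries /series/= big1// => i _; rewrite a0 mul0r.
by apply/esym/(cvg_unique _ _ c) => //; exact: cvg_cst.
Qed.

(** At the supremum of the t such that f vanishes on ]l, t[, f is analytic and zero on the left,
    hence zero on both sides; the supremum can therefore not lie before u. *)
Lemma real_analytic_identity f (l m u : R) : l < m <= u ->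
  (forall x, l < x <= u -> real_analytic f x) ->
  (forall x, l < x < m -> f x = 0) -> forall x, l < x <= u -> f x = 0.
Proof.
move=> /andP[lm mu] fa fz.
pose S := [set t | t <= u /\ forall x, l < x < t -> f x = 0].
have Sm : S m by split.
have Sub : ubound S u by move=> t [].
have hS : has_sup S by split; [exists m|exists u].
have ms : m <= sup S by exact: sup_upper_bound.
have su : sup S <= u by apply: ge_sup => //; exists m.
have zs x : l < x < sup S -> f x = 0.
  move=> /andP[lx xs]; have [||y [yu Sy] xy] := @sup_adherent _ S (sup S - x) => //.
    by rewrite subr_gt0.
  by apply: Sy; rewrite lx; move: xy; rewrite opprB addrC subrK.
have ls : l < sup S by lra.
have [|||d d0 fd] := @real_analytic_zero_left f (sup S) (sup S - l).
- by apply: fa; rewrite ls.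
- by lra.
- by move=> x ?; apply: zs; lra.
have [eu|neu] := leP u (sup S).
  move=> x /andP[lx xu]; have [xs|xs] := ltP x (sup S); first by apply: zs; rewrite lx.
  have -> : x = sup S by lra.
  by apply: fd; rewrite subrr normr0.
exfalso; pose t := Num.min u (sup S + d).
have St : S t.
  split; first by rewrite /t ge_min lexx.
  move=> x /andP[lx]; rewrite /t lt_min => /andP[xu xd].
  have [xs|xs] := ltP x (sup S); first by apply: zs; rewrite lx.
  by apply: fd; rewrite ger0_norm; lra.
have := sup_upper_bound hS St; rewrite /t leNgt lt_min neu/= ltrDl d0//.
Qed.

End RealAnalytic.

(** * Complex-valued analytic functions *)

Section ComplexAbs.
Context {R : realType}.
Implicit Types z w : R[i].

Lemma cabs_ge0 z : 0 <= cabs z.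
Proof. by case: z => a b; rewrite sqrtr_ge0. Qed.

Lemma normCE z : `|z| = (cabs z)%:C.
Proof. by []. Qed.

Lemma cabsM z w : cabs (z * w) = cabs z * cabs w.
Proof. exact: ComplexField.Normc.normcM. Qed.

Lemma cabsV z : cabs z^-1 = (cabs z)^-1.
Proof. exact: ComplexField.Normc.normcV. Qed.

Lemma cabs1 : cabs 1 = 1 :> R.
Proof. exact: ComplexField.Normc.normc1. Qed.

Lemma cabs0 : cabs 0 = 0 :> R.
Proof. exact: ComplexField.Normc.normc0. Qed.

Lemma cabs_eq0 z : (cabs z == 0) = (z == 0).
Proof.
apply/eqP/eqP => [|->]; last exact: cabs0.
exact: ComplexField.Normc.eq0_normc.
Qed.

Lemma cabs_gt0 z : (0 < cabs z) = (z != 0).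
Proof. by rewrite lt0r cabs_ge0 cabs_eq0 andbT. Qed.

Lemma cabsX z n : cabs (z ^+ n) = cabs z ^+ n.
Proof. by elim: n => [|n IH]; rewrite ?expr0 ?cabs1// !exprS cabsM IH. Qed.

Lemma cabsD z w : cabs (z + w) <= cabs z + cabs w.
Proof. by have := ler_normD z w; rewrite !normCE -rmorphD/= lecR. Qed.

Lemma cabsN z : cabs (- z) = cabs z.
Proof. by have := normrN z; rewrite !normCE => -[]. Qed.

Lemma cabsB z w : cabs (z - w) <= cabs z + cabs w.
Proof. by rewrite -[cabs w]cabsN cabsD. Qed.

Lemma cabsR (x : R) : cabs x%:C = `|x|.
Proof. by rewrite /cabs/= expr0n addr0 sqrtr_sqr. Qed.

Lemma Re_le_cabs z : `|complex.Re z| <= cabs z.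
Proof.
case: z => a b; rewrite /cabs/= -sqrtr_sqr ler_wsqrtr// lerDl sqr_ge0//.
Qed.

Lemma Im_le_cabs z : `|complex.Im z| <= cabs z.
Proof.
case: z => a b; rewrite /cabs/= -sqrtr_sqr ler_wsqrtr// lerDr sqr_ge0//.
Qed.

Lemma cabs_le_ReIm z : cabs z <= `|complex.Re z| + `|complex.Im z|.
Proof.
case: z => a b; rewrite /cabs/= -[leRHS]ger0_norm ?addr_ge0//.
rewrite -sqrtr_sqr ler_wsqrtr// sqrrD -[a ^+ 2]real_normK ?num_real//.
by rewrite -[b ^+ 2]real_normK ?num_real// addrAC lerDl mulrn_wge0// mulr_ge0.
Qed.

Lemma cvgCP (T : Type) (F : set_system T) {FF : Filter F} (f : T -> R[i]) (l : R[i]) :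
  ((f t : R[i]^o) @[t --> F] --> (l : R[i]^o)) <->
  (forall e : R, 0 < e -> \forall t \near F, cabs (l - f t) < e).
Proof.
split=> [/cvgrPdist_lt H e e0|H].
  have := H e%:C; rewrite ltcR => /(_ e0); apply: filterS => t.
  by rewrite normCE ltcR.
(* In the order of R[i], 0 < e forces the imaginary part of e to vanish. *)
apply/cvgrPdist_lt => -[e e']; rewrite ltcE/= => /andP[/eqP -> e0].
by apply: filterS (H e e0) => t; rewrite normCE -[_ +i* _]/(e%:C) ltcR.
Qed.

Lemma complex_ReB z w : complex.Re (z - w) = complex.Re z - complex.Re w.
Proof. by case: z w => [? ?][? ?]. Qed.

Lemma complex_ImB z w : complex.Im (z - w) = complex.Im z - complex.Im w.
Proof. by case: z w => [? ?][? ?]. Qed.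

Lemma cvgC_ReIm (u : nat -> R[i]) (s : R[i]) :
  ((u : nat -> R[i]^o) @ \oo --> (s : R[i]^o)) <->
  ((complex.Re (u n)) @[n --> \oo] --> complex.Re s) /\
  ((complex.Im (u n)) @[n --> \oo] --> complex.Im s).
Proof.
split=> [/cvgCP H|[/cvgrPdist_lt Hr /cvgrPdist_lt Hi]].
  split; apply/cvgrPdist_lt => e /H; apply: filterS => n; apply: le_lt_trans.
    by rewrite -complex_ReB Re_le_cabs.
  by rewrite -complex_ImB Im_le_cabs.
apply/cvgCP => e e0; have e20 : 0 < e / 2 by rewrite divr_gt0.
near=> n; rewrite (le_lt_trans (cabs_le_ReIm _))// complex_ReB complex_ImB (splitr e) ltrD//.
  by near: n; exact: Hr.
by near: n; exact: Hi.
Unshelve. all: by end_near. Qed.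

Lemma Re_scale z (x : R) : complex.Re (z * x%:C) = complex.Re z * x.
Proof. by case: z => a b /=; rewrite mulr0 subr0. Qed.

Lemma Im_scale z (x : R) : complex.Im (z * x%:C) = complex.Im z * x.
Proof. by case: z => a b /=; rewrite mulr0 add0r. Qed.

Lemma Re_sum (I : Type) (r : seq I) (F : I -> R[i]) :
  complex.Re (\sum_(i <- r) F i) = \sum_(i <- r) complex.Re (F i).
Proof.
elim: r => [|i r IH]; first by rewrite !big_nil.
by rewrite !big_cons -IH; case: (F i) (\sum_(_ <- _) _) => [? ?] [? ?].
Qed.

Lemma Im_sum (I : Type) (r : seq I) (F : I -> R[i]) :
  complex.Im (\sum_(i <- r) F i) = \sum_(i <- r) complex.Im (F i).
Proof.
elim: r => [|i r IH]; first by rewrite !big_nil.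
by rewrite !big_cons -IH; case: (F i) (\sum_(_ <- _) _) => [? ?] [? ?].
Qed.

Lemma has_csum_ReIm (a : nat -> R[i]) (h : R) s :
  has_csum (fun n => a n * h%:C ^+ n) s <->
  (pseries (fun n => complex.Re (a n)) h @ \oo --> complex.Re s) /\
  (pseries (fun n => complex.Im (a n)) h @ \oo --> complex.Im s).
Proof.
have Re_pseries : pseries (fun n => complex.Re (a n)) h =
    (fun n => complex.Re (series (fun n => a n * h%:C ^+ n) n)).
  apply/funext => n; rewrite /pseries /series/= Re_sum; apply: eq_bigr => i _.
  by rewrite -rmorphXn/= Re_scale.
have Im_pseries : pseries (fun n => complex.Im (a n)) h =
    (fun n => complex.Im (series (fun n => a n * h%:C ^+ n) n)).
  apply/funext => n; rewrite /pseries /series/= Im_sum; apply: eq_bigr => i _.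
  by rewrite -rmorphXn/= Im_scale.
by rewrite Re_pseries Im_pseries; exact: cvgC_ReIm.
Qed.

Lemma analytic_at_ReIm (f : R -> R[i]) x0 : analytic_at f x0 ->
  real_analytic (fun x => complex.Re (f x)) x0 /\ real_analytic (fun x => complex.Im (f x)) x0.
Proof.
move=> [a [r [r0 af]]].
by split; [exists (fun n => complex.Re (a n))|exists (fun n => complex.Im (a n))];
  exists r; split => // x /af /has_csum_ReIm[].
Qed.

Lemma complex_eq z w : complex.Re z = complex.Re w -> complex.Im z = complex.Im w -> z = w.
Proof. by case: z w => [? ?] [? ?] /= -> ->. Qed.

Lemma has_csum_unique (u : nat -> R[i]) s t : has_csum u s -> has_csum u t -> s = t.
Proof.
move=> /cvgC_ReIm[us1 us2] /cvgC_ReIm[ut1 ut2].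
by apply: complex_eq; [exact: cvg_unique us1 ut1|exact: cvg_unique us2 ut2].
Qed.

Lemma analytic_identity (f g : R -> R[i]) (l m u : R) : l < m <= u ->
  (forall x, l < x <= u -> analytic_at f x) ->
  (forall x, l < x <= u -> analytic_at g x) ->
  (forall x, l < x < m -> f x = g x) -> forall x, l < x <= u -> f x = g x.
Proof.
move=> lmu fa ga fg x lxu; apply: complex_eq; apply/eqP; rewrite -subr_eq0; apply/eqP.
  apply: (@real_analytic_identity _ (fun x => complex.Re (f x) - complex.Re (g x)) l m u) => // y ly.
    by apply: real_analyticB; [case: (analytic_at_ReIm (fa y ly))|case: (analytic_at_ReIm (ga y ly))].
  by rewrite fg// subrr.
apply: (@real_analytic_identity _ (fun x => complex.Im (f x) - complex.Im (g x)) l m u) => // y ly.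
  by apply: real_analyticB; [case: (analytic_at_ReIm (fa y ly))|case: (analytic_at_ReIm (ga y ly))].
by rewrite fg// subrr.
Qed.

(** [analytic_at] gives coefficients without a formula; here they are identified with the
    derivatives, componentwise, since [cderive1n] is componentwise. *)
Lemma cderive1n_coef (q : R -> R[i]) x0 : analytic_at q x0 ->
  exists r C, [/\ 0 < r, (forall n, cabs (cderive1n n q x0 / n`!%:R) * r ^+ n <= C) &
    forall x, `|x - x0| < r ->
      has_csum (fun n => cderive1n n q x0 / n`!%:R * (x - x0)%:C ^+ n) (q x)].
Proof.
move=> [a [r [r0 aq]]].
have [||C1 C10 aC1] := @pseries_coef_bound _ (fun n => complex.Re (a n)) (r / 2).
- by rewrite divr_gt0.
- apply/cvg_ex; exists (complex.Re (q (x0 + r / 2))).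
  have := aq (x0 + r / 2); rewrite addrAC subrr add0r.
  have -> : `|r / 2| < r by rewrite gtr0_norm; lra.
  by move=> /(_ isT)/has_csum_ReIm[].
have [||C2 C20 aC2] := @pseries_coef_bound _ (fun n => complex.Im (a n)) (r / 2).
- by rewrite divr_gt0.
- apply/cvg_ex; exists (complex.Im (q (x0 + r / 2))).
  have := aq (x0 + r / 2); rewrite addrAC subrr add0r.
  have -> : `|r / 2| < r by rewrite gtr0_norm; lra.
  by move=> /(_ isT)/has_csum_ReIm[].
have r20 : 0 < r / 2 by rewrite divr_gt0.
have ca n : cderive1n n q x0 / n`!%:R = a n.
  have n0 : (n`!%:R : R) != 0 by rewrite pnatr_eq0 -lt0n fact_gt0.
  have n0' : (n`!%:R : R[i]) != 0 by rewrite pnatr_eq0 -lt0n fact_gt0.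
  apply: (mulIf n0'); rewrite divfK//.
  have -> : (n`!%:R : R[i]) = (n`!%:R : R)%:C by rewrite rmorph_nat.
  apply: complex_eq; rewrite /= ?Re_scale ?Im_scale mulrC.
    apply: (real_analytic_derive1n r20 aC1) => x xr.
    have xr2 : `|x - x0| < r by lra.
    by have /has_csum_ReIm[] := aq x xr2.
  apply: (real_analytic_derive1n r20 aC2) => x xr.
  have xr2 : `|x - x0| < r by lra.
    by have /has_csum_ReIm[] := aq x xr2.
exists (r / 2), (C1 + C2); split => // [n|x xr].
  rewrite ca (@le_trans _ _ ((`|complex.Re (a n)| + `|complex.Im (a n)|) * (r / 2) ^+ n))//.
    by rewrite ler_wpM2r ?cabs_le_ReIm// exprn_ge0// ltW.
  by rewrite mulrDl lerD.
under eq_fun do rewrite ca.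
by apply: aq; apply: lt_trans xr _; lra.
Qed.

Lemma analytic_taylor (q : R -> R[i]) (m : nat) : analytic_at q 0 ->
  exists r C, [/\ 0 < r, 0 <= C & forall x, `|x| <= r ->
    cabs (q x - \sum_(0 <= i < m) cderive1n i q 0 / i`!%:R * x%:C ^+ i) <= C * `|x| ^+ m].
Proof.
move=> /cderive1n_coef[r [C [r0 aC aq]]].
have C0 : 0 <= C by apply: le_trans (aC 0%N); rewrite expr0 mulr1 cabs_ge0.
exists (r / 2), (2 * (2 * C / r ^+ m)); split => [||x xr].
- by rewrite divr_gt0.
- by rewrite !(mulr_ge0, divr_ge0, exprn_ge0, invr_ge0)// ltW.
set a := fun n => cderive1n n q 0 / n`!%:R.
have aCr n : `|complex.Re (a n)| * r ^+ n <= C.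
  by apply: le_trans (aC n); rewrite ler_wpM2r ?exprn_ge0 ?(ltW r0) ?Re_le_cabs.
have aCi n : `|complex.Im (a n)| * r ^+ n <= C.
  by apply: le_trans (aC n); rewrite ler_wpM2r ?exprn_ge0 ?(ltW r0) ?Im_le_cabs.
have hr y : `|y - 0| < r -> pseries (fun n => complex.Re (a n)) (y - 0) @ \oo --> complex.Re (q y).
  by move=> /aq/has_csum_ReIm[].
have hi y : `|y - 0| < r -> pseries (fun n => complex.Im (a n)) (y - 0) @ \oo --> complex.Im (q y).
  by move=> /aq/has_csum_ReIm[].
rewrite (le_trans (cabs_le_ReIm _))// (_ : 2 * _ * _ = 2 * C / r ^+ m * `|x| ^+ m + 2 * C / r ^+ m * `|x| ^+ m); last by ring.
have xr' : `|x - 0| <= r / 2 by rewrite subr0.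
apply: lerD.
  have := pseries_taylor m r0 aCr hr xr'; rewrite subr0; apply: le_trans.
  rewrite le_eqVlt; apply/orP; left; apply/eqP; congr `|_|.
  rewrite complex_ReB Re_sum; congr (_ - _); apply: eq_bigr => i _.
  by rewrite -rmorphXn/= Re_scale.
have := pseries_taylor m r0 aCi hi xr'; rewrite subr0; apply: le_trans.
rewrite le_eqVlt; apply/orP; left; apply/eqP; congr `|_|.
rewrite complex_ImB Im_sum; congr (_ - _); apply: eq_bigr => i _.
by rewrite -rmorphXn/= Im_scale.
Qed.

End ComplexAbs.

(** * The radius of convergence *)

Section TaylorRadius.
Context {R : realType}.
Implicit Types c : nat -> R[i].

Lemma cabs_divn (z : R[i]) n : cabs (z / n%:R) = cabs z / n%:R.
Proof. by rewrite cabsM cabsV -(rmorph_nat (real_complex R)) cabsR normr_nat. Qed.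

(** Cauchy-Hadamard: the k-th roots are at most C' / r, so their upper limit is finite. *)
Lemma taylor_radius_gt0 c (r C : R) : 0 < r ->
  (forall n, cabs (c n / n`!%:R) * r ^+ n <= C) -> (0 < taylor_radius c)%E.
Proof.
move=> r0 cC; have {}cC n : cabs (c n) / n`!%:R * r ^+ n <= C by rewrite -cabs_divn.
rewrite /taylor_radius; set u := fun k => _.
have u0 k : (0%:E <= u k)%E by rewrite lee_fin powR_ge0.
(* C' >= 1 yields C <= C' <= C'^k for k >= 1, so the k-th root is bounded by C' / r. *)
pose C' := Num.max C 1; have C1 : 1 <= C' by rewrite le_max lexx orbT.
have C0 : 0 < C' by apply: lt_le_trans C1.
have uB : (limn_esup u <= (C' / r)%:E)%E.
  (* The index 0 is left out: its exponent 0^-1 is 0, so u 0 = 1 whatever c 0 is. *)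
  apply: le_trans (_ : ereal_sup [set u x | x in [set n | (1 <= n)%N]] <= _)%E.
    by apply: ereal_inf_lbound; exists [set n | (1 <= n)%N] => //; exists 1%N.
  apply: ge_ereal_sup => _ [k /= k1 <-]; rewrite lee_fin.
  have -> : C' / r = powR ((C' / r) ^+ k) k%:R^-1.
    rewrite -powR_mulrn ?divr_ge0 ?(ltW r0) ?(ltW C0)// -powRrM divff ?powRr1//.
      by rewrite divr_ge0 ?(ltW r0) ?(ltW C0).
    by rewrite pnatr_eq0 -lt0n.
  apply: ge0_ler_powR.
  - by rewrite invr_ge0.
  - by rewrite nnegrE divr_ge0 ?cabs_ge0.
  - by rewrite nnegrE exprn_ge0// divr_ge0 ?(ltW r0) ?(ltW C0).
  rewrite expr_div_n ler_pdivlMr ?exprn_gt0//.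
  apply: le_trans (cC k) _; apply: (@le_trans _ _ C'); first by rewrite le_max lexx.
  by rewrite ler_eXnr.
have L0 : (0 <= limn_esup u)%E.
  apply: le_ereal_inf_tmp => _ [V [N _ NV] <-].
  apply: le_trans (u0 N) _; apply: ereal_sup_ubound; exists N => //; apply: NV => /=.
  exact: leqnn.
have [->|Ln0] := eqVneq (limn_esup u) 0%E; first by rewrite inve0.
rewrite inve_gt0//; first by rewrite lt_neqAle eq_sym Ln0.
by rewrite lt_eqF// (le_lt_trans uB) ?ltry.
Qed.

(** The root test in the other direction: from some index on the terms are at most 1, and the
    finitely many earlier ones are covered by their sum. *)
Lemma taylor_radius_bound c (x : R) : 0 < x -> (x%:E < taylor_radius c)%E ->
  exists C, forall n, cabs (c n / n`!%:R) * x ^+ n <= C.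
Proof.
move=> x0; rewrite /taylor_radius; set u := fun k => _ => xL.
have u0 k : (0%:E <= u k)%E by rewrite lee_fin powR_ge0.
have L0 : (0 <= limn_esup u)%E.
  apply: le_ereal_inf_tmp => _ [V [N _ NV] <-].
  apply: le_trans (u0 N) _; apply: ereal_sup_ubound; exists N => //; apply: NV => /=.
  exact: leqnn.
have : (limn_esup u < (x^-1)%:E)%E.
  move: xL; rewrite inve_pgt ?inE ?lee_fin ?(ltW x0)//.
  by rewrite inver gt_eqF.
move=> /ereal_inf_lt[_ [V [N _ NV] <-]] Vx.
suff [C cC] : exists C, forall n, cabs (c n) / n`!%:R * x ^+ n <= C.
  by exists C => n; rewrite cabs_divn.
exists (1 + \sum_(0 <= k < N.+1) cabs (c k) / k`!%:R * x ^+ k) => n.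
have t0 k : 0 <= cabs (c k) / k`!%:R * x ^+ k.
  by rewrite mulr_ge0 ?divr_ge0 ?cabs_ge0// exprn_ge0// ltW.
have [nN|Nn] := ltnP n N.+1.
  rewrite big_mkord (bigD1 (Ordinal nN))//= addrCA lerDl addr_ge0// sumr_ge0//.
rewrite ler_wpDr ?sumr_ge0//.
have un : powR ((cabs (c n) / n`!%:R)) n%:R^-1 < x^-1.
  rewrite -lte_fin; apply: le_lt_trans Vx; apply: ereal_sup_ubound.
  by exists n => //; apply: NV => /=; apply: ltnW.
have n0 : (0 < n)%N by apply: leq_trans Nn.
have -> : (cabs (c n) / n`!%:R) = (powR ((cabs (c n) / n`!%:R)) n%:R^-1) ^+ n.
  rewrite -powR_mulrn ?powR_ge0// -powRrM mulVf ?powRr1 ?divr_ge0 ?cabs_ge0//.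
  by rewrite pnatr_eq0 -lt0n.
rewrite -exprMn exprn_ile1 ?mulr_ge0 ?powR_ge0 ?(ltW x0)//.
by rewrite ltW// -ltr_pdivlMr// div1r.
Qed.

Lemma taylor_radius_ltR c (x : R) : (x%:E < taylor_radius c)%E ->
  exists2 y, x < y & (y%:E < taylor_radius c)%E.
Proof.
case: (taylor_radius c) => [r||] //=.
  by rewrite lte_fin => xr; exists ((x + r) / 2); rewrite ?lte_fin; lra.
by move=> _; exists (x + 1); rewrite ?ltry// ltrDl.
Qed.

(** The expansion of q at 0 is known to represent q only on some small interval. On ]0, x] both q
    and the sum of the series are analytic, so their agreement near 0 propagates to x. *)
Lemma taylor_series_eq (q : R -> R[i]) (x : R) : 0 < x ->
  (forall y, 0 <= y <= x -> analytic_at q y) ->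
  (x%:E < taylor_radius (fun k => cderive1n k q 0))%E ->
  has_csum (taylor_term (fun k => cderive1n k q 0) x) (q x).
Proof.
move=> x0 qa xrad.
have [z xz zrad] := taylor_radius_ltR xrad.
have z0 : 0 < z by apply: lt_trans xz.
have [C cC] := taylor_radius_bound z0 zrad.
have [|r [C' [r0 cC' qr]]] := @cderive1n_coef _ q 0; first by apply: qa; rewrite lexx ltW.
set c := fun n : nat => cderive1n n q 0 / n`!%:R in cC cC' qr.
(* [p] stands for the real or the imaginary part. *)
have part (p : R[i] -> R) :
    (forall w, `|p w| <= cabs w) ->
    (forall y, 0 <= y <= x -> real_analytic (fun x => p (q x)) y) ->
    (forall y, `|y| < r -> pseries (fun n => p (c n)) y @ \oo --> p (q y)) ->
    pseries (fun n => p (c n)) x @ \oo --> p (q x).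
  move=> pc pa pq; set a := fun n => p (c n).
  have az : radius_ge a z.
    apply: (@bound_radius_ge _ _ C) => n; apply: le_trans (cC n).
    by apply: ler_wpM2r; [rewrite exprn_ge0 ?(ltW z0)|exact: pc].
  have xz' : `|x| < z by rewrite gtr0_norm.
  have -> : p (q x) = limn (pseries a x); last exact: radius_ge_cvg az xz'.
  apply/eqP; rewrite -subr_eq0; apply/eqP.
  apply: (@real_analytic_identity _ (fun x => p (q x) - limn (pseries a x)) 0 (Num.min r x) x).
  - by rewrite lt_min r0 x0 ge_min lexx orbT.
  - move=> y /andP[y0 yx]; apply: real_analyticB; first by apply: pa; rewrite ltW.
    by apply: (pseries_recenter az); rewrite gtr0_norm//; lra.
  - move=> y; rewrite lt_min => /and3P[y0 yr yx].
    by rewrite (cvg_lim _ (pq y _)) ?subrr// gtr0_norm.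
  - by rewrite x0 lexx.
rewrite (_ : taylor_term _ x = fun n => c n * x%:C ^+ n); last first.
  by apply/funext => n; rewrite /taylor_term /c mulrAC.
apply/has_csum_ReIm; split.
  have := part (@complex.Re R); apply => [w|y /qa/analytic_at_ReIm[]//|y yr]; first exact: Re_le_cabs.
  by have := qr y; rewrite subr0 => /(_ yr)/has_csum_ReIm[].
have := part (@complex.Im R); apply => [w|y /qa/analytic_at_ReIm[]//|y yr]; first exact: Im_le_cabs.
by have := qr y; rewrite subr0 => /(_ yr)/has_csum_ReIm[].
Qed.

Lemma taylor_recovery (q : R -> R[i]) (hq : analytic_on `[0, pi] q) :
  let q_ k := cderive1n k q 0 in
  let rad := taylor_radius q_ in
  (0 < rad)%E /\
  (forall x : R, 0 < x <= pi -> (x%:E < rad)%E ->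
     has_csum (taylor_term q_ x) (q x)) /\
  ((rad < pi%:E)%E ->
     forall f : R -> R[i], analytic_on `]0, pi[ f ->
       (forall x : R, 0 < x -> (x%:E < rad)%E ->
          has_csum (taylor_term q_ x) (f x)) ->
       forall x : R, (rad < x%:E)%E -> x < pi -> f x = q x).
Proof.
move=> q_ rad.
have qa y : 0 <= y <= pi -> analytic_at q y.
  by move=> y0; apply: hq; rewrite /= in_itv.
have rad0 : (0 < rad)%E.
  have [|r [C [r0 cC _]]] := @cderive1n_coef _ q 0.
    by apply: qa; rewrite lexx pi_ge0.
  exact: taylor_radius_gt0 r0 cC.
have tay x : 0 < x <= pi -> (x%:E < rad)%E -> has_csum (taylor_term q_ x) (q x).
  move=> /andP[x0 xpi] xrad; apply: taylor_series_eq => // y /andP[y0 yx].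
  by apply: qa; rewrite y0 (le_trans yx).
split => //; split => // radpi f fa ft x radx xpi.
move: rad0 radpi radx tay ft; case: rad => [r||]//; rewrite !lte_fin => r0 rpi rx tay ft.
(* On ]0, r[ both functions are sums of the same series, and both are analytic on ]0, x]. *)
apply: (@analytic_identity _ f q 0 r x).
- by rewrite r0 ltW.
- by move=> y /andP[y0 yx]; apply: fa; rewrite /= in_itv/= y0 (le_lt_trans yx).
- by move=> y /andP[y0 yx]; apply: qa; rewrite ltW//= (le_trans yx)// ltW.
- move=> y /andP[y0 yr]; apply: (@has_csum_unique _ (taylor_term q_ y)).
    by apply: ft; rewrite ?lte_fin.
  by apply: tay; rewrite ?lte_fin// y0 ltW// (lt_trans yr).
- by rewrite (lt_trans r0)//= lexx.
Qed.

End TaylorRadius.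

(** * Integration by parts for absolutely continuous functions *)

Section RealIntegrals.
Context {R : realType}.
Local Notation mu := (@lebesgue_measure R).
Local Notation itg D f := (mu.-integrable D (EFin \o f)).
Implicit Types (f g h : R -> R) (D : set R).

(** A class of multipliers of integrable functions, closed under sums and products; on compact
    intervals it contains the continuous and the absolutely continuous functions. *)
Definition bmeas D f := measurable_fun D f /\ exists B, forall x, D x -> `|f x| <= B.

Lemma bmeas_bounded D f : bmeas D f -> [bounded f x | x in D].
Proof.
move=> [_ [B fB]]; exists B; split; first exact: num_real.
by move=> C BC x Dx; exact: le_trans (fB _ Dx) (ltW BC).
Qed.

Lemma bmeas_within_continuous a b f : {within `[a, b], continuous f} -> bmeas `[a, b] f.
Proof.
move=> cf; split.
  exact: (@subspace_continuous_measurable_fun _ `[a, b]).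
have [ba|ab] := ltP b a.
  by exists 0 => x /=; rewrite in_itv/= => /andP[ax xb]; lra.
have [c1 c1ab fc1] := EVT_max ab cf.
have [c2 c2ab fc2] := EVT_min ab cf.
exists (`|f c1| + `|f c2|) => x xab.
have := fc1 x xab; have := fc2 x xab.
have := ler_norm (f c1); have := ler_norm (- f c2); rewrite normrN => *.
have := normr_ge0 (f c1); have := normr_ge0 (f c2) => *.
by rewrite ler_norml; apply/andP; split; lra.
Qed.

Lemma bmeas_continuous a b f : continuous f -> bmeas `[a, b] f.
Proof. by move=> cf; apply: bmeas_within_continuous; exact: continuous_subspaceT. Qed.

Lemma bmeasS D E f : measurable D -> measurable E -> D `<=` E -> bmeas E f -> bmeas D f.
Proof.
move=> mD mE DE [mf [B fB]]; split; first exact: measurable_funS mf.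
by exists B => x /DE; exact: fB.
Qed.

Lemma bmeasM D f g : bmeas D f -> bmeas D g -> bmeas D (fun x => f x * g x).
Proof.
move=> [mf [B fB]] [mg [C gC]]; split; first exact: measurable_funM.
by exists (B * C) => x Dx; rewrite normrM ler_pM ?fB ?gC.
Qed.

Lemma bmeasD D f g : bmeas D f -> bmeas D g -> bmeas D (fun x => f x + g x).
Proof.
move=> [mf [B fB]] [mg [C gC]]; split; first exact: measurable_funD.
by exists (B + C) => x Dx; rewrite (le_trans (ler_normD _ _))// lerD ?fB ?gC.
Qed.

Lemma bmeasB D f g : bmeas D f -> bmeas D g -> bmeas D (fun x => f x - g x).
Proof.
move=> [mf [B fB]] [mg [C gC]]; split; first exact: measurable_funB.
by exists (B + C) => x Dx; rewrite (le_trans (ler_normB _ _))// lerD ?fB ?gC.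
Qed.

Lemma bmeas_cst D (c : R) : bmeas D (fun=> c).
Proof. by split; [exact: measurable_cst|exists `|c|]. Qed.

Lemma itgM_bmeas D f g : measurable D -> bmeas D f -> itg D g -> itg D (fun x => f x * g x).
Proof.
move=> mD bf ig; rewrite (_ : EFin \o _ = (EFin \o f) \* (EFin \o g))%E.
  by apply: integrableMr => //; [case: bf|exact: bmeas_bounded].
by apply/funext => x /=; rewrite EFinM.
Qed.

Lemma itg_cst (a b c : R) : itg `[a, b] (fun=> c).
Proof.
apply: continuous_compact_integrable; first exact: segment_compact.
by apply: continuous_subspaceT => x; exact: cvg_cst.
Qed.

Lemma itg_bmeas (a b : R) f : bmeas `[a, b] f -> itg `[a, b] f.
Proof.
move=> bf; have := itgM_bmeas (measurable_itv _) bf (itg_cst a b 1).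
by congr (mu.-integrable _ _); apply/funext => x /=; rewrite mulr1.
Qed.

Lemma itgD D f g : measurable D -> itg D f -> itg D g -> itg D (fun x => f x + g x).
Proof.
move=> mD fi gi; rewrite (_ : EFin \o _ = (EFin \o f) \+ (EFin \o g))%E.
  exact: integrableD.
by apply/funext => x /=; rewrite EFinD.
Qed.

Lemma itgB D f g : measurable D -> itg D f -> itg D g -> itg D (fun x => f x - g x).
Proof.
move=> mD fi gi; rewrite (_ : EFin \o _ = (EFin \o f) \- (EFin \o g))%E.
  exact: integrableB.
by apply/funext => x /=; rewrite EFinB.
Qed.

Lemma itg_norm D f : measurable D -> itg D f -> itg D (fun x => `|f x|).
Proof.
move=> mD fi; rewrite (_ : EFin \o _ = (abse \o (EFin \o f))).
  exact: integrable_abse.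
by apply/funext => x.
Qed.

Lemma itgZ D (c : R) f : measurable D -> itg D f -> itg D (fun x => c * f x).
Proof. by move=> mD fi; apply: itgM_bmeas => //; exact: bmeas_cst. Qed.

Lemma itgS D E f : measurable D -> measurable E -> D `<=` E -> itg E f -> itg D f.
Proof. by move=> mD mE DE; exact: integrableS. Qed.

Lemma itg_meas D f : itg D f -> measurable_fun D f.
Proof. by move=> /measurable_int/measurable_EFinP. Qed.

Lemma indefinite_continuous (a b c : R) g : a <= b -> itg `[a, b] g ->
  {within `[a, b], continuous (fun x => c + \int[mu]_(t in `[a, x]) g t)}.
Proof.
move=> ab ig x; apply: cvgD; first exact: cvg_cst.
exact: (@parameterized_integral_continuous _ a b g ab ig).
Qed.

Lemma eq_Rintegral_itv D f g : (forall x, D x -> f x = g x) ->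
  \int[mu]_(x in D) f x = \int[mu]_(x in D) g x.
Proof. by move=> fg; apply: eq_Rintegral => x /set_mem; exact: fg. Qed.

Lemma Rintegral_FTC2 (F f : R -> R) (a b : R) : a <= b -> continuous f ->
  (forall x, is_derive x (1 : R) F (f x)) ->
  \int[mu]_(x in `[a, b]) f x = F b - F a.
Proof.
rewrite le_eqVlt => /orP[/eqP <- _ _|ab cf dF].
  by rewrite set_itv1 Rintegral_set1 subrr.
have cF x : {for x, continuous F}.
  by apply: differentiable_continuous; apply/derivable1_diffP; exact: @ex_derive.
rewrite /Rintegral (@continuous_FTC2 _ f F)//.
- exact: continuous_subspaceT.
- split; first by move=> x _; exact: @ex_derive.
  + by apply: cvg_at_right_filter; exact: cF.
  + by apply: cvg_at_left_filter; exact: cF.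
- by move=> x _; rewrite derive1E; exact: @derive_val.
Qed.

Lemma measurable_indic_le : measurable_fun [set: R * R] (fun p : R * R => ((p.2 <= p.1)%R%:R : R)).
Proof.
have m : measurable [set p : R * R | p.2 <= p.1].
  rewrite -[X in measurable X]setTI; apply: measurable_fun_le => //.
have := @measurable_indic _ _ R [set: R * R] [set p : R * R | p.2 <= p.1] m.
congr (measurable_fun _ _); apply/funext => p.
rewrite indicE; have [h|h] := boolP (p.2 <= p.1); first by rewrite mem_set.
by rewrite memNset//=; apply/negP.
Qed.

(** Both functions are extended by zero and multiplied by the indicator of t <= s; Tonelli bounds
    the result by the product of the two L^1 norms, so Fubini applies. *)
Lemma triangle_Fubini (b : R) (p g : R -> R) : 0 <= b ->
  itg `[0, b] p -> itg `[0, b] g ->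
  \int[mu]_(s in `[0, b]) (p s * \int[mu]_(t in `[0, s]) g t) =
  \int[mu]_(t in `[0, b]) (g t * \int[mu]_(s in `[t, b]) p s).
Proof.
move=> b0 ip ig.
pose p' := p \_ `[0, b]; pose g' := g \_ `[0, b].
have ip' : itg setT p'.
  by rewrite /p' -restrict_EFin; apply/integrable_restrict => //; rewrite setTI.
have ig' : itg setT g'.
  by rewrite /g' -restrict_EFin; apply/integrable_restrict => //; rewrite setTI.
pose f (z : R * R) := p' z.1 * g' z.2 * (z.2 <= z.1)%R%:R.
have mf : measurable_fun setT f.
  apply: measurable_funM; last exact: measurable_indic_le.
  apply: measurable_funM.
    by apply: measurableT_comp; [exact: itg_meas ip'|exact: measurable_fst].
  by apply: measurableT_comp; [exact: itg_meas ig'|exact: measurable_snd].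
have if_ : (mu \x mu)%E.-integrable setT (EFin \o f).
  apply/integrable12ltyP; first exact/measurable_EFinP.
  apply: (@le_lt_trans _ _ (\int[mu]_x (`|p' x|%:E * \int[mu]_y `|g' y|%:E))%E).
    apply: ge0_le_integral => //.
    - by move=> x _; exact: integral_ge0.
    - apply: (@measurable_fun_fubini_tonelli_F _ _ _ _ _ mu (fun z => `|f z|%:E)) => //.
      by apply/measurable_EFinP; apply: measurableT_comp mf.
    - apply: emeasurable_funM => //.
      by apply/measurable_EFinP; apply: measurableT_comp (itg_meas ip').
    move=> x _; rewrite -ge0_integralZl ?lee_fin//; last first.
      by apply/measurable_EFinP; apply: measurableT_comp (itg_meas ig').
    apply: ge0_le_integral => //.
    - apply/measurable_EFinP; apply: measurableT_comp => //.
      exact: (measurable_fun_pair2 x mf).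
    - apply/measurable_EFinP; apply: measurable_funM; first exact: measurable_cst.
      by apply: measurableT_comp (itg_meas ig').
    - move=> y _; rewrite lee_fin /f/= !normrM normr_nat -mulrA ler_wpM2l// ler_piMr//.
      by case: (y <= x); rewrite ?lexx ?ler01.
  have ig'' := itg_norm measurableT ig'.
  have igy : (\int[mu]_y `|g' y|%:E < +oo)%E.
    by move/integrableP : ig' => [_].
  have igf : (\int[mu]_y `|g' y|%:E)%E \is a fin_num.
    by rewrite ge0_fin_numE// integral_ge0.
  rewrite -(fineK igf) ge0_integralZr ?lee_fin ?fine_ge0 ?integral_ge0//; last first.
    by apply/measurable_EFinP; apply: measurableT_comp (itg_meas ip').
  apply: lte_mul_pinfty; first by rewrite integral_ge0.
    rewrite ge0_fin_numE ?integral_ge0//.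
    by move/integrableP : ip' => [_].
  by rewrite ltry.
have := Fubini if_.
have L : (\int[mu]_x \int[mu]_y (EFin \o f) (x, y) =
   \int[mu]_(s in `[0%R, b]) (p s * \int[mu]_(t in `[0%R, s]) g t)%R%:E)%E.
  rewrite [RHS]integral_mkcond; apply: eq_integral => s _.
  rewrite patchE; case: ifPn => [/set_mem|/negP sb]; last first.
    rewrite integral0_eq// => t _ /=; rewrite /f/= /p' patchE ifN ?mul0r//.
    exact/negP.
  rewrite /= in_itv/= => /andP[s0 sb].
  rewrite (_ : \int[mu]_y _ = \int[mu]_(y in `[0%R, s]) (p s * g y)%:E)%E; last first.
    rewrite [RHS]integral_mkcond; apply: eq_integral => t _.
    rewrite patchE /f/= /p' /g' !patchE !mem_setE !in_itv/= s0 sb/=.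
    have [t0|t0] /= := boolP (0 <= t); last by rewrite mulr0 mul0r.
    have [ts|ts] /= := boolP (t <= s); last by rewrite mulr0.
    by rewrite (le_trans ts sb) mulr1.
  have igs : itg `[0, s] g.
    apply: (@integrableS _ _ _ mu `[0, b] `[0, s] (EFin \o g)) => //.
    by move=> t; rewrite /= !in_itv/= => /andP[-> ts]; exact: le_trans sb.
  rewrite -(@RintegralZl _ _ _ mu `[0, s] g (p s))// /Rintegral fineK//.
  by apply: integrable_fin_num => //; exact: itgZ.
have RR : (\int[mu]_y \int[mu]_x (EFin \o f) (x, y) =
   \int[mu]_(t in `[0%R, b]) (g t * \int[mu]_(s in `[t, b]) p s)%R%:E)%E.
  rewrite [RHS]integral_mkcond; apply: eq_integral => t _.
  rewrite patchE; case: ifPn => [/set_mem|/negP tb]; last first.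
    rewrite integral0_eq// => s _ /=; rewrite /f/= /g' patchE ifN ?mulr0 ?mul0r//.
    exact/negP.
  rewrite /= in_itv/= => /andP[t0 tb].
  rewrite (_ : \int[mu]_x _ = \int[mu]_(x in `[t, b]) (g t * p x)%:E)%E; last first.
    rewrite [RHS]integral_mkcond; apply: eq_integral => s _.
    rewrite patchE /f/= /p' /g' !patchE !mem_setE !in_itv/= t0 tb/=.
    have [sb|sb] /= := boolP (s <= b); last by rewrite andbF !andbF !mul0r.
    have [ts|ts] /= := boolP (t <= s); last by rewrite mulr0.
    by rewrite (le_trans t0 ts) mulr1 mulrC.
  have ips : itg `[t, b] p.
    apply: (@integrableS _ _ _ mu `[0, b] `[t, b] (EFin \o p)) => //.
    by move=> s; rewrite /= !in_itv/= => /andP[ts ->]; rewrite (le_trans t0).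
  rewrite -(@RintegralZl _ _ _ mu `[t, b] p (g t))// /Rintegral fineK//.
  by apply: integrable_fin_num => //; exact: itgZ.
by rewrite L RR /Rintegral => ->.
Qed.

(** Since g is only integrable, G need not be differentiable everywhere; exchanging the integrals
    over the triangle replaces the product rule. *)
Lemma ac_integration_by_parts (phi dphi g : R -> R) (G0 b : R) : 0 <= b ->
  (forall x, is_derive x (1 : R) phi (dphi x)) -> continuous dphi -> itg `[0, b] g ->
  let G x := G0 + \int[mu]_(t in `[0, x]) g t in
  \int[mu]_(x in `[0, b]) (phi x * g x + dphi x * G x) = phi b * G b - phi 0 * G 0.
Proof.
move=> b0 dF cdphi ig G.
have cphi : continuous phi.
  by move=> x; apply: differentiable_continuous; apply/derivable1_diffP; exact: @ex_derive.
have mb : measurable (`[0, b] : set R) by exact: measurable_itv.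
have bphi := bmeas_continuous 0 b cphi.
have bdphi := bmeas_continuous 0 b cdphi.
have bG : bmeas `[0, b] G.
  by apply: bmeas_within_continuous; exact: indefinite_continuous.
have bI : bmeas `[0, b] (fun x => \int[mu]_(t in `[0, x]) g t).
  have := bmeasB bG (bmeas_cst `[0, b] G0).
  by congr bmeas; apply/funext => x; rewrite /G addrC addKr.
have G0E : G 0 = G0 by rewrite /G set_itv1 Rintegral_set1 addr0.
rewrite RintegralD//; [|exact: itgM_bmeas|exact: itg_bmeas (bmeasM bdphi bG)].
have -> : \int[mu]_(x in `[0, b]) (dphi x * G x) =
    G0 * (phi b - phi 0) + \int[mu]_(x in `[0, b]) (dphi x * \int[mu]_(t in `[0, x]) g t).
  rewrite -(Rintegral_FTC2 b0 cdphi dF) -RintegralZl//; last exact: itg_bmeas.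
  rewrite -RintegralD//; last 2 first.
  - by apply: itgZ => //; exact: itg_bmeas.
  - by apply: itg_bmeas; exact: bmeasM.
  by apply: eq_Rintegral_itv => x _; rewrite /G; ring.
rewrite (triangle_Fubini b0 (itg_bmeas bdphi) ig).
rewrite (@eq_Rintegral_itv _ (fun t => g t * _) (fun t => phi b * g t - phi t * g t)); last first.
  move=> t; rewrite /= in_itv/= => /andP[t0 tb].
  by rewrite (Rintegral_FTC2 tb cdphi dF); ring.
rewrite RintegralB//; [|exact: itgZ|exact: itgM_bmeas].
rewrite RintegralZl// G0E /G; ring.
Qed.

End RealIntegrals.

(** * Complex-valued integrals *)

(* Locked, for otherwise rewriting with complex_ReM sees through cexp. *)
HB.lock Definition cexp {R : realType} (z : R[i]) : R[i] :=
  (expR (complex.Re z))%:C * (cos (complex.Im z) +i* sin (complex.Im z)).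

Section ComplexIntegrals.
Context {R : realType}.
Local Notation mu := (@lebesgue_measure R).
Local Notation itg D f := (mu.-integrable D (EFin \o f)).
Local Notation Re := (@complex.Re R).
Local Notation Im := (@complex.Im R).
Implicit Types (f g : R -> R[i]) (D : set R) (z w : R[i]).

Lemma complex_ReM z w : Re (z * w) = Re z * Re w - Im z * Im w.
Proof. by case: z w => [? ?] [? ?]. Qed.

Lemma complex_ImM z w : Im (z * w) = Re z * Im w + Im z * Re w.
Proof. by case: z w => [? ?] [? ?]. Qed.

Lemma complex_ReD z w : Re (z + w) = Re z + Re w.
Proof. by case: z w => [? ?] [? ?]. Qed.

Lemma complex_ImD z w : Im (z + w) = Im z + Im w.
Proof. by case: z w => [? ?] [? ?]. Qed.

Lemma Re_cexp z : Re (cexp z) = expR (Re z) * cos (Im z).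
Proof. by rewrite unlock complex_ReM /= mul0r subr0. Qed.

Lemma Im_cexp z : Im (cexp z) = expR (Re z) * sin (Im z).
Proof. by rewrite unlock complex_ImM /= mul0r addr0. Qed.

Lemma cabs_cexp z : cabs (cexp z) = expR (Re z).
Proof.
rewrite unlock cabsM cabsR ger0_norm ?expR_ge0// /cabs/= cos2Dsin2 sqrtr1 mulr1//.
Qed.

Lemma cexp0 : cexp (0 : R[i]) = 1.
Proof. by apply: complex_eq; rewrite ?Re_cexp ?Im_cexp/= expR0 ?cos0 ?sin0 ?mulr1 ?mulr0. Qed.

Lemma cexpD z w : cexp (z + w) = cexp z * cexp w.
Proof.
apply: complex_eq; rewrite ?complex_ReM ?complex_ImM !Re_cexp !Im_cexp complex_ReD complex_ImD expRD ?cosD ?sinD; ring.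
Qed.

Lemma is_derive_Re_cexp (al : R[i]) (x : R) :
  is_derive x (1 : R) (fun x : R => Re (cexp (al * x%:C))) (Re (al * cexp (al * x%:C))).
Proof.
have -> : (fun x : R => Re (cexp (al * x%:C))) =
    (fun x => expR (Re al * x) * cos (Im al * x)).
  by apply/funext => y; rewrite Re_cexp Re_scale Im_scale.
rewrite complex_ReM Re_cexp Im_cexp Re_scale Im_scale.
apply: is_derive_eq; rewrite /GRing.scale/=; ring.
Qed.

Lemma is_derive_Im_cexp (al : R[i]) (x : R) :
  is_derive x (1 : R) (fun x : R => Im (cexp (al * x%:C))) (Im (al * cexp (al * x%:C))).
Proof.
have -> : (fun x : R => Im (cexp (al * x%:C))) =
    (fun x => expR (Re al * x) * sin (Im al * x)).
  by apply/funext => y; rewrite Im_cexp Re_scale Im_scale.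
rewrite complex_ImM Re_cexp Im_cexp Re_scale Im_scale.
apply: is_derive_eq; rewrite /GRing.scale/=; ring.
Qed.

Lemma continuous_Re_cexp al : continuous (fun x : R => Re (cexp (al * x%:C))).
Proof.
move=> x; apply: differentiable_continuous; apply/derivable1_diffP.
exact: (@ex_derive _ _ _ _ _ _ _ (is_derive_Re_cexp al x)).
Qed.

Lemma continuous_Im_cexp al : continuous (fun x : R => Im (cexp (al * x%:C))).
Proof.
move=> x; apply: differentiable_continuous; apply/derivable1_diffP.
exact: (@ex_derive _ _ _ _ _ _ _ (is_derive_Im_cexp al x)).
Qed.

Lemma continuous_Re_dcexp al : continuous (fun x : R => Re (al * cexp (al * x%:C))).
Proof.
move=> x; under eq_fun do rewrite complex_ReM.
by apply: cvgB; apply: cvgM; try exact: cvg_cst;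
  [exact: continuous_Re_cexp|exact: continuous_Im_cexp].
Qed.

Lemma continuous_Im_dcexp al : continuous (fun x : R => Im (al * cexp (al * x%:C))).
Proof.
move=> x; under eq_fun do rewrite complex_ImM.
by apply: cvgD; apply: cvgM; try exact: cvg_cst;
  [exact: continuous_Im_cexp|exact: continuous_Re_cexp].
Qed.

Definition cbmeas D f := bmeas D (fun x => Re (f x)) /\ bmeas D (fun x => Im (f x)).

Lemma cbmeas_cexp (a b : R) al : cbmeas `[a, b] (fun x : R => cexp (al * x%:C)).
Proof.
by split; apply: bmeas_continuous; [exact: continuous_Re_cexp|exact: continuous_Im_cexp].
Qed.

Lemma cbmeas_cst D z : cbmeas D (fun=> z).
Proof. by split; exact: bmeas_cst. Qed.

Lemma cbmeasM D f g : cbmeas D f -> cbmeas D g -> cbmeas D (fun x => f x * g x).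
Proof.
move=> [f1 f2] [g1 g2]; split; under [X in bmeas _ X]eq_fun do rewrite ?complex_ReM ?complex_ImM.
  by apply: bmeasB; exact: bmeasM.
by apply: bmeasD; exact: bmeasM.
Qed.

Lemma cbmeasD D f g : cbmeas D f -> cbmeas D g -> cbmeas D (fun x => f x + g x).
Proof.
move=> [f1 f2] [g1 g2]; split; under [X in bmeas _ X]eq_fun do rewrite ?complex_ReD ?complex_ImD.
  exact: bmeasD.
exact: bmeasD.
Qed.

Lemma cbmeasB D f g : cbmeas D f -> cbmeas D g -> cbmeas D (fun x => f x - g x).
Proof.
move=> [f1 f2] [g1 g2]; split; under [X in bmeas _ X]eq_fun do rewrite ?complex_ReB ?complex_ImB.
  exact: bmeasB.
exact: bmeasB.
Qed.

Lemma cbmeasS D E f : measurable D -> measurable E -> D `<=` E -> cbmeas E f -> cbmeas D f.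
Proof. by move=> mD mE DE [f1 f2]; split; exact: bmeasS DE _. Qed.

Lemma cbmeas_bound D f : cbmeas D f -> exists2 B, 0 <= B & forall x, D x -> cabs (f x) <= B.
Proof.
move=> [[_ [B1 fB1]] [_ [B2 fB2]]]; exists (`|B1| + `|B2|) => [|x Dx]; first exact: addr_ge0.
rewrite (le_trans (cabs_le_ReIm _))// lerD//.
  by rewrite (le_trans (fB1 _ Dx))// ler_norm.
by rewrite (le_trans (fB2 _ Dx))// ler_norm.
Qed.

Lemma cintegrableS D E f : measurable D -> measurable E -> D `<=` E ->
  cintegrable mu E f -> cintegrable mu D f.
Proof. by move=> mD mE DE [f1 f2]; split; exact: itgS DE _. Qed.

Lemma cintegrableD D f g : measurable D -> cintegrable mu D f -> cintegrable mu D g ->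
  cintegrable mu D (fun x => f x + g x).
Proof.
move=> mD [f1 f2] [g1 g2]; split.
  under [X in EFin \o X]eq_fun do rewrite complex_ReD; exact: itgD.
under [X in EFin \o X]eq_fun do rewrite complex_ImD; exact: itgD.
Qed.

Lemma cintegrableB D f g : measurable D -> cintegrable mu D f -> cintegrable mu D g ->
  cintegrable mu D (fun x => f x - g x).
Proof.
move=> mD [f1 f2] [g1 g2]; split.
  under [X in EFin \o X]eq_fun do rewrite complex_ReB; exact: itgB.
under [X in EFin \o X]eq_fun do rewrite complex_ImB; exact: itgB.
Qed.

Lemma cintegrableM D f g : measurable D -> cbmeas D f -> cintegrable mu D g ->
  cintegrable mu D (fun x => f x * g x).
Proof.
move=> mD [f1 f2] [g1 g2]; split.
  under [X in EFin \o X]eq_fun do rewrite complex_ReM.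
  by apply: itgB => //; exact: itgM_bmeas.
under [X in EFin \o X]eq_fun do rewrite complex_ImM.
by apply: itgD => //; exact: itgM_bmeas.
Qed.

Lemma cintegrableZ D z g : measurable D -> cintegrable mu D g ->
  cintegrable mu D (fun x => z * g x).
Proof. by move=> mD; apply: cintegrableM => //; exact: cbmeas_cst. Qed.

Lemma cintegrable_cbmeas (a b : R) f : cbmeas `[a, b] f -> cintegrable mu `[a, b] f.
Proof. by move=> [f1 f2]; split; exact: itg_bmeas. Qed.

Lemma eq_cintegral D f g : (forall x, D x -> f x = g x) -> cintegral D f = cintegral D g.
Proof.
by move=> fg; apply: complex_eq; apply: eq_Rintegral_itv => x Dx; rewrite fg.
Qed.

Lemma cintegralD D f g : measurable D -> cintegrable mu D f -> cintegrable mu D g ->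
  cintegral D (fun x => f x + g x) = cintegral D f + cintegral D g.
Proof.
move=> mD [f1 f2] [g1 g2]; apply: complex_eq; rewrite ?complex_ReD ?complex_ImD /=.
  by rewrite -RintegralD//; apply: eq_Rintegral_itv => x _; rewrite complex_ReD.
by rewrite -RintegralD//; apply: eq_Rintegral_itv => x _; rewrite complex_ImD.
Qed.

Lemma cintegralZ D z g : measurable D -> cintegrable mu D g ->
  cintegral D (fun x => z * g x) = z * cintegral D g.
Proof.
move=> mD [g1 g2]; apply: complex_eq; rewrite ?complex_ReM ?complex_ImM /=.
  rewrite -!RintegralZl// -RintegralB//; last 2 first; try exact: itgZ.
  by apply: eq_Rintegral_itv => x _; rewrite complex_ReM.
rewrite -!RintegralZl// -RintegralD//; last 2 first; try exact: itgZ.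
by apply: eq_Rintegral_itv => x _; rewrite complex_ImM.
Qed.

Lemma normr_Rintegral_le D (f g : R -> R) : measurable D -> itg D f -> itg D g ->
  (forall x, D x -> 0 <= g x) -> {ae mu, forall x, D x -> `|f x| <= g x} ->
  `|\int[mu]_(x in D) f x| <= \int[mu]_(x in D) g x.
Proof.
move=> mD fi gi g0 fg; apply: le_trans (@le_normr_Rintegral _ _ _ mu D f mD fi) _.
rewrite /Rintegral; apply: fine_le.
- by apply: integrable_fin_num => //; exact: itg_norm.
- exact: integrable_fin_num.
apply: ae_ge0_le_integral => //.
- exact: measurable_int (itg_norm mD fi).
- exact: measurable_int gi.
Qed.

Lemma ae_sub (P Q : R -> Prop) : (forall x, P x -> Q x) ->
  {ae mu, forall x, P x} -> {ae mu, forall x, Q x}.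
Proof. by move=> PQ; apply: filterS => //; exact: (ae_filter_ringOfSetsType mu). Qed.

Lemma ae_and (P Q : R -> Prop) :
  {ae mu, forall x, P x} -> {ae mu, forall x, Q x} -> {ae mu, forall x, P x /\ Q x}.
Proof. by move=> aP aQ; apply: filterI => //; exact: (ae_filter_ringOfSetsType mu). Qed.

(** The factor 2 comes from estimating the real and imaginary parts separately. *)
Lemma cabs_cintegral_le D f (g : R -> R) : measurable D -> cintegrable mu D f -> itg D g ->
  (forall x, D x -> 0 <= g x) -> {ae mu, forall x, D x -> cabs (f x) <= g x} ->
  cabs (cintegral D f) <= 2 * \int[mu]_(x in D) g x.
Proof.
move=> mD [f1 f2] gi g0 fg; rewrite (le_trans (cabs_le_ReIm _))// mulrDl mul1r lerD//.
  apply: normr_Rintegral_le => //; apply: ae_sub fg => x fg Dx.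
  exact: le_trans (Re_le_cabs _) (fg Dx).
apply: normr_Rintegral_le => //; apply: ae_sub fg => x fg Dx.
exact: le_trans (Im_le_cabs _) (fg Dx).
Qed.

Lemma cintegral_split f (a b c : R) : a <= b -> b <= c -> cintegrable mu `[a, c] f ->
  cintegral `[a, c] f = cintegral `[a, b] f + cintegral `[b, c] f.
Proof.
move=> ab bc [f1 f2].
have part (p : R -> R) : itg `[a, c] p ->
    \int[mu]_(x in `[a, c]) p x = \int[mu]_(x in `[a, b]) p x + \int[mu]_(x in `[b, c]) p x.
  move=> ip; apply/eqP; rewrite addrC -subr_eq; apply/eqP.
  rewrite (@Rintegral_itvB _ p (BLeft a) (BRight c) b)//.
  apply: Rintegral_itv_obnd_cbnd; apply: itgS ip => //.
  by move=> x; rewrite /= !in_itv/= => /andP[bx ->]; rewrite (le_trans ab (ltW bx)).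
by apply: complex_eq; rewrite ?complex_ReD ?complex_ImD; exact: part.
Qed.

Lemma ac_cbmeas (U g : R -> R[i]) : ac_derivative U g -> cbmeas `[0, pi] U.
Proof.
move=> [[g1 g2] Ug]; have pi0 := pi_ge0 R.
have mb : measurable (`[0, pi] : set R) by exact: measurable_itv.
have E (p : R -> R) (h h' : R -> R) : itg `[0, pi] h' ->
    (forall x, x \in `[0, pi] -> h x = h 0 + \int[mu]_(t in `[0, x]) h' t) ->
    bmeas `[0, pi] h.
  move=> ih hh'; have [m [B hB]] := bmeas_within_continuous (indefinite_continuous (c := h 0) pi0 ih).
  split; first by apply: eq_measurable_fun m => x /set_mem xx; rewrite (hh' x).
  by exists B => x xx; rewrite (hh' x)//; exact: hB.
split.
  by apply: (E id _ _ g1) => x /Ug ->; rewrite complex_ReD.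
by apply: (E id _ _ g2) => x /Ug ->; rewrite complex_ImD.
Qed.

(** The fundamental theorem for e^(al s) U(s). Its real and imaginary parts each combine two real
    integrations by parts. *)
Lemma cexp_integration_by_parts (al : R[i]) (U g : R -> R[i]) (b : R) : 0 <= b <= pi ->
  ac_derivative U g ->
  cintegral `[0, b] (fun s => cexp (al * s%:C) * (g s + al * U s)) =
  cexp (al * b%:C) * U b - U 0.
Proof.
move=> /andP[b0 bpi] acU; have bU := ac_cbmeas acU.
have mb : measurable (`[0, b] : set R) by exact: measurable_itv.
have sb : `[0, b] `<=` (`[0, pi] : set R).
  by move=> x; rewrite /= !in_itv/= => /andP[-> xb]; exact: le_trans bpi.
have {bU}[bU1 bU2] := cbmeasS mb (measurable_itv _) sb bU.
case: acU => gi; have {gi}[g1 g2] := cintegrableS mb (measurable_itv _) sb gi.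
move=> Ug.
have UR x : x \in `[0, b] -> Re (U x) = Re (U 0) + \int[mu]_(t in `[0, x]) Re (g t).
  by move=> xb; rewrite {1}Ug ?complex_ReD//; apply: (sb x xb).
have UI x : x \in `[0, b] -> Im (U x) = Im (U 0) + \int[mu]_(t in `[0, x]) Im (g t).
  by move=> xb; rewrite {1}Ug ?complex_ImD//; apply: (sb x xb).
have e0 : cexp (al * 0%:C) = 1 by rewrite mulr0 cexp0.
have bin : b \in `[0, b] by rewrite in_itv/= b0 lexx.
have zin : 0 \in `[0, b] by rewrite in_itv/= b0 lexx.
have gen (e e' h u : R -> R) : (forall x, is_derive x (1 : R) e (e' x)) -> continuous e' ->
    itg `[0, b] h -> (forall x, x \in `[0, b] -> u x = u 0 + \int[mu]_(t in `[0, x]) h t) ->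
    \int[mu]_(x in `[0, b]) (e x * h x + e' x * u x) = e b * u b - e 0 * u 0.
  move=> de ce ih hu; have /= := ac_integration_by_parts (u 0) b0 de ce ih.
  rewrite -hu// -hu// => <-; apply: eq_Rintegral_itv => x xb; rewrite -hu//.
have Re' := is_derive_Re_cexp al; have Im' := is_derive_Im_cexp al.
have cR := @continuous_Re_dcexp al; have cI := @continuous_Im_dcexp al.
have bR := bmeas_continuous 0 b (@continuous_Re_cexp al).
have bI := bmeas_continuous 0 b (@continuous_Im_cexp al).
have bR' := bmeas_continuous 0 b cR; have bI' := bmeas_continuous 0 b cI.
have S (e e' h u : R -> R) : bmeas `[0, b] e -> bmeas `[0, b] e' -> itg `[0, b] h ->
    bmeas `[0, b] u -> itg `[0, b] (fun x => e x * h x + e' x * u x).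
  move=> be be' ih bu; apply: itgD => //; first exact: itgM_bmeas.
  by apply: itg_bmeas; exact: bmeasM.
apply: complex_eq.
  rewrite complex_ReB complex_ReM /=.
  have A := gen _ _ _ (fun x => Re (U x)) Re' cR g1 UR.
  have B := gen _ _ _ (fun x => Im (U x)) Im' cI g2 UI.
  rewrite e0/= in A B; transitivity ((Re (cexp (al * b%:C)) * Re (U b) - 1 * Re (U 0)) -
    (Im (cexp (al * b%:C)) * Im (U b) - 0 * Im (U 0))); last by ring.
  rewrite -A -B -RintegralB//; [|exact: S|exact: S].
  by apply: eq_Rintegral_itv => x _; rewrite !(complex_ReM, complex_ImM, complex_ReD, complex_ImD); ring.
rewrite complex_ImB complex_ImM /=.
have A := gen _ _ _ (fun x => Im (U x)) Re' cR g2 UI.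
have B := gen _ _ _ (fun x => Re (U x)) Im' cI g1 UR.
rewrite e0/= in A B; transitivity ((Re (cexp (al * b%:C)) * Im (U b) - 1 * Im (U 0)) +
  (Im (cexp (al * b%:C)) * Re (U b) - 0 * Re (U 0))); last by ring.
rewrite -A -B -RintegralD//; [|exact: S|exact: S].
by apply: eq_Rintegral_itv => x _; rewrite !(complex_ReM, complex_ImM, complex_ReD, complex_ImD); ring.
Qed.

End ComplexIntegrals.

(** * The Volterra operator *)

Section Volterra.
Context {R : realType}.
Local Notation mu := (@lebesgue_measure R).
Local Notation itg D f := (mu.-integrable D (EFin \o f)).
Local Notation Re := (@complex.Re R).
Local Notation Im := (@complex.Im R).

Lemma measurable_triangle :
  measurable [set p : R * R | 0 <= p.2 /\ p.2 <= p.1 /\ p.1 <= pi].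
Proof.
have -> : [set p : R * R | 0 <= p.2 /\ p.2 <= p.1 /\ p.1 <= pi] =
   (setT `&` [set p : R * R | 0 <= p.2]) `&`
   ((setT `&` [set p : R * R | p.2 <= p.1]) `&` (setT `&` [set p : R * R | p.1 <= pi])).
  by apply/seteqP; split => p /=; tauto.
by apply: measurableI; [|apply: measurableI]; apply: measurable_fun_le.
Qed.

(** By Fubini almost every section is integrable, and [m] is the marginal of |f|, extended by zero
    off the triangle. *)
Lemma ae_section_integrable (f : R * R -> R) :
  (mu \x mu)%E.-integrable [set p : R * R | 0 <= p.2 /\ p.2 <= p.1 /\ p.1 <= pi] (EFin \o f) ->
  exists m : R -> R, [/\ (forall s, 0 <= m s), itg `[0, pi] m &
    {ae mu, forall s, s \in `[0, pi] -> itg `[0, s] (fun t => f (s, t)) /\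
      \int[mu]_(t in `[0, s]) `|f (s, t)| <= m s}].
Proof.
set T := [set p : R * R | _] => fi; have mT := measurable_triangle.
pose f' := f \_ T.
have fi' : (mu \x mu)%E.-integrable setT (EFin \o f').
  by rewrite /f' -restrict_EFin; apply/integrable_restrict => //; rewrite setTI.
have fiN : (mu \x mu)%E.-integrable setT (EFin \o (fun z => `|f' z|)).
  rewrite (_ : EFin \o _ = (abse \o (EFin \o f'))); first exact: integrable_abse.
  by apply/funext => x.
pose F := fubini_F mu (EFin \o (fun z => `|f' z|)).
have iF : mu.-integrable setT F by exact: integrable_fubini_F.
have F0 s : (0 <= F s)%E by apply: integral_ge0 => t _; rewrite lee_fin.
have sec s : s \in `[0, pi] -> (fun t => f' (s, t)) = (fun t => f (s, t)) \_ `[0, s].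
  rewrite in_itv/= => /andP[s0 spi]; apply/funext => t; rewrite /f' !patchE.
  rewrite mem_setE in_itv/=; congr (if _ then _ else _).
  apply/idP/idP => [/set_mem[/= ? []->] //|/andP[t0 ts]]; first by move=> _; apply/andP.
  by apply/mem_set.
(* Where F is infinite, [fine] returns 0; this happens only on a null set. *)
exists (fine \o F); split => [s||].
- by rewrite /= fine_ge0.
- apply: (@itgS _ _ setT) => //.
  apply: (@le_integrable _ _ _ mu setT measurableT _ F) => //.
    apply/measurable_EFinP; apply: measurableT_comp => //; exact: measurable_int iF.
  move=> s _ /=; case: (F s) (F0 s) => [r||] //= r0; first by rewrite normr0 leey.
have a1 := ae_integrable1 fi'.
have a2 : {ae mu, forall s, F s \is a fin_num}.
  have := integrable_ae measurableT iF; apply: ae_sub => s; exact.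
apply: ae_sub (ae_and a1 a2) => s [h1 h2] spi.
have ifs : itg `[0, s] (fun t => f (s, t)).
  have := h1; rewrite (_ : (fun y => _) = EFin \o (fun t => f' (s, t)))// sec//.
  rewrite -restrict_EFin => /integrable_restrict; rewrite setTI; exact.
split => //; rewrite -lee_fin /= fineK//.
have -> : F s = (\int[mu]_t ((fun t => `|f (s, t)|%:E) \_ (`[0%R, s] : set R)) t)%E.
  apply: eq_integral => t _ /=.
  have := congr1 (fun g => g t) (sec s spi) => /= ->.
  by rewrite !patchE; case: ifPn => //; rewrite normr0.
rewrite -integral_mkcond /Rintegral fineK//.
all: by apply: integrable_fin_num => //; exact: itg_norm.
Qed.

(** All later estimates see the kernel only through this integrable majorant. *)
Lemma volterra_bound (M : R -> R -> R[i]) : integrable_kernel M ->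
  exists m : R -> R, [/\ (forall s, 0 <= m s), itg `[0, pi] m &
    {ae mu, forall s, s \in `[0, pi] -> cintegrable mu `[0, s] (M s) /\
      forall y B, cbmeas `[0, pi] y -> (forall t, t \in `[0, s] -> cabs (y t) <= B) ->
        cabs (cintegral `[0, s] (fun t => M s t * y t)) <= m s * B}].
Proof.
move=> [/ae_section_integrable[m1 [m10 im1 am1]] /ae_section_integrable[m2 [m20 im2 am2]]].
have mp : measurable (`[0, pi] : set R) by exact: measurable_itv.
exists (fun s => 2 * (m1 s + m2 s)); split => [s||].
- by rewrite mulr_ge0// addr_ge0.
- by apply: itgZ => //; exact: itgD.
apply: ae_sub (ae_and am1 am2) => s [h1 h2] spi.
have {h1}[i1 l1] := h1 spi; have {h2}[i2 l2] := h2 spi.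
have iM : cintegrable mu `[0, s] (M s) by [].
split => // y B by_ yB.
have [s0 spi'] : 0 <= s /\ s <= pi by move: spi; rewrite in_itv/= => /andP.
have B0 : 0 <= B.
  by apply: le_trans (cabs_ge0 _) (yB 0 _); rewrite in_itv/= lexx.
have ms : measurable (`[0, s] : set R) by exact: measurable_itv.
have sub : `[0, s] `<=` (`[0, pi] : set R).
  by move=> t; rewrite /= !in_itv/= => /andP[-> ts]; exact: le_trans spi'.
have iN : itg `[0, s] (fun t => `|Re (M s t)| + `|Im (M s t)|).
  by apply: itgD => //; exact: itg_norm.
apply: (@le_trans _ _ (2 * \int[mu]_(t in `[0, s]) (B * (`|Re (M s t)| + `|Im (M s t)|)))).
  apply: cabs_cintegral_le => //.
  - under [X in cintegrable _ _ X]eq_fun do rewrite mulrC.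
    by apply: cintegrableM => //; exact: cbmeasS sub by_.
  - exact: itgZ.
  - by move=> t _; rewrite mulr_ge0// addr_ge0.
  apply: aeW => t ts; rewrite cabsM mulrC ler_pM ?cabs_ge0//; first exact: yB.
  exact: cabs_le_ReIm.
rewrite RintegralZl// RintegralD//; [|exact: itg_norm|exact: itg_norm].
rewrite [leRHS]mulrC mulrCA ler_wpM2l// ler_wpM2l// lerD//.
Qed.

(** With lam = - al^2 the left side is y'' - al^2 y, the operator that gets factored. The forcing
    [h] lets solutions for different potentials be subtracted, and y', y'' are parameters so that
    linear combinations act on them too. *)
Definition forced_solution (M : R -> R -> R[i]) (q h : R -> R[i]) (lam a b : R[i])
    (y y1 y2 : R -> R[i]) : Prop :=
  [/\ ac_derivative y y1, ac_derivative y1 y2, y 0 = a, y1 0 = b &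
    {ae mu, forall x, x \in `[0, pi] ->
      y2 x + lam * y x =
      q x * y x + cintegral `[0, x] (fun t => M x t * y t) + h x}].

Lemma cauchy_forced M q lam a b y : cauchy_solution M q lam a b y ->
  exists y1 y2, forced_solution M q (fun=> 0) lam a b y y1 y2.
Proof.
move=> [y1 [y2 [acy acy1 ya y1b eqn]]]; exists y1, y2; split => //.
by apply: ae_sub eqn => x eqn /eqn <-; ring.
Qed.

Lemma ac_derivative_comb (c : R[i]) (f g u v : R -> R[i]) :
  ac_derivative f g -> ac_derivative u v ->
  ac_derivative (fun x => f x + c * u x) (fun x => g x + c * v x).
Proof.
move=> [ig fg] [iv uv]; have mp : measurable (`[0, pi] : set R) by exact: measurable_itv.
split; first by apply: cintegrableD => //; exact: cintegrableZ.
move=> x xpi; have [x0 xpi'] : 0 <= x /\ x <= pi by move: xpi; rewrite in_itv/= => /andP.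
have mx : measurable (`[0, x] : set R) by exact: measurable_itv.
have sub : `[0, x] `<=` (`[0, pi] : set R).
  by move=> t; rewrite /= !in_itv/= => /andP[-> ts]; exact: le_trans xpi'.
have ig' := cintegrableS mx mp sub ig; have iv' := cintegrableS mx mp sub iv.
rewrite cintegralD//; last exact: cintegrableZ.
by rewrite cintegralZ// fg// uv//; ring.
Qed.

(** Used with c = -1 for the difference of two Weyl solutions and with c = N for the Weyl solution
    itself. Integrability of almost every section of [M] makes the Volterra term linear. *)
Lemma forced_comb M q h h' lam a b a' b' y y1 y2 z z1 z2 (c : R[i]) : integrable_kernel M ->
  forced_solution M q h lam a b y y1 y2 -> forced_solution M q h' lam a' b' z z1 z2 ->
  forced_solution M q (fun x => h x + c * h' x) lam (a + c * a') (b + c * b')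
    (fun x => y x + c * z x) (fun x => y1 x + c * z1 x) (fun x => y2 x + c * z2 x).
Proof.
move=> /volterra_bound[m [_ _ am]] [acy acy1 ya yb eqy] [acz acz1 za zb eqz].
split; try exact: ac_derivative_comb.
- by rewrite ya za.
- by rewrite yb zb.
apply: ae_sub (ae_and am (ae_and eqy eqz)) => x [iM [ey ez]] xpi.
have {iM}[iM _] := iM xpi; have {}ey := ey xpi; have {}ez := ez xpi.
have [x0 xpi'] : 0 <= x /\ x <= pi by move: xpi; rewrite in_itv/= => /andP.
have mp : measurable (`[0, pi] : set R) by exact: measurable_itv.
have mx : measurable (`[0, x] : set R) by exact: measurable_itv.
have sub : `[0, x] `<=` (`[0, pi] : set R).
  by move=> t; rewrite /= !in_itv/= => /andP[-> ts]; exact: le_trans xpi'.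
have by_ := cbmeasS mx mp sub (ac_cbmeas acy).
have bz_ := cbmeasS mx mp sub (ac_cbmeas acz).
have iMy : cintegrable mu `[0, x] (fun t => M x t * y t).
  by under [X in cintegrable _ _ X]eq_fun do rewrite mulrC; exact: cintegrableM.
have iMz : cintegrable mu `[0, x] (fun t => M x t * z t).
  by under [X in cintegrable _ _ X]eq_fun do rewrite mulrC; exact: cintegrableM.
have -> : cintegral `[0, x] (fun t => M x t * (y t + c * z t)) =
   cintegral `[0, x] (fun t => M x t * y t) + c * cintegral `[0, x] (fun t => M x t * z t).
  rewrite -cintegralZ// -cintegralD//; last exact: cintegrableZ.
  by apply: eq_cintegral => t _; ring.
transitivity ((y2 x + lam * y x) + c * (z2 x + lam * z x)); first by ring.
by rewrite ey ez; ring.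
Qed.

(** Trades a change of potential for a forcing term, so that both Weyl solutions obey an equation
    with the same potential. *)
Lemma forced_potential M q q' h lam a b y y1 y2 :
  forced_solution M q h lam a b y y1 y2 ->
  forced_solution M q' (fun x => h x + (q x - q' x) * y x) lam a b y y1 y2.
Proof.
move=> [acy acy1 ya yb eqy]; split => //.
by apply: ae_sub eqy => x ey xpi; rewrite ey//; ring.
Qed.

End Volterra.

(** * The boundary value problem *)

Section Estimates.
Context {R : realType}.
Local Notation mu := (@lebesgue_measure R).
Local Notation itg D f := (mu.-integrable D (EFin \o f)).
Local Notation Re := (@complex.Re R).
Local Notation Im := (@complex.Im R).
Local Notation I0pi := (`[0, pi]%classic : set R).

Lemma ge0_Rintegral_subset (A B : set R) (h : R -> R) : measurable A -> measurable B ->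
  A `<=` B -> itg B h -> (forall s, 0 <= h s) ->
  \int[mu]_(s in A) h s <= \int[mu]_(s in B) h s.
Proof.
move=> mA mB AB ih h0; have ihA := itgS mA mB AB ih.
rewrite /Rintegral; apply: fine_le; [exact: integrable_fin_num|exact: integrable_fin_num|].
apply: ge0_subset_integral => //; first exact: measurable_int ih.
by move=> x _; rewrite lee_fin.
Qed.

(** The exponential and the weight are bounded together, pointwise, by K; only the integrable factor
    [h] stays under the integral. *)
Lemma cabs_weighted_integral_le (z al : R[i]) (F : R -> R[i]) (h p : R -> R) (K a b : R) :
  0 <= a -> b <= pi -> cintegrable mu I0pi F -> itg I0pi h -> (forall s, 0 <= h s) ->
  {ae mu, forall s, s \in I0pi -> cabs (F s) <= h s * p s} -> 0 <= K ->
  (forall s, s \in `[a, b] -> cabs (z * cexp (al * s%:C)) * p s <= K) ->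
  cabs (z * cintegral `[a, b] (fun s => cexp (al * s%:C) * F s)) <=
  2 * (K * \int[mu]_(s in I0pi) h s).
Proof.
move=> a0 bpi iF ih h0 Fh K0 zK.
have mp : measurable I0pi by exact: measurable_itv.
have mab : measurable (`[a, b] : set R) by exact: measurable_itv.
have sub : `[a, b] `<=` I0pi.
  by move=> t; rewrite /= !in_itv/= => /andP[at_ tb]; rewrite (le_trans a0)//= (le_trans tb).
have iF' := cintegrableS mab mp sub iF; have ih' := itgS mab mp sub ih.
have iE : cintegrable mu `[a, b] (fun s => cexp (al * s%:C) * F s).
  by apply: cintegrableM => //; exact: cbmeas_cexp.
rewrite -cintegralZ//.
apply: (@le_trans _ _ (2 * \int[mu]_(s in `[a, b]) (K * h s))).
  apply: cabs_cintegral_le => //; first exact: cintegrableZ.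
  - exact: itgZ.
  - by move=> x _; exact: mulr_ge0.
  apply: ae_sub Fh => s Fs /[dup] sab /sub /mem_set spi.
  rewrite mulrA cabsM (@le_trans _ _ (cabs (z * cexp (al * s%:C)) * (h s * p s)))//.
    by rewrite ler_wpM2l ?cabs_ge0// Fs.
  by rewrite mulrCA mulrC ler_wpM2r// zK.
rewrite ler_wpM2l// RintegralZl// ler_wpM2l//.
exact: ge0_Rintegral_subset.
Qed.

(* Writing F for y'' - al^2 y, the functions u = y' + al y and v = y' - al y satisfy
   u' - al u = F = v' + al v. *)
Lemma forward_factor (al : R[i]) (y y1 y2 : R -> R[i]) (x : R) :
  ac_derivative y y1 -> ac_derivative y1 y2 -> 0 <= x <= pi ->
  y1 x + al * y x = cexp (al * x%:C) * (y1 0 + al * y 0 +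
    cintegral `[0, x] (fun s => cexp (- al * s%:C) * (y2 s - al ^+ 2 * y s))).
Proof.
move=> acy acy1 xpi.
have acu := ac_derivative_comb al acy1 acy.
have := cexp_integration_by_parts (- al) xpi acu.
have -> : cintegral `[0, x] (fun s => cexp (- al * s%:C) * (y2 s + al * y1 s + - al * (y1 s + al * y s))) =
   cintegral `[0, x] (fun s => cexp (- al * s%:C) * (y2 s - al ^+ 2 * y s)).
  by apply: eq_cintegral => s _; ring.
move=> ->; rewrite [_ + (_ - _)]addrC subrK mulrA -cexpD mulNr subrr cexp0 mul1r//.
Qed.

(** Integration runs down from pi because, for Re al < 0, the kernel e^(al (s - x)) decays for s >=
    x, just as e^(al (x - s)) does for s <= x in the forward factor. *)
Lemma backward_factor (al : R[i]) (y y1 y2 : R -> R[i]) (x : R) :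
  ac_derivative y y1 -> ac_derivative y1 y2 -> 0 <= x <= pi ->
  y1 x - al * y x = cexp (- al * x%:C) * (cexp (al * pi%:C) * (y1 pi - al * y pi) -
    cintegral `[x, pi] (fun s => cexp (al * s%:C) * (y2 s - al ^+ 2 * y s))).
Proof.
move=> acy acy1 xpi; have pi0 := pi_ge0 R; have [x0 xp] := andP xpi.
have acu := ac_derivative_comb (- al) acy1 acy.
have pipi : 0 <= (pi : R) <= pi by rewrite pi0 lexx.
have e s : cexp (al * s%:C) * (y2 s + - al * y1 s + al * (y1 s + - al * y s)) =
   cexp (al * s%:C) * (y2 s - al ^+ 2 * y s) by ring.
have A := cexp_integration_by_parts al xpi acu.
have B := cexp_integration_by_parts al pipi acu.
rewrite (eq_cintegral (fun s _ => e s)) in A.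
rewrite (eq_cintegral (fun s _ => e s)) in B.
have iF : cintegrable mu I0pi (fun s => cexp (al * s%:C) * (y2 s - al ^+ 2 * y s)).
  have mp : measurable I0pi by exact: measurable_itv.
  apply: cintegrableM => //; first exact: cbmeas_cexp.
  apply: cintegrableB => //; first by case: acy1.
  by apply: cintegrable_cbmeas; apply: cbmeasM; [exact: cbmeas_cst|exact: ac_cbmeas acy].
rewrite (cintegral_split x0 xp iF) A in B.
have -> : cintegral `[x, pi] (fun s => cexp (al * s%:C) * (y2 s - al ^+ 2 * y s)) =
  (cexp (al * pi%:C) * (y1 pi + - al * y pi)) - cexp (al * x%:C) * (y1 x + - al * y x).
  move: B; set A1 := cexp (al * x%:C) * _; set A2 := cexp (al * pi%:C) * _; set J := cintegral _ _.
  move=> B; have -> : A2 = A1 + J by apply: (addIr (- (y1 0 + - al * y 0))); rewrite -B; ring.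
  ring.
transitivity (cexp (- al * x%:C) * (cexp (al * x%:C) * (y1 x - al * y x))); last by ring.
by rewrite mulrA -cexpD mulNr addNr cexp0 mul1r.
Qed.

(** The weights that the kernel e^(-t|x - s|) reproduces up to the factor c. The condition is
    pointwise, so it can be used against a density that is only integrable. *)
Definition weight (t c : R) (p : R -> R) := [/\ 1 <= c, (forall x, 0 <= p x) &
  forall x s, x \in I0pi -> s \in I0pi -> expR (- (t * `|x - s|)) * p s <= c * p x].

Lemma cabs_cexpR (al : R[i]) (x : R) : cabs (cexp (al * x%:C)) = expR (Re al * x).
Proof. by rewrite cabs_cexp Re_scale. Qed.

Lemma in_I0pi (x : R) : (x \in I0pi) = (0 <= x <= pi).
Proof. by rewrite mem_setE in_itv. Qed.

(** * The two-point problem y'' - al^2 y = F with y(pi) = 0 *)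

Section BoundaryValueProblem.
Context (al : R[i]) (y y1 y2 : R -> R[i]) (h p : R -> R) (t c : R).
Context (acy : ac_derivative y y1).
Context (acy1 : ac_derivative y1 y2).
Context (ypi : y pi = 0).
Context (tal : Re al = - t).
Context (t0 : 0 < t).
Context (wp : weight t c p).
Context (ih : itg I0pi h).
Context (h0 : forall s, 0 <= h s).
Let F := fun s => y2 s - al ^+ 2 * y s.
Context (Fh : {ae mu, forall s, s \in I0pi -> cabs (F s) <= h s * p s}).
Let H := \int[mu]_(s in I0pi) h s.
Let E := cexp (al * pi%:C).
Let J := cintegral I0pi (fun s => cexp (al * s%:C) * F s).
(** The factor E belongs to K because e^(-al s) alone grows, while E e^(-al s) has modulus e^(-t (pi
    - s)). *)
Let K := E * cintegral I0pi (fun s => cexp (- al * s%:C) * F s).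

Let pi0 : (0 : R) <= pi. Proof. exact: pi_ge0. Qed.

Let H0 : 0 <= H. Proof. by apply: Rintegral_ge0. Qed.

Let iF : cintegrable mu I0pi F.
Proof.
have mp : measurable I0pi by exact: measurable_itv.
apply: cintegrableB => //; first by case: acy1.
by apply: cintegrable_cbmeas; apply: cbmeasM; [exact: cbmeas_cst|exact: ac_cbmeas acy].
Qed.

(** Backward integration to 0 gives y'(0) - al y(0) = E y'(pi) - J, forward integration to pi gives
    y'(pi) = E (y'(0) + al y(0)) + K; y'(pi) is eliminated. *)
Lemma bvp_initial : (y1 0 + al * y 0) * (1 - E ^+ 2) = E * K - J + 2 * al * y 0.
Proof.
have zz : 0 <= (0 : R) <= pi by rewrite lexx pi0.
have pp : 0 <= (pi : R) <= pi by rewrite lexx pi0.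
have A := backward_factor al acy acy1 zz.
have B := forward_factor al acy acy1 pp.
rewrite mulr0 cexp0 mul1r -/J -/E ypi mulr0 subr0 in A.
rewrite ypi mulr0 addr0 -/E -/F mulrDr -/K in B.
have -> : (y1 0 + al * y 0) * (1 - E ^+ 2) =
  (y1 0 - al * y 0) + 2 * al * y 0 - E * (E * (y1 0 + al * y 0)) by ring.
rewrite A B; ring.
Qed.

Lemma bvp_K_le : cabs K <= 2 * (c * p pi * H).
Proof.
case: wp => c1 p0 pw; apply: (cabs_weighted_integral_le (p := p)) => //.
  by rewrite mulr_ge0// (le_trans ler01).
move=> s; rewrite in_itv/= => /andP[s0 spi].
rewrite cabsM !cabs_cexp -expRD !Re_scale.
have -> : Re (- al) = t by rewrite -[t]opprK -tal; case: (al).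
rewrite tal; have -> : - t * pi + t * s = - (t * `|pi - s|).
  by rewrite ger0_norm ?subr_ge0//; ring.
by apply: pw; rewrite in_I0pi ?pi0 ?lexx ?s0.
Qed.

Lemma bvp_J_le : cabs J <= 2 * (c * p 0 * H).
Proof.
case: wp => c1 p0 pw; rewrite -[J]mul1r; apply: (cabs_weighted_integral_le (p := p)) => //.
  by rewrite mulr_ge0// (le_trans ler01).
move=> s; rewrite in_itv/= => /andP[s0 spi].
rewrite mul1r cabs_cexpR tal; have -> : - t * s = - (t * `|0 - s|).
  by rewrite sub0r normrN ger0_norm//; ring.
by apply: pw; rewrite in_I0pi ?pi0 ?lexx ?s0.
Qed.

Context (Ehalf : expR (- (t * pi)) <= 2^-1).

(** Compares y with the free decaying solution y(0) e^(al x). The gain 1 / |al| arises because the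
    forward and backward quantities differ by 2 al y. *)
Lemma bvp_estimate x : x \in I0pi ->
  cabs (y x - y 0 * cexp (al * x%:C)) <=
  4 * cabs (y 0) * expR (- (t * pi)) + 13 * c ^+ 5 * p x * H / cabs al.
Proof.
rewrite in_I0pi => xpi; have [x0 xp] := andP xpi.
have [c1 p0 pw] := wp; have c0 : 0 <= c by apply: le_trans c1.
have zz : 0 <= (0 : R) <= pi by rewrite lexx pi0.
have pp : 0 <= (pi : R) <= pi by rewrite lexx pi0.
have A := backward_factor al acy acy1 zz.
have B := forward_factor al acy acy1 pp.
have C := backward_factor al acy acy1 xpi.
have D := forward_factor al acy acy1 xpi.
rewrite mulr0 cexp0 mul1r -/J -/E ypi mulr0 subr0 in A.
rewrite ypi mulr0 addr0 -/E -/F mulrDr -/K in B.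
rewrite -/E ypi mulr0 subr0 -/F in C; rewrite -/F in D.
set I1 := cintegral _ _ in D; set I2 := cintegral _ _ in C.
set e := cexp (al * x%:C) in D *; set e' := cexp (- al * x%:C) in C.
have r0 : 0 < cabs al.
  by rewrite cabs_gt0; apply: contraTneq t0 => al0; move: tal; rewrite al0/= => /eqP;
   rewrite eq_sym oppr_eq0 => /eqP ->; rewrite ltxx.
set H2 := 2 * H; have H20 : 0 <= H2 by rewrite mulr_ge0.
have Eh := Ehalf; set ep := expR (- (t * pi)) in Eh *; have ep0 : 0 < ep by exact: expR_gt0.
have cE : cabs E = ep by rewrite /E cabs_cexpR tal mulNr.
have ReNal : Re (- al) = t by rewrite -[t]opprK -tal; case: (al).
set ex := expR (- (t * x)); have ex0 : 0 < ex by exact: expR_gt0.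
have ex1 : ex <= 1 by rewrite /ex -expR0 ler_expR oppr_le0 mulr_ge0// ltW.
have ce : cabs e = ex by rewrite /e cabs_cexpR tal mulNr.
set fx := expR (- (t * (pi - x))); have fx0 : 0 < fx by exact: expR_gt0.
have fx1 : fx <= 1 by rewrite /fx -expR0 ler_expR oppr_le0 mulr_ge0 ?subr_ge0// ltW.
have ceE : cabs (e' * E) = fx.
  rewrite /e' /E cabsM !cabs_cexpR ReNal tal -expRD; congr expR; ring.
(* The weight inequality between 0, x and pi: the exponentials in front of the boundary quantities
   carry their weights over to x. *)
have w1 : ep * p pi <= c * p 0.
  have := pw 0 pi; rewrite !in_I0pi zz pp => /(_ isT isT).
  by rewrite sub0r normrN ger0_norm.
have w2 : ep * p 0 <= c * p pi.
  have := pw pi 0; rewrite !in_I0pi zz pp => /(_ isT isT).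
  by rewrite subr0 ger0_norm.
have w3 : ex * p 0 <= c * p x.
  have := pw x 0; rewrite !in_I0pi zz xpi => /(_ isT isT).
  by rewrite subr0 ger0_norm.
have w4 : fx * p pi <= c * p x.
  have := pw x pi; rewrite !in_I0pi pp xpi => /(_ isT isT).
  by rewrite distrC ger0_norm ?subr_ge0.
have kK : cabs K <= c * p pi * H2 by rewrite (le_trans bvp_K_le)// /H2; lra.
have kJ : cabs J <= c * p 0 * H2 by rewrite (le_trans bvp_J_le)// /H2; lra.
have kI1 : cabs (e * I1) <= c * p x * H2.
  rewrite (_ : c * p x * H2 = 2 * (c * p x * H)); last by rewrite /H2; ring.
  apply: (cabs_weighted_integral_le (p := p)) => //; first by rewrite mulr_ge0.
  move=> s; rewrite in_itv/= => /andP[s0 sx].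
  rewrite cabsM !cabs_cexpR ReNal tal -expRD.
  have -> : - t * x + t * s = - (t * `|x - s|) by rewrite ger0_norm ?subr_ge0//; ring.
  by apply: pw; rewrite in_I0pi ?x0 ?s0//= (le_trans sx).
have kI2 : cabs (e' * I2) <= c * p x * H2.
  rewrite (_ : c * p x * H2 = 2 * (c * p x * H)); last by rewrite /H2; ring.
  apply: (cabs_weighted_integral_le (p := p)) => //; first by rewrite mulr_ge0.
  move=> s; rewrite in_itv/= => /andP[xs spi].
  rewrite cabsM !cabs_cexpR ReNal tal -expRD.
  have -> : t * x + - t * s = - (t * `|x - s|).
    by rewrite distrC ger0_norm ?subr_ge0//; ring.
  by apply: pw; rewrite in_I0pi ?x0 ?spi ?andbT//= (le_trans x0).
set a := cabs (y 0); have a0 : 0 <= a by exact: cabs_ge0.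
set r := cabs al in r0 *.
have c2 : 1 <= c ^+ 2 by exact: exprn_ege1.
have cc2 : c <= c ^+ 2 by rewrite expr2 ler_peMl.
have u0 : cabs (y1 0 + al * y 0) <= 4 * c ^+ 2 * p 0 * H2 + 4 * r * a.
  have : cabs (y1 0 + al * y 0) * cabs (1 - E ^+ 2) <= ep * (c * p pi * H2) + c * p 0 * H2 + 2 * r * a.
    rewrite -cabsM bvp_initial (le_trans (cabsD _ _))// lerD//.
      rewrite (le_trans (cabsB _ _))// lerD// cabsM cE ler_wpM2l// ltW//.
    rewrite !cabsM -/r -/a.
    by have -> : cabs (2 : R[i]) = 2 by rewrite -(rmorph_nat (real_complex R)) cabsR normr_nat.
  have q : 2^-1 <= cabs (1 - E ^+ 2).
    have : cabs 1 <= cabs (1 - E ^+ 2) + cabs (E ^+ 2).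
      by apply: le_trans (cabsD _ _); rewrite subrK.
    rewrite cabs1 cabsX cE; have : ep ^+ 2 <= 2^-1.
      rewrite expr2 (@le_trans _ _ (ep * 1))// ?mulr1//.
      by rewrite ler_piMl ?(ltW ep0)//; move: Eh; lra.
    lra.
  have w1' := ler_wpM2l (mulr_ge0 c0 H20) w1.
  have cc2' := ler_wpM2r (mulr_ge0 (p0 0) H20) cc2.
  have q' := ler_wpM2l (cabs_ge0 (y1 0 + al * y 0)) q.
  move: w1' cc2' q'; rewrite !expr2; lra.
set V := y1 pi in A B C.
have kV : cabs V <= 4 * r * a * ep + 5 * c ^+ 3 * p pi * H2.
  rewrite B (le_trans (cabsD _ _))// cabsM cE.
  have u0' := ler_wpM2l (ltW ep0) u0.
  have w2' := ler_wpM2l (mulr_ge0 (mulr_ge0 c0 c0) H20) w2.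
  have ccc : c <= c ^+ 3.
    by rewrite exprS ler_peMr.
  have ccc' := ler_wpM2r (mulr_ge0 (p0 pi) H20) ccc.
  move: kK u0' w2' ccc'; rewrite !exprS !expr0 !mulr1; lra.
(* Forward minus backward formula at x. Writing y'(0) + al y(0) as E V - J + 2 al y(0) isolates the
   free solution. *)
have key : 2 * al * (y x - y 0 * e) = (e * E - e' * E) * V - e * J + e * I1 + e' * I2.
  move: C D; rewrite (_ : y1 0 + al * y 0 = E * V - J + 2 * al * y 0); last by rewrite -A; ring.
  move=> C D; have -> : 2 * al * (y x - y 0 * e) =
     (y1 x + al * y x) - (y1 x - al * y x) - 2 * al * y 0 * e by ring.
  by rewrite C D; ring.
have kk : 2 * r * cabs (y x - y 0 * e) <= (ex * ep + fx) * cabs V + ex * cabs J + c * p x * H2 + c * p x * H2.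
  have -> : 2 * r * cabs (y x - y 0 * e) = cabs (2 * al * (y x - y 0 * e)).
    rewrite !cabsM -/r; congr (_ * _ * _).
    by rewrite -(rmorph_nat (real_complex R)) cabsR normr_nat.
  rewrite key (le_trans (cabsD _ _))// lerD// (le_trans (cabsD _ _))// lerD//.
  rewrite (le_trans (cabsB _ _))// lerD//; last by rewrite cabsM ce.
  rewrite cabsM ler_wpM2r ?cabs_ge0// (le_trans (cabsB _ _))// ceE cabsM ce cE//.
(* 13 = 1 + 2 + 5 + 5 from e J, the two inner integrals and the two terms in V; the power c^5 comes
   from e E V, where the c^3 in the bound of V meets two more weight inequalities. *)
have fin : cabs (y x - y 0 * e) * (2 * r) <= 8 * r * a * ep + 13 * c ^+ 5 * p x * H2.
  rewrite mulrC (le_trans kk)//.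
  have c3 : 0 <= c ^+ 3 by rewrite exprn_ge0.
  have s1 : ex * cabs J <= c ^+ 5 * p x * H2.
    have := ler_wpM2l (ltW ex0) kJ.
    have := ler_wpM2l (mulr_ge0 c0 H20) w3.
    have : c ^+ 2 * (p x * H2) <= c ^+ 5 * (p x * H2).
      by rewrite ler_wpM2r ?mulr_ge0// ler_weXn2l.
    rewrite expr2; lra.
  have s2 : c * p x * H2 <= c ^+ 5 * p x * H2.
    by rewrite ler_wpM2r// ler_wpM2r// exprS ler_peMr// exprn_ege1.
  have s3 : fx * cabs V <= 4 * r * a * ep + 5 * c ^+ 5 * p x * H2.
    have := ler_wpM2l (ltW fx0) kV.
    have := ler_wpM2l (mulr_ge0 c3 H20) w4.
    have : c ^+ 4 * (p x * H2) <= c ^+ 5 * (p x * H2).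
      by rewrite ler_wpM2r ?mulr_ge0// ler_weXn2l.
    have : fx * (4 * r * a * ep) <= 4 * r * a * ep.
      by rewrite ler_piMl// !mulr_ge0// ltW.
    rewrite !exprS !expr0 !mulr1; lra.
  have s4 : ex * ep * cabs V <= 4 * r * a * ep + 5 * c ^+ 5 * p x * H2.
    have := ler_wpM2l (mulr_ge0 (ltW ex0) (ltW ep0)) kV.
    have := ler_wpM2l (mulr_ge0 (mulr_ge0 c3 H20) (ltW ex0)) w1.
    have := ler_wpM2l (mulr_ge0 (mulr_ge0 c3 c0) H20) w3.
    have : ex * ep * (4 * r * a * ep) <= 4 * r * a * ep.
      rewrite ler_piMl// ?mulr_ge0// ?(ltW r0) ?(ltW ep0)//.
      by rewrite mulr_ile1 ?(ltW ex0) ?(ltW ep0)//; move: Eh; lra.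
    rewrite !exprS !expr0 !mulr1; lra.
  rewrite mulrDl; move: s1 s2 s3 s4; lra.
have r2 : 0 < 2 * r by rewrite mulr_gt0.
rewrite -(ler_pM2r r2) (le_trans fin)// le_eqVlt; apply/orP; left; apply/eqP.
rewrite /H2; field; rewrite gt_eqF//.
Qed.

End BoundaryValueProblem.

End Estimates.

(** * A priori bounds *)

Section Apriori.
Context {R : realType}.
Local Notation mu := (@lebesgue_measure R).
Local Notation itg D f := (mu.-integrable D (EFin \o f)).
Local Notation Re := (@complex.Re R).
Local Notation Im := (@complex.Im R).
Local Notation I0pi := (`[0, pi]%classic : set R).

Definition eventually_small (f : R -> R) := forall e, 0 < e -> exists A, forall r, A < r -> f r < e.

Lemma eventually_smallD f g : eventually_small f -> eventually_small g -> eventually_small (fun r => f r + g r).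
Proof.
move=> sf sg e e0; have e20 : 0 < e / 2 by rewrite divr_gt0.
have [A fA] := sf _ e20; have [B gB] := sg _ e20.
exists (Num.max A B) => r; rewrite gt_max => /andP[/fA fr /gB gr].
by rewrite (splitr e) ltrD.
Qed.

Lemma eventually_smallZ (c : R) f : 0 <= c -> eventually_small f -> eventually_small (fun r => c * f r).
Proof.
move=> c0 sf e e0; have c1 : 0 < c + 1 by rewrite ltr_wpDl.
have [A fA] := sf _ (divr_gt0 e0 c1); exists A => r /fA; rewrite ltr_pdivlMr// => fr.
have [f0|f0] := leP 0 (f r); last by rewrite (le_lt_trans _ e0)// mulr_ge0_le0// ltW.
by apply: le_lt_trans fr; rewrite mulrC ler_wpM2l// lerDl.
Qed.

Lemma eventually_small_exp (c : R) : 0 < c -> eventually_small (fun r => expR (- (c * r))).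
Proof.
move=> c0 e e0; exists (e^-1 / c) => r; rewrite ltr_pdivrMr// => er.
have r0 : 0 < r * c by apply: lt_trans er; rewrite invr_gt0.
rewrite expRN -[ltRHS]invrK ltf_pV2 ?posrE ?expR_gt0 ?invr_gt0//.
rewrite (lt_le_trans er)// mulrC (le_trans _ (expR_ge1Dx _))// lerDr//.
Qed.

(* Dominated convergence along the integers and monotonicity in the parameter. *)
Lemma eventually_small_exp_integral (c : R) (g : R -> R) : 0 < c -> (forall s, 0 <= g s) -> itg I0pi g ->
  eventually_small (fun r => \int[mu]_(s in I0pi) (expR (- (c * r * s)) * g s)).
Proof.
move=> c0 g0 ig e e0; have mp : measurable I0pi by exact: measurable_itv.
have cexp_ r : continuous (fun s : R => expR (- (c * r * s))).
  move=> s; apply: (@continuous_comp _ _ _ (fun s => - (c * r * s)) expR); last exact: continuous_expR.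
  by apply: cvgN; apply: cvgM; [exact: cvg_cst|exact: cvg_id].
have iE r : itg I0pi (fun s => expR (- (c * r * s)) * g s).
  by apply: itgM_bmeas => //; exact: bmeas_continuous.
have [] := @dominated_convergence _ _ R mu I0pi mp
  (fun n s => (expR (- (c * n%:R * s)) * g s)%:E) (cst 0%E) (EFin \o g).
- by move=> n; exact: measurable_int (iE n%:R).
- exact: measurable_cst.
- have : {ae mu, forall s : R, s != 0}.
    exists [set 0]; split; first exact: measurable_set1.
      exact: lebesgue_measure_set1.
    by move=> s /= /negP; rewrite negbK => /eqP.
  apply: ae_sub => s sn0; rewrite /= in_itv/= => /andP[s0 _].
  have {s0 sn0}s0 : 0 < s by rewrite lt0r sn0.
  apply: cvg_EFin; first by near=> n.
  rewrite -[X in _ --> X](mul0r (g s)); apply: cvgM; last exact: cvg_cst.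
  apply/cvgrPdist_lt => e' e'0.
  have [A hA] := eventually_small_exp (mulr_gt0 c0 s0) e'0.
  near=> n; rewrite sub0r normrN gtr0_norm ?expR_gt0//.
  rewrite (_ : c * n%:R * s = c * s * n%:R); last by ring.
  by apply: hA; near: n; exact: nbhs_infty_gtr.
- exact: ig.
- apply: aeW => s n; rewrite /= in_itv/= => /andP[s0 _].
  rewrite lee_fin normrM gtr0_norm ?expR_gt0// ger0_norm// ler_piMl//.
  by rewrite -expR0 ler_expR oppr_le0 !mulr_ge0// ltW.
move=> _ _; rewrite integral0.
move=> /fine_cvgP[_ /cvgrPdist_lt /(_ _ e0)[n _ /(_ n (leqnn n))]].
rewrite /= sub0r normrN => hn; exists n%:R => r nr.
apply: le_lt_trans hn; apply: le_trans (ler_norm _).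
apply: le_Rintegral => //.
move=> s; rewrite /= in_itv/= => /andP[s0 _]; rewrite ler_wpM2r// ler_expR lerN2.
by rewrite ler_wpM2r// ler_wpM2l ?(ltW c0)// ltW.
Unshelve. all: by end_near. Qed.

(** Bounds (1 + u)^k e^(-sg u) over u >= 0, from v^k / k! <= e^v at v = sg (1 + u). The summand 1
    puts it above 1, as [weight] demands. *)
Definition expbound (sg : R) (k : nat) : R := 1 + expR sg * k`!%:R / sg ^+ k.

Lemma expbound_ge1 sg k : 0 < sg -> 1 <= expbound sg k.
Proof.
by move=> s0; rewrite lerDl divr_ge0 ?mulr_ge0 ?expR_ge0// exprn_ge0// ltW.
Qed.

Lemma poly_exp_le (sg u : R) k : 0 < sg -> 0 <= u ->
  (1 + u) ^+ k * expR (- (sg * u)) <= expbound sg k.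
Proof.
move=> s0 u0; have v0 : 0 <= 1 + u by rewrite addr_ge0.
have kf : (0 : R) < k`!%:R by rewrite ltr0n fact_gt0.
have key : (sg * (1 + u)) ^+ k / k`!%:R <= expR (sg * (1 + u)).
  case: k kf => [|k] kf; first rewrite expr0 fact0 divr1.
    by rewrite (le_trans _ (expR_ge1Dx _))// lerDl mulr_ge0// ltW.
  apply: le_trans (expR_ge1Dxn k _); last by rewrite mulr_ge0// ltW.
  by rewrite lerDr.
rewrite /expbound (@le_trans _ _ (expR sg * k`!%:R / sg ^+ k))//; last by rewrite lerDr.
rewrite ler_pdivlMr ?exprn_gt0// expRN mulrAC ler_pdivrMr ?expR_gt0//.
move: key; rewrite exprMn mulrDr mulr1 expRD ler_pdivrMr// => key.
by rewrite mulrC [leRHS]mulrAC.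
Qed.

Definition poly_weight (r : R) (k : nat) (s : R) : R := (1 + r * `|s|) ^+ k.

Lemma poly_weight_ge1 r k s : 0 <= r -> 1 <= poly_weight r k s.
Proof. by move=> r0; apply: exprn_ege1; rewrite lerDl mulr_ge0. Qed.

Lemma poly_weight_le r k s x : 0 <= r -> 0 <= s <= x -> poly_weight r k s <= poly_weight r k x.
Proof.
move=> r0 /andP[s0 sx]; have x0 := le_trans s0 sx.
rewrite /poly_weight !ger0_norm//; apply: lerXn2r; rewrite ?nnegrE ?addr_ge0 ?mulr_ge0//.
by rewrite lerD2l ler_wpM2l.
Qed.

Lemma poly_weight_leS r k s : 0 <= r -> poly_weight r k s <= poly_weight r k.+1 s.
Proof. by move=> r0; apply: ler_weXn2l => //; rewrite lerDl mulr_ge0. Qed.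

Lemma poly_weight_exp_le (sg r t : R) k s : 0 < sg -> 0 <= r -> sg * r <= t -> 0 <= s ->
  expR (- (t * s)) * poly_weight r k s <= expbound sg k.
Proof.
move=> sg0 r0 sgt s0.
apply: le_trans (poly_exp_le k sg0 (mulr_ge0 r0 s0)).
rewrite mulrC /poly_weight ger0_norm// ler_wpM2l ?exprn_ge0 ?addr_ge0 ?mulr_ge0//.
by rewrite ler_expR lerN2 mulrA ler_wpM2r.
Qed.

(** Submultiplicativity, 1 + r|s| <= (1 + r|x|)(1 + r|x - s|), leaves a factor that the exponential
    absorbs. The resulting constant does not depend on r. *)
Lemma weight_poly_weight (sg r t : R) k : 0 < sg -> 0 <= r -> sg * r <= t ->
  weight t (expbound sg k) (poly_weight r k).
Proof.
move=> sg0 r0 sgt; split; first exact: expbound_ge1.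
  by move=> x; rewrite (le_trans ler01)// poly_weight_ge1.
move=> x s _ _.
have : poly_weight r k s <= poly_weight r k x * poly_weight r k (`|x - s|).
  rewrite /poly_weight -exprMn; apply: lerXn2r.
  - by rewrite nnegrE addr_ge0// mulr_ge0.
  - by rewrite nnegrE mulr_ge0// addr_ge0// mulr_ge0.
  rewrite normr_id mulrDl mul1r mulrDr mulr1.
  have sx : r * `|s| <= r * `|x| + r * `|x - s|.
    rewrite -mulrDr ler_wpM2l// -[s in `|s|](subKr x) (le_trans (ler_normB _ _))//.
  have : 0 <= r * `|x| * (r * `|x - s|) by rewrite !mulr_ge0.
  by move: sx; lra.
move=> /(ler_wpM2l (expR_ge0 (- (t * `|x - s|)))) /le_trans; apply.
rewrite mulrCA mulrC ler_wpM2r ?(le_trans ler01) ?poly_weight_ge1//.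
exact: poly_weight_exp_le.
Qed.

Lemma weight_cst (t : R) : 0 <= t -> weight t 1 (fun=> 1).
Proof.
move=> t0; split => // x s _ _; rewrite !mulr1 -expR0 ler_expR oppr_le0 mulr_ge0//.
Qed.

(** B0 makes the supremum finite, after which s <= A + s / 2 can be solved; the conclusion is free
    of B0, which for the solutions is not uniform in rho. *)
Lemma contraction_bound (D : set R) (f : R -> R) (A B0 : R) : 0 <= A ->
  (forall x, D x -> 0 <= f x) -> (forall x, D x -> f x <= B0) ->
  (forall B, 0 <= B -> (forall x, D x -> f x <= B) -> forall x, D x -> f x <= A + B / 2) ->
  forall x, D x -> f x <= 2 * A.
Proof.
move=> A0 f0 fB0 step x Dx; set s := sup [set f z | z in D].
have hs : has_sup [set f z | z in D].
  by split; [exists (f x), x|exists B0 => _ [z Dz <-]; exact: fB0].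
have fs z : D z -> f z <= s by move=> Dz; apply: sup_upper_bound => //; exists z.
have s0 : 0 <= s := le_trans (f0 x Dx) (fs x Dx).
have : s <= A + s / 2.
  by apply: ge_sup; [exists (f x), x|move=> _ [z Dz <-]; exact: step].
move=> ss; rewrite (le_trans (fs x Dx))//; lra.
Qed.

Definition kernel_bound (M : R -> R -> R[i]) (m : R -> R) :=
  [/\ (forall s, 0 <= m s), itg I0pi m &
    {ae mu, forall s, s \in I0pi -> cintegrable mu `[0, s] (M s) /\
      forall y B, cbmeas I0pi y -> (forall t, t \in `[0, s] -> cabs (y t) <= B) ->
        cabs (cintegral `[0, s] (fun t => M s t * y t)) <= m s * B}].

Lemma kernel_boundP M : integrable_kernel M -> exists m, kernel_bound M m.
Proof.
move=> /volterra_bound[m [m0 im am]]; exists m; split => //.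
by apply: ae_sub am => s am; rewrite in_I0pi => spi; apply: am; rewrite in_itv.
Qed.

(** Monotonicity of p serves the Volterra term: on [0, s] the solution is at most B p(s). The
    version without h feeds the remainder estimate, the full one the a priori bound. *)
Lemma forced_rhs_le M m q h (lam a b : R[i]) y y1 y2 (Q A B : R) (p : R -> R) :
  kernel_bound M m -> forced_solution M q h lam a b y y1 y2 ->
  (forall s, s \in I0pi -> cabs (q s) <= Q) ->
  (forall s x, 0 <= s <= x -> p s <= p x) ->
  (forall s, s \in I0pi -> cabs (h s) <= A * p s) -> 0 <= B ->
  (forall s, s \in I0pi -> cabs (y s) <= B * p s) ->
  {ae mu, forall s, s \in I0pi ->
     cabs (y2 s + lam * y s - h s) <= (Q + m s) * B * p s /\
     cabs (y2 s + lam * y s) <= ((Q + m s) * B + A) * p s}.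
Proof.
move=> [m0 im am] [acy _ _ _ eqy] qQ pm hA B0 yB.
apply: ae_sub (ae_and am eqy) => s [ms es] spi.
have spi' := spi; rewrite in_I0pi in spi'; have [s0 sp] := andP spi'.
have spi2 : s \in `[0, pi] by rewrite in_itv.
have {ms}[_ ms] := ms spi; have {}es := es spi2.
have k1 : cabs (q s * y s) <= Q * (B * p s).
  by rewrite cabsM ler_pM ?cabs_ge0 ?qQ ?yB.
have k2 : cabs (cintegral `[0, s] (fun t => M s t * y t)) <= m s * (B * p s).
  apply: ms; first exact: ac_cbmeas acy.
  move=> t; rewrite in_itv/= => /andP[t0 ts].
  rewrite (le_trans (yB t _)) ?in_I0pi ?t0 ?(le_trans ts)//.
  by rewrite ler_wpM2l// pm// t0.
have k3 : cabs (y2 s + lam * y s - h s) <= (Q + m s) * B * p s.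
  rewrite es addrK (le_trans (cabsD _ _))// (le_trans (lerD k1 k2))//; lra.
split => //; rewrite -[y2 s + _](subrK (h s)) (le_trans (cabsD _ _))// mulrDl lerD//.
exact: hA.
Qed.

Lemma mem_I0pi (x : R) : I0pi x -> x \in I0pi. Proof. by move/mem_set. Qed.

(** A bound B on |y| / p turns the right-hand side into a density with integral B kap + A pi;
    [bvp_estimate] and the smallness assumption then return a bound in which B is halved. *)
Lemma forced_apriori M m q h (al a b : R[i]) y y1 y2 (Q A t c : R) (p : R -> R) :
  kernel_bound M m -> forced_solution M q h (- al ^+ 2) a b y y1 y2 -> y pi = 0 ->
  (forall s, s \in I0pi -> cabs (q s) <= Q) -> 0 <= Q ->
  (forall s x, 0 <= s <= x -> p s <= p x) -> (forall s, 1 <= p s) ->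
  (forall s, s \in I0pi -> cabs (h s) <= A * p s) -> 0 <= A ->
  Re al = - t -> 0 < t -> weight t c p -> expR (- (t * pi)) <= 2^-1 ->
  13 * c ^+ 5 * (\int[mu]_(s in I0pi) (Q + m s)) / cabs al <= 2^-1 ->
  forall x, x \in I0pi -> cabs (y x) <= (10 * cabs a + 26 * c ^+ 5 * pi * A / cabs al) * p x.
Proof.
move=> km fs ypi qQ Q0 pm p1 hA A0 tal t0 wp Eh small.
have [m0 im am] := km; have [acy acy1 ya yb _] := fs.
have mp : measurable I0pi by exact: measurable_itv.
have iQm : itg I0pi (fun s => Q + m s).
  by apply: itgD => //; exact: itg_cst.
have [B0 B00 yB0] := cbmeas_bound (ac_cbmeas acy).
have c1 : 1 <= c by case: wp.
have c0 : 0 <= c by apply: le_trans c1.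
set kap := \int[mu]_(s in I0pi) (Q + m s) in small.
have px x : 0 < p x by apply: lt_le_trans (p1 x).
(* The free solution and 4 |a| e^(-t pi) together give at most 3 |a|, below 5 |a| p. The doubling in
   [contraction_bound] produces 10 and 26. *)
set A1 := 5 * cabs a + 13 * c ^+ 5 * (A * pi) / cabs al.
have A10 : 0 <= A1.
  by rewrite /A1 addr_ge0 ?divr_ge0 ?mulr_ge0 ?cabs_ge0 ?exprn_ge0 ?pi_ge0.
suff H x : I0pi x -> cabs (y x) / p x <= 2 * A1.
  move=> x /set_mem/H; rewrite ler_pdivrMr// => /le_trans; apply.
  rewrite le_eqVlt; apply/orP; left; apply/eqP; congr (_ * _).
  by rewrite /A1; ring.
apply: (@contraction_bound I0pi (fun x => cabs (y x) / p x) A1 B0) => //.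
- by move=> z _; rewrite divr_ge0 ?cabs_ge0 ?ltW.
- move=> z zpi; rewrite ler_pdivrMr// (le_trans (yB0 _ zpi))// ler_peMr//.
move=> B B_ge0 yB z zpi.
have yB' s : s \in I0pi -> cabs (y s) <= B * p s.
  by move=> /set_mem/yB; rewrite ler_pdivrMr.
have F := forced_rhs_le km fs qQ pm hA B_ge0 yB'.
have ih : itg I0pi (fun s => B * (Q + m s) + A).
  by apply: itgD => //; [exact: itgZ|exact: itg_cst].
have h0 s : 0 <= B * (Q + m s) + A by rewrite addr_ge0 ?mulr_ge0 ?addr_ge0.
have Fh : {ae mu, forall s, s \in I0pi ->
    cabs (y2 s - al ^+ 2 * y s) <= (B * (Q + m s) + A) * p s}.
  apply: ae_sub F => s F spi; have [_] := F spi.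
  by rewrite mulNr [B * _]mulrC.
have est := bvp_estimate acy acy1 ypi tal t0 wp ih h0 Fh Eh (mem_I0pi zpi).
have IE : \int[mu]_(s in I0pi) (B * (Q + m s) + A) = B * kap + A * pi.
  rewrite RintegralD//; [|exact: itgZ|exact: itg_cst].
  rewrite RintegralZl// Rintegral_cst//; congr (_ + _ * _).
  have := @lebesgue_measure_itv R `[0, pi]; rewrite /= lte_fin pi_gt0/= oppr0 adde0 => mupi.
  by rewrite -[RHS]/(fine pi%:E) -mupi.
rewrite IE ya in est.
have zpi' : 0 <= z by move: zpi; rewrite /= in_itv/= => /andP[].
have e1 : cabs (cexp (al * z%:C)) <= 1.
  by rewrite cabs_cexpR tal -expR0 ler_expR mulNr oppr_le0 mulr_ge0// ltW.
rewrite ler_pdivrMr//.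
have : cabs (y z) <= cabs (y z - a * cexp (al * z%:C)) + cabs a * cabs (cexp (al * z%:C)).
  by rewrite -cabsM; apply: le_trans (cabsD _ _); rewrite subrK.
have a0 := cabs_ge0 a.
have e2 : cabs a * cabs (cexp (al * z%:C)) <= cabs a by rewrite ler_piMr.
have e3 : 4 * cabs a * expR (- (t * pi)) <= 2 * cabs a.
  have := ler_wpM2l a0 Eh; lra.
have e4 : 3 * cabs a <= 5 * cabs a * p z.
  have := ler_wpM2l a0 (p1 z); lra.
have e5 : 13 * c ^+ 5 * p z * (B * kap + A * pi) / cabs al =
   (13 * c ^+ 5 * kap / cabs al) * (B * p z) + 13 * c ^+ 5 * (A * pi) / cabs al * p z by ring.
have e6 := ler_wpM2r (mulr_ge0 B_ge0 (ltW (px z))) small.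
move: est e2 e3 e4 e6; rewrite e5 /A1; clear; lra.
Qed.

Lemma potential_bounded (q : R -> R[i]) : analytic_on I0pi q -> cbmeas I0pi q.
Proof.
move=> qa; split; apply: bmeas_within_continuous;
  apply: continuous_in_subspaceT => x /set_mem/qa/analytic_at_ReIm[];
  [by move=> + _; exact: real_analytic_continuous|by move=> _; exact: real_analytic_continuous].
Qed.

End Apriori.

(** * The sector, Taylor remainders and Laplace integrals *)

Section Asymptotics.
Context {R : realType}.
Local Notation mu := (@lebesgue_measure R).
Local Notation itg D f := (mu.-integrable D (EFin \o f)).
Local Notation Re := (@complex.Re R).
Local Notation Im := (@complex.Im R).
Local Notation I0pi := (`[0, pi]%classic : set R).

(** sg is the minimum of sin on [delta, pi - delta]. As Re (i rho) = - Im rho, it bounds the decay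
    rate from below uniformly in the sector. *)
Lemma sector_lower_bound (delta : R) : 0 < delta < pi / 2 -> exists2 sg, 0 < sg &
  forall rho, sector delta rho -> 0 < cabs rho /\ sg * cabs rho <= Im rho.
Proof.
move=> /andP[d0 dpi]; have dd : delta <= pi - delta by lra.
have [c cd hc] := EVT_min dd (continuous_subspaceT (@continuous_sin R)).
exists (sin c).
  by apply: sin_gt0_pi; move: cd; rewrite in_itv/= => /andP[c1 c2]; apply/andP; split; lra.
move=> _ [r [th [r0 dth ->]]].
have cr : cabs (r%:C * (cos th +i* sin th)) = r.
  by rewrite cabsM cabsR gtr0_norm// /cabs/= cos2Dsin2 sqrtr1 mulr1.
rewrite cr; split => //.
by rewrite complex_ImM /= mul0r addr0 mulrC ler_wpM2l ?(ltW r0)// hc// in_itv.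
Qed.

(** Beyond the local radius r the remainder is merely bounded, but there x^m >= r^m, so a larger
    constant covers it. *)
Lemma taylor_global (f : R -> R[i]) (m : nat) : analytic_on I0pi f ->
  exists2 C, 0 <= C & forall x, x \in I0pi ->
    cabs (f x - \sum_(0 <= i < m) cderive1n i f 0 / i`!%:R * x%:C ^+ i) <= C * x ^+ m.
Proof.
move=> fa; have bf := potential_bounded fa.
have [|r [C [r0 C0 hC]]] := @analytic_taylor _ f m.
  by apply: fa; rewrite /= in_itv/= lexx pi_ge0.
have bX (n : nat) : cbmeas I0pi (fun x : R => x%:C ^+ n).
  elim: n => [|n IH]; first by under [X in cbmeas _ X]eq_fun do rewrite expr0; exact: cbmeas_cst.
  under [X in cbmeas _ X]eq_fun do rewrite exprS; apply: cbmeasM => //; split; apply: bmeas_continuous => x /=.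
    exact: cvg_id.
  exact: cvg_cst.
have bP n : cbmeas I0pi (fun x => \sum_(0 <= i < n) cderive1n i f 0 / i`!%:R * x%:C ^+ i).
  elim: n => [|n IH]; first by under [X in cbmeas _ X]eq_fun do rewrite big_nil; exact: cbmeas_cst.
  under [X in cbmeas _ X]eq_fun do rewrite big_nat_recr//=; apply: cbmeasD => //.
  by apply: cbmeasM => //; exact: cbmeas_cst.
have [B B0 hB] := cbmeas_bound (cbmeasB bf (bP m)).
exists (C + B / r ^+ m); first by rewrite addr_ge0// divr_ge0// exprn_ge0// ltW.
move=> x; rewrite in_I0pi => xpi; have [x0 xp] := andP xpi.
have [xr|rx] := leP x r.
  have := hC x; rewrite ger0_norm// => /(_ xr) /le_trans; apply.
  by rewrite ler_wpM2r ?exprn_ge0// lerDl divr_ge0// exprn_ge0// ltW.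
have xx : I0pi x by rewrite /= in_itv.
rewrite (le_trans (hB x xx))//.
rewrite mulrDl -[leLHS]add0r lerD ?mulr_ge0 ?exprn_ge0//.
rewrite -mulrA ler_peMr// mulrC ler_pdivlMr ?exprn_gt0// mul1r.
by apply: lerXn2r; rewrite ?nnegrE// ltW.
Qed.

Definition monomial (k : nat) (s : R) : R[i] := (s ^+ k / k`!%:R)%:C.

Lemma cbmeas_monomial k : cbmeas I0pi (monomial k).
Proof.
split; apply: bmeas_continuous => x /=; last exact: cvg_cst.
by apply: cvgM; [exact: exprn_continuous|exact: cvg_cst].
Qed.

Lemma ac_monomial0 : ac_derivative (monomial 0) (fun=> 0).
Proof.
split; first exact: cintegrable_cbmeas (cbmeas_cst _ _).
move=> x _; rewrite /monomial !expr0; apply: complex_eq; rewrite ?complex_ReD ?complex_ImD/=;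
 by rewrite Rintegral_cst//= mul0r addr0.
Qed.

Lemma ac_monomialS k : ac_derivative (monomial k.+1) (monomial k).
Proof.
split; first exact: cintegrable_cbmeas (cbmeas_monomial k).
move=> x; rewrite in_itv/= => /andP[x0 _].
rewrite /monomial expr0n mul0r add0r; apply: complex_eq => /=; last first.
  by rewrite Rintegral_cst//= mul0r.
have cf : continuous (fun s : R => s ^+ k / k`!%:R).
  by move=> s; apply: cvgM; [exact: exprn_continuous|exact: cvg_cst].
have dF (s : R) : is_derive s (1 : R) (fun s => s ^+ k.+1 / k.+1`!%:R) (s ^+ k / k`!%:R).
  rewrite (_ : (fun s => _) = k.+1`!%:R^-1 *: ((@id R) ^+ k.+1)); last first.
    by apply/funext => z; rewrite mulrC; congr (_ * _); elim: k.+1 => // n; rewrite !exprS => ->.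
  apply: is_derive_eq; rewrite /GRing.scale/= factS natrM mulr1; field.
  by rewrite pnatr_eq0 -lt0n fact_gt0/= addrC natr1 pnatr_eq0.
by rewrite (Rintegral_FTC2 x0 cf dF) expr0n mul0r subr0.
Qed.

(** Each integration by parts lowers the degree by one and leaves a boundary term at pi: k + 1
    terms, each at most (1 + |be| pi)^k e^(Re be pi). *)
Lemma monomial_laplace (be : R[i]) (k : nat) : Re be < 0 ->
  cabs ((- be) ^+ k.+1 * cintegral I0pi (fun s => cexp (be * s%:C) * monomial k s) - 1) <=
  k.+1%:R * (1 + cabs be * pi) ^+ k * expR (Re be * pi).
Proof.
move=> be0; have pi0 := pi_ge0 R.
have pp : 0 <= (pi : R) <= pi by rewrite pi0 lexx.
have mp : measurable I0pi by exact: measurable_itv.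
have b1 : 1 <= 1 + cabs be * pi by rewrite lerDl mulr_ge0// cabs_ge0.
elim: k => [|k IH].
  have := cexp_integration_by_parts be pp ac_monomial0.
  have e s : cexp (be * s%:C) * (0 + be * monomial 0 s) =
    be * (cexp (be * s%:C) * monomial 0 s) by ring.
  rewrite (eq_cintegral (fun s _ => e s)) cintegralZ//; last first.
    by apply: cintegrable_cbmeas; apply: cbmeasM; [exact: cbmeas_cexp|exact: cbmeas_monomial].
  rewrite expr1 mulNr => ->.
  have mon0 s : monomial 0 s = 1 by rewrite /monomial expr0 fact0 divr1.
  rewrite (mon0 pi) (mon0 0).
  rewrite mulr1 opprB [1 - _]addrC addrK cabsN cabs_cexpR expr0 !mul1r//.
have := cexp_integration_by_parts be pp (ac_monomialS k).
have e s : cexp (be * s%:C) * (monomial k s + be * monomial k.+1 s) =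
  cexp (be * s%:C) * monomial k s + be * (cexp (be * s%:C) * monomial k.+1 s) by ring.
have im j : cintegrable mu I0pi (fun s => cexp (be * s%:C) * monomial j s).
  by apply: cintegrable_cbmeas; apply: cbmeasM; [exact: cbmeas_cexp|exact: cbmeas_monomial].
rewrite (eq_cintegral (fun s _ => e s)) cintegralD//; last exact: cintegrableZ.
rewrite cintegralZ// [monomial k.+1 0]/monomial expr0n mul0r subr0.
set Ik := cintegral _ _ in IH *; set Ik1 := cintegral _ _ => eqI.
have -> : (- be) ^+ k.+2 * Ik1 - 1 =
    ((- be) ^+ k.+1 * Ik - 1) - (- be) ^+ k.+1 * (cexp (be * pi%:C) * monomial k.+1 pi).
  by rewrite -eqI exprS; ring.
rewrite (le_trans (cabsB _ _))// -natr1 mulrDl mulrDl lerD//.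
  rewrite (le_trans IH)// ler_wpM2r ?expR_ge0// ler_wpM2l// ler_weXn2l//.
rewrite mul1r !cabsM cabsX cabsN cabs_cexpR /monomial cabsR mulrCA mulrC.
rewrite ler_wpM2r ?expR_ge0// ger0_norm ?divr_ge0 ?exprn_ge0//.
rewrite mulrA -exprMn ler_pdivrMr ?ltr0n ?fact_gt0//.
rewrite (@le_trans _ _ ((1 + cabs be * pi) ^+ k.+1))//.
  by apply: lerXn2r; rewrite ?nnegrE ?addr_ge0 ?mulr_ge0 ?cabs_ge0// lerDr.
rewrite ler_peMr ?exprn_ge0 ?(le_trans ler01 b1)// ler1n fact_gt0//.
Qed.

End Asymptotics.

(** * The difference of two Weyl functions *)

Section WeylDifference.
Context {R : realType}.
Local Notation mu := (@lebesgue_measure R).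
Local Notation itg D f := (mu.-integrable D (EFin \o f)).
Local Notation Re := (@complex.Re R).
Local Notation Im := (@complex.Im R).
Local Notation I0pi := (`[0, pi]%classic : set R).

Context (M : R -> R -> R[i]) (m : R -> R) (Q sg : R).
Context (hM : integrable_kernel M) (km : kernel_bound M m) (Q0 : 0 <= Q) (sg0 : 0 < sg).
Let kap := \int[mu]_(s in I0pi) (Q + m s).

Let mp : measurable I0pi. Proof. exact: measurable_itv. Qed.
Let m0 : forall s, 0 <= m s. Proof. by case: km. Qed.
Let im : itg I0pi m. Proof. by case: km. Qed.
Let iQm : itg I0pi (fun s => Q + m s).
Proof. by apply: itgD => //; exact: itg_cst. Qed.
Let Qm0 : forall s, 0 <= Q + m s. Proof. by move=> s; rewrite addr_ge0. Qed.
Let kap0 : 0 <= kap. Proof. exact: Rintegral_ge0. Qed.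
Let pi0 : (0 : R) < pi. Proof. exact: pi_gt0. Qed.

Let exp_half (t r : R) : 0 < r -> sg * r <= t -> 1 <= sg * r * pi ->
  expR (- (t * pi)) <= 2^-1.
Proof.
move=> r0 sgt big; rewrite expRN lef_pV2 ?posrE ?expR_gt0//.
apply: le_trans (expR_ge1Dx _); have := ler_wpM2r (ltW pi0) sgt; lra.
Qed.

Local Ltac light_lra :=
  clear - M m Q sg hM km Q0 sg0 kap mp m0 im iQm Qm0 kap0 pi0 exp_half; lra.

(** Applied to S, this keeps large rho away from the zeros of Delta_1. If y vanished at both ends,
    the a priori bound with zero data would give y = 0 on [0, pi], hence K = J = 0 and b (1 - E^2) =
    0, while |E| <= 1/2. *)
Lemma initial_value_neq0 (q : R -> R[i]) (al b : R[i]) (t : R) y y1 y2 :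
  (forall s, s \in I0pi -> cabs (q s) <= Q) ->
  forced_solution M q (fun=> 0) (- al ^+ 2) 0 b y y1 y2 -> b != 0 ->
  Re al = - t -> 0 < cabs al -> sg * cabs al <= t ->
  1 <= sg * cabs al * pi -> 26 * kap <= cabs al -> y pi != 0.
Proof.
move=> qQ fs b0 tal r0 sgt big big2; apply: contra_neqN b0 => /eqP ypi.
have t0 : 0 < t by apply: lt_le_trans sgt; rewrite mulr_gt0.
have wt := weight_cst (ltW t0); have Eh := exp_half r0 sgt big.
have z0 s : s \in I0pi -> cabs ((fun=> 0 : R[i]) s) <= 0 * (fun=> 1 : R) s.
  by rewrite cabs0 mul0r.
have y0 : forall x, x \in I0pi -> cabs (y x) <= 0.
  move=> x xpi; have := @forced_apriori _ M m q (fun=> 0) al 0 b y y1 y2 Q 0 t 1 (fun=> 1)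
    km fs ypi qQ Q0 (fun _ _ _ => lexx _) (fun=> lexx _) z0 (lexx _) tal t0 wt Eh.
  rewrite cabs0 !mulr0 mul0r addr0 mul0r expr1n mulr1; apply => //.
  by rewrite ler_pdivrMr// -/kap; lra.
have [acy acy1 ya yb eqy] := fs.
have Fh : {ae mu, forall s, s \in I0pi ->
    cabs (y2 s - al ^+ 2 * y s) <= (cst 0 : R -> R) s * (fun=> 1 : R) s}.
  have F' := @forced_rhs_le _ M m q (fun=> 0) (- al ^+ 2) 0 b y y1 y2 Q 0 0 (fun=> 1) km fs qQ
    (fun _ _ _ => lexx _) z0 (lexx 0).
  apply: ae_sub (F' _) => [s Fs spi|s spi]; last by rewrite mul0r y0.
  by have [_] := Fs spi; rewrite mulNr mulr0 addr0 mul0r.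
have i0 : itg I0pi (cst 0 : R -> R) by exact: itg_cst.
have h0 : forall s, 0 <= (cst 0 : R -> R) s by [].
have KL := bvp_K_le acy acy1 tal wt i0 h0 Fh.
have JL := bvp_J_le acy acy1 tal wt i0 h0 Fh.
have := @bvp_initial R al y y1 y2 acy acy1 ypi.
move: KL JL; rewrite Rintegral_cst// mul0r !mulr0 => KL JL.
set K := _ * cintegral _ _ in KL *; set J := cintegral _ _ in JL *.
have -> : K = 0 by apply/eqP; rewrite -cabs_eq0 eq_le KL cabs_ge0.
have -> : J = 0 by apply/eqP; rewrite -cabs_eq0 eq_le JL cabs_ge0.
rewrite ya yb !mulr0 subr0 !addr0 => /eqP; rewrite mulf_eq0 => /orP[/eqP->//|].
rewrite subr_eq0 => /eqP /(congr1 cabs); rewrite cabs1 cabsX cabs_cexpR tal mulNr => E1.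
exfalso; have := ler_wpM2l (expR_ge0 (- (t * pi))) Eh; move: E1 Eh; rewrite expr2.
move=> <-; have := expR_ge0 (- (t * pi)); lra.
Qed.

(** The limit in quantitative form, with a bound depending on al only through r. [C2 / r] bounds y -
    e^(al x), [D / r^(k+1)] bounds w relative to its weight, and [g] controls F without its leading
    part. The terms on the right come, in order, from E K, from J without its leading part, from
    cutting the Laplace integral at pi, and from d E^2; the outer 2 bounds 1 / |1 - E^2|. *)
Lemma weyl_difference_bound (k : nat) (q qt : R -> R[i]) (d al b1 b2 : R[i]) (C0 C1 t : R)
    y y1 y2 z z1 z2 (r := cabs al) (C2 := 4 / (sg * pi) + 130 * kap)
    (c := expbound sg k) (c' := expbound (sg / 2) k.+1) (D := 260 * c ^+ 5 * pi * C0)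
    (g := fun s => D * (Q + m s) + (C0 * C2 + C1)) :
  (forall s, s \in I0pi -> cabs (q s) <= Q) ->
  (forall s, s \in I0pi -> cabs (qt s) <= Q) ->
  0 <= C0 -> 0 <= C1 ->
  (forall s, s \in I0pi -> cabs (q s - qt s) <= C0 * s ^+ k) ->
  (forall s, s \in I0pi -> cabs (q s - qt s - d * monomial k s) <= C1 * s ^+ k.+1) ->
  forced_solution M q (fun=> 0) (- al ^+ 2) 1 b1 y y1 y2 -> y pi = 0 ->
  forced_solution M qt (fun=> 0) (- al ^+ 2) 1 b2 z z1 z2 -> z pi = 0 ->
  Re al = - t -> 0 < r -> sg * r <= t ->
  1 <= sg * r * pi -> 26 * c ^+ 5 * kap <= r ->
  cabs ((- (2 * al)) ^+ k.+1 * (b1 - b2) + d) <=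
  2 * (2 ^+ k.+1 * (2 * c * c' * (D * kap + 10 * C0) * expR (- (sg / 2 * pi * r)) +
         2 * c' * \int[mu]_(s in I0pi) (expR (- (sg / 2 * r * s)) * g s)) +
       cabs d * (k.+1%:R * 2 ^+ k * c' * expR (- (sg / 2 * pi * r))) +
       cabs d * expR (- (sg / 2 * pi * r))).
Proof.
move=> qQ qtQ C00 C10 qC0 qC1 fy ypi fz zpi tal r0 sgt big big2.
have c1 : 1 <= c := expbound_ge1 k sg0.
have c0 : 0 <= c := le_trans ler01 c1.
have c5 : 1 <= c ^+ 5 by exact: exprn_ege1.
have sg20 : 0 < sg / 2 by rewrite divr_gt0.
have c'1 : 1 <= c' := expbound_ge1 k.+1 sg20.
have c'0 : 0 <= c' := le_trans ler01 c'1.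
have t0 : 0 < t by apply: lt_le_trans sgt; rewrite mulr_gt0.
have Eh := exp_half r0 sgt big; have wt := weight_cst (ltW t0).
have D0 : 0 <= D by rewrite /D !mulr_ge0 ?exprn_ge0 ?(ltW pi0).
have C20 : 0 <= C2 by rewrite /C2 addr_ge0 ?divr_ge0 ?mulr_ge0 ?(ltW pi0) ?(ltW sg0).
have DE : D = 260 * c ^+ 5 * pi * C0 by [].
have C2E : C2 = 4 / (sg * pi) + 130 * kap by [].
have c'E : c' = expbound (sg / 2) k.+1 by [].
clearbody D C2 c'.
have cE' : c = expbound sg k by [].
clearbody c.
have g0 s : 0 <= g s := addr_ge0 (mulr_ge0 D0 (Qm0 s)) (addr_ge0 (mulr_ge0 C00 C20) C10).
have ig : itg I0pi g by apply: itgD => //; [exact: itgZ|exact: itg_cst].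
have z0 s : s \in I0pi -> cabs ((fun=> 0 : R[i]) s) <= 0 * (fun=> 1 : R) s.
  by rewrite cabs0 mul0r.
have kap26 : 26 * kap <= r.
  apply: le_trans big2; rewrite ler_wpM2r//; have := c5; light_lra.
(* The constant of [forced_apriori] for a = 1 and the unit weight; it is the source of 130 = 13 * 10
   in [C2] and of 260 = 26 * 10 in [D]. *)
have y10 x : x \in I0pi -> cabs (y x) <= 10.
  move=> xpi; have := @forced_apriori _ M m q (fun=> 0) al 1 b1 y y1 y2 Q 0 t 1 (fun=> 1)
    km fy ypi qQ Q0 (fun _ _ _ => lexx _) (fun=> lexx _) z0 (lexx _) tal t0 wt Eh.
  rewrite cabs1 !mulr0 mul0r addr0 mulr1 expr1n mulr1 mulr1; apply => //.
  by rewrite ler_pdivrMr// -/kap -/r; lra.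
have [acy acy1 ya yb eqy] := fy.
have ye x : x \in I0pi -> cabs (y x - cexp (al * x%:C)) <= C2 / r.
  move=> xpi.
  have F := @forced_rhs_le _ M m q (fun=> 0) (- al ^+ 2) 1 b1 y y1 y2 Q 0 10 (fun=> 1) km fy qQ
    (fun _ _ _ => lexx _) z0 (ler0n _ _).
  have Fh : {ae mu, forall s, s \in I0pi ->
      cabs (y2 s - al ^+ 2 * y s) <= (10 * (Q + m s)) * (fun=> 1 : R) s}.
    apply: ae_sub (F _) => [s Fs spi|s spi]; last by rewrite mulr1 y10.
    by have [_] := Fs spi; rewrite mulNr addr0 [10 * _]mulrC.
  have i10 : itg I0pi (fun s => 10 * (Q + m s)) by exact: itgZ.
  have h10 s : 0 <= 10 * (Q + m s) by rewrite mulr_ge0.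
  have := bvp_estimate acy acy1 ypi tal t0 wt i10 h10 Fh Eh xpi.
  rewrite ya mul1r cabs1 RintegralZl// -/kap -/r expr1n !mulr1 => /le_trans; apply.
  have -> : C2 / r = 4 / (sg * pi) / r + 130 * kap / r by rewrite C2E mulrDl.
  apply: lerD; last by rewrite mulrA -natrM.
  (* The first part of C2: e^(t pi) >= t pi >= sg pi r. *)
  rewrite expRN -mulrA ler_wpM2l// -invfM lef_pV2 ?posrE ?expR_gt0 ?mulr_gt0//.
  rewrite (le_trans _ (expR_ge1Dx _))//.
  have := ler_wpM2r (ltW pi0) sgt; light_lra.
(* w vanishes at both endpoints and solves the equation for qt with forcing (q - qt) y. *)
have fw := forced_comb (-1) hM (forced_potential qt fy) fz.
set h := fun x => _ in fw.
set w := (fun x => y x + -1 * z x) in fw; set w1 := (fun x => y1 x + -1 * z1 x) in fw.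
set w2 := (fun x => y2 x + -1 * z2 x) in fw.
have hE x : h x = (q x - qt x) * y x by rewrite /h; ring.
rewrite (_ : 1 + -1 * 1 = 0) in fw; last by ring.
rewrite (_ : b1 + -1 * b2 = b1 - b2) in fw; last by ring.
have wpi : w pi = 0 by rewrite /w ypi zpi mulr0 addr0.
have r00 := ltW r0.
have rn j : 0 < r ^+ j by rewrite exprn_gt0.
have p1 s : 1 <= poly_weight r k s by exact: poly_weight_ge1.
have pm s x : 0 <= s <= x -> poly_weight r k s <= poly_weight r k x by exact: poly_weight_le.
have wp := weight_poly_weight k sg0 r00 sgt; rewrite -cE' in wp.
(* Since r s <= 1 + r s, powers of s are traded for inverse powers of r. *)
have spow j s : 0 <= s -> s ^+ j <= poly_weight r j s / r ^+ j.
  move=> s0; rewrite ler_pdivlMr// -exprMn /poly_weight ger0_norm//.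
  by apply: lerXn2r; rewrite ?nnegrE ?addr_ge0 ?mulr_ge0// mulrC lerDr.
have hA s : s \in I0pi -> cabs (h s) <= 10 * C0 / r ^+ k * poly_weight r k s.
  move=> spi; rewrite hE cabsM.
  have s0 : 0 <= s by move: spi; rewrite in_I0pi => /andP[].
  apply: (@le_trans _ _ (C0 * s ^+ k * 10)); first by rewrite ler_pM ?cabs_ge0 ?qC0 ?y10.
  have := ler_wpM2l C00 (spow k s s0); light_lra.
have [A AE] : exists A, A = 10 * C0 / r ^+ k by eexists.
rewrite -AE in hA; have A0 : 0 <= A by rewrite AE divr_ge0 ?mulr_ge0// ltW.
have big3 : 13 * c ^+ 5 * kap / r <= 2^-1 by rewrite ler_pdivrMr//; move: big2; light_lra.
have [W WE] : exists W, W = D / r ^+ k.+1 by eexists.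
have W0 : 0 <= W by rewrite WE divr_ge0// ltW.
(* The forcing has order r^(-k) relative to the weight; the factor 1 / |al| of the a priori bound
   supplies the last power. *)
have wW x : x \in I0pi -> cabs (w x) <= W * poly_weight r k x.
  move=> xpi; have := @forced_apriori _ M m qt h al 0 (b1 - b2) w w1 w2 Q A t c (poly_weight r k)
    km fw wpi qtQ Q0 pm p1 hA A0 tal t0 wp Eh big3 x xpi.
  rewrite cabs0 mulr0 add0r -/r (_ : 26 * c ^+ 5 * pi * A / r = W)//.
  by rewrite WE AE DE (exprS r k); field; rewrite !gt_eqF.
have Fw := forced_rhs_le km fw qtQ pm hA W0 wW.
have [acw acw1 wa wb _] := fw.
have sE s : w2 s + - al ^+ 2 * w s = w2 s - al ^+ 2 * w s by ring.
have iK : itg I0pi (fun s => W * (Q + m s) + A).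
  by apply: itgD => //; [exact: itgZ|exact: itg_cst].
have hK s : 0 <= W * (Q + m s) + A by rewrite addr_ge0 ?mulr_ge0.
have FK : {ae mu, forall s, s \in I0pi ->
    cabs (w2 s - al ^+ 2 * w s) <= (W * (Q + m s) + A) * poly_weight r k s}.
  apply: ae_sub Fw => s Fs spi; have [_] := Fs spi.
  by rewrite mulNr [W * _]mulrC.
have KL := bvp_K_le acw acw1 tal wp iK hK FK.
have init := @bvp_initial R al w w1 w2 acw acw1 wpi.
have IK : \int[mu]_(s in I0pi) (W * (Q + m s) + A) = W * kap + A * pi.
  rewrite RintegralD//; [|exact: itgZ|exact: itg_cst].
  rewrite RintegralZl// Rintegral_cst//; congr (_ + _ * _).
  have := @lebesgue_measure_itv R `[0, pi]; rewrite /= lte_fin pi_gt0/= oppr0 adde0 => mupi.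
  by rewrite -[RHS]/(fine pi%:E) -mupi.
rewrite IK in KL.
rewrite wa wb !mulr0 !addr0 in init.
set E := cexp (al * pi%:C) in init KL *.
set K := E * cintegral _ _ in init KL; set J := cintegral _ _ in init.
set ep := expR (- (t * pi)) in Eh *.
have cE : cabs E = ep by rewrite /E cabs_cexpR tal mulNr.
set et := expR (- (sg / 2 * pi * r)).
have pipos := ltW pi0.
(* Half of e^(-t pi) absorbs the weight at pi, the other half remains as [et]. *)
have epp : ep * poly_weight r k.+1 pi <= c' * et.
  have sg2 : sg / 2 * r <= t / 2 by move: sgt; light_lra.
  have e1 := @poly_weight_exp_le _ (sg / 2) r (t / 2) k.+1 pi sg20 r00 sg2 pipos.
  rewrite -c'E in e1.
  have -> : ep = expR (- (t / 2 * pi)) * expR (- (t / 2 * pi)).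
    by rewrite /ep -expRD; congr expR; field.
  rewrite mulrAC ler_pM ?mulr_ge0 ?expR_ge0//.
    by rewrite (le_trans ler01)// poly_weight_ge1.
  by rewrite ler_expR lerN2 mulrAC ler_wpM2r.
have pkk : poly_weight r k pi <= poly_weight r k.+1 pi by exact: poly_weight_leS.
have etaA : r ^+ k.+1 * cabs (E * K) <= 2 * c * c' * (D * kap + 10 * C0) * et.
  have wr : r * pi * poly_weight r k pi <= poly_weight r k.+1 pi.
    rewrite /poly_weight exprS ler_wpM2r ?exprn_ge0 ?addr_ge0 ?mulr_ge0//.
    by rewrite ger0_norm// lerDr.
  have eK : r ^+ k.+1 * cabs K <= 2 * c * (D * kap + 10 * C0) * poly_weight r k.+1 pi.
    apply: (le_trans (ler_wpM2l (ltW (rn k.+1)) KL)).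
    have -> : r ^+ k.+1 * (2 * (c * poly_weight r k pi * (W * kap + A * pi))) =
       2 * c * (D * kap * poly_weight r k pi + 10 * C0 * (r * pi * poly_weight r k pi)).
      by rewrite WE AE (exprS r k); field; rewrite !gt_eqF.
    rewrite -[leRHS]mulrA; apply: ler_wpM2l; first exact: mulr_ge0.
    rewrite [leRHS]mulrDl; apply: lerD; first by rewrite ler_wpM2l ?mulr_ge0.
    by rewrite ler_wpM2l ?mulr_ge0.
  rewrite cabsM cE mulrCA.
  apply: (le_trans (ler_wpM2l (expR_ge0 _) eK)).
  have cc : 0 <= 2 * c * (D * kap + 10 * C0) by rewrite !(mulr_ge0, addr_ge0).
  have := ler_wpM2l cc epp; rewrite /ep; light_lra.
(* The leading part of F is d (s^k / k!) e^(al s), since y is close to e^(al s). Against the outer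
   e^(al s) it yields the Laplace integral [Ik] at 2 al. *)
pose G s := (w2 s - al ^+ 2 * w s) - d * (monomial k s * cexp (al * s%:C)).
pose JG := cintegral I0pi (fun s => cexp (al * s%:C) * G s).
pose Ik := cintegral I0pi (fun s => cexp (2 * al * s%:C) * monomial k s).
have bexp : cbmeas I0pi (fun s : R => cexp (al * s%:C)) by exact: cbmeas_cexp.
have bmon : cbmeas I0pi (fun s : R => monomial k s * cexp (al * s%:C)).
  by apply: cbmeasM => //; exact: cbmeas_monomial.
have iF : cintegrable mu I0pi (fun s => w2 s - al ^+ 2 * w s).
  apply: cintegrableB => //; first by case: acw1.
  by apply: cintegrable_cbmeas; apply: cbmeasM; [exact: cbmeas_cst|exact: ac_cbmeas acw].
have iG : cintegrable mu I0pi G.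
  by apply: cintegrableB => //; apply: cintegrableZ => //; exact: cintegrable_cbmeas.
have JE : J = JG + d * Ik.
  rewrite /Ik -cintegralZ//; last first.
    by apply: cintegrable_cbmeas; apply: cbmeasM; [exact: cbmeas_cexp|exact: cbmeas_monomial].
  rewrite -cintegralD//; last 2 first.
  - exact: cintegrableM.
  - apply: cintegrableZ => //; apply: cintegrable_cbmeas.
    by apply: cbmeasM; [exact: cbmeas_cexp|exact: cbmeas_monomial].
  apply: eq_cintegral => s _; rewrite /G.
  have -> : 2 * al * s%:C = al * s%:C + al * s%:C by ring.
  by rewrite cexpD; ring.
(* Part of the decay of e^(al s) is left in front of g, for dominated convergence. *)
pose p' s := poly_weight r k.+1 s / r ^+ k.+1 * expR (sg / 2 * r * s).
have p'0 s : 0 <= p' s.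
  by rewrite /p' mulr_ge0 ?expR_ge0// divr_ge0 ?(ltW (rn _))// (le_trans ler01)// poly_weight_ge1.
have hG : {ae mu, forall s, s \in I0pi -> cabs (G s) <= (expR (- (sg / 2 * r * s)) * g s) * p' s}.
  apply: ae_sub Fw => s Fs spi; have [Fs1 _] := Fs spi.
  have s0 : 0 <= s by move: (spi); rewrite in_I0pi => /andP[].
  have -> : expR (- (sg / 2 * r * s)) * g s * p' s = g s * (poly_weight r k.+1 s / r ^+ k.+1).
    rewrite /p' -[RHS]mulr1 -[X in _ = _ * X](expRxMexpNx_1 (sg / 2 * r * s)); ring.
  (* Three errors: qt w with the Volterra term, the deviation of y from e^(al s), and the Taylor
     remainder of q - qt. Each is O(r^(-k-1) (1 + r s)^(k+1)) times a summand of g. *)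
  have -> : G s = (w2 s + - al ^+ 2 * w s - h s) +
     ((q s - qt s) * (y s - cexp (al * s%:C)) +
      (q s - qt s - d * monomial k s) * cexp (al * s%:C)).
    by rewrite /G hE; ring.
  set P := poly_weight r k.+1 s / r ^+ k.+1.
  have ps : poly_weight r k s <= poly_weight r k.+1 s by exact: poly_weight_leS.
  have g1 : (Q + m s) * W * poly_weight r k s <= D * (Q + m s) * P.
    have -> : (Q + m s) * W * poly_weight r k s = (D * (Q + m s) / r ^+ k.+1) * poly_weight r k s.
      by rewrite WE; ring.
    have -> : D * (Q + m s) * P = (D * (Q + m s) / r ^+ k.+1) * poly_weight r k.+1 s.
      by rewrite /P; ring.
    by rewrite ler_wpM2l// divr_ge0 ?mulr_ge0// ltW.
  have g2 : cabs ((q s - qt s) * (y s - cexp (al * s%:C))) <= C0 * C2 * P.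
    rewrite cabsM (@le_trans _ _ (C0 * s ^+ k * (C2 / r)))//.
      by rewrite ler_pM ?cabs_ge0 ?qC0 ?ye.
    have : C0 * C2 / r * s ^+ k <= C0 * C2 / r * (poly_weight r k.+1 s / r ^+ k).
      rewrite ler_wpM2l ?divr_ge0 ?mulr_ge0// (le_trans (spow k s s0))//.
      by rewrite ler_wpM2r// invr_ge0 ltW.
    rewrite /P (_ : C0 * C2 / r * (poly_weight r k.+1 s / r ^+ k) = C0 * C2 * (poly_weight r k.+1 s / r ^+ k.+1)).
      by apply: le_trans; rewrite le_eqVlt; apply/orP; left; apply/eqP; ring.
    by rewrite (exprS r k); field; rewrite !gt_eqF.
  have g3 : cabs ((q s - qt s - d * monomial k s) * cexp (al * s%:C)) <= C1 * P.
    rewrite cabsM (@le_trans _ _ (C1 * s ^+ k.+1 * 1))//.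
      rewrite ler_pM ?cabs_ge0 ?qC1// cabs_cexpR tal -expR0 ler_expR mulNr oppr_le0.
      by rewrite mulr_ge0// ltW.
    by rewrite mulr1 ler_wpM2l ?spow.
  have -> : g s * P = D * (Q + m s) * P + (C0 * C2 * P + C1 * P) by rewrite /g; ring.
  rewrite (le_trans (cabsD _ _))//; apply: lerD; first exact: le_trans Fs1 g1.
  by rewrite (le_trans (cabsD _ _))//; apply: lerD.
have iEg : itg I0pi (fun s => expR (- (sg / 2 * r * s)) * g s).
  apply: itgM_bmeas => //; apply: bmeas_continuous => s.
  apply: (@continuous_comp _ _ _ (fun s => - (sg / 2 * r * s)) expR); last exact: continuous_expR.
  by apply: cvgN; apply: cvgM; [exact: cvg_cst|exact: cvg_id].
have hEg s : 0 <= expR (- (sg / 2 * r * s)) * g s by rewrite mulr_ge0 ?expR_ge0.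
set Ig := \int[mu]_(s in I0pi) (expR (- (sg / 2 * r * s)) * g s).
have etaB : r ^+ k.+1 * cabs JG <= 2 * c' * Ig.
  have := @cabs_weighted_integral_le _ 1 al G _ p' (c' / r ^+ k.+1) 0 pi (lexx _) (lexx _)
    iG iEg hEg hG.
  rewrite mul1r -/JG -/Ig => JGle.
  have : cabs JG <= 2 * (c' / r ^+ k.+1 * Ig).
    apply: JGle; first by rewrite divr_ge0// ltW.
    move=> s; rewrite in_itv/= => /andP[s0 sp].
    rewrite mul1r cabs_cexpR tal /p'.
    have -> : expR (- t * s) * (poly_weight r k.+1 s / r ^+ k.+1 * expR (sg / 2 * r * s)) =
      poly_weight r k.+1 s * (expR (- t * s) * expR (sg / 2 * r * s)) / r ^+ k.+1 by ring.
    rewrite ler_wpM2r ?invr_ge0 ?(ltW (rn _))//.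
    have -> : poly_weight r k.+1 s * (expR (- t * s) * expR (sg / 2 * r * s)) =
       expR (- ((t - sg / 2 * r) * s)) * poly_weight r k.+1 s.
      by rewrite -expRD mulrC; congr (expR _ * _); ring.
    (* The decay rate left over, t - sg r / 2, is still at least sg r / 2, the rate for which c' is
       defined. *)
    by rewrite c'E; apply: poly_weight_exp_le => //; move: sgt; light_lra.
  move=> /(ler_wpM2l (ltW (rn k.+1))) /le_trans; apply.
  by rewrite le_eqVlt; apply/orP; left; apply/eqP; field; rewrite gt_eqF.
have be0 : Re (2 * al) < 0.
  have -> : Re (2 * al) = - (2 * t).
    have -> : 2 * al = al + al by ring.
    by rewrite complex_ReD tal; ring.
  by rewrite oppr_lt0 mulr_gt0.
have c2al : cabs (2 * al) = 2 * r.
  by rewrite cabsM -(rmorph_nat (real_complex R)) cabsR normr_nat.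
have etaC : cabs ((- (2 * al)) ^+ k.+1 * Ik - 1) <= k.+1%:R * 2 ^+ k * c' * et.
  apply: (le_trans (monomial_laplace k be0)).
  have -> : Re (2 * al) * pi = - (t * pi) + - (t * pi).
    have -> : 2 * al = al + al by ring.
    by rewrite complex_ReD tal; ring.
  rewrite c2al expRD -/ep.
  have ep1 : ep <= 1 by move: Eh; light_lra.
  have ep0 : 0 <= ep := expR_ge0 _.
  have l1 : (1 + 2 * r * pi) ^+ k <= 2 ^+ k * poly_weight r k pi.
    have rpi : 0 <= r * pi by rewrite mulr_ge0.
    rewrite /poly_weight -exprMn ger0_norm//; apply: lerXn2r; rewrite ?nnegrE; move: rpi; light_lra.
  have l2 : (1 + 2 * r * pi) ^+ k * ep <= 2 ^+ k * (c' * et).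
    have := ler_wpM2r ep0 l1; have k2 : 0 <= (2 : R) ^+ k by rewrite exprn_ge0.
    have := ler_wpM2l (mulr_ge0 k2 ep0) pkk.
    have := ler_wpM2l k2 epp; light_lra.
  have l3 : (1 + 2 * r * pi) ^+ k * ep * ep <= 2 ^+ k * (c' * et).
    apply: le_trans l2; rewrite ler_piMr// mulr_ge0// exprn_ge0// addr_ge0//.
    by rewrite !mulr_ge0.
  have := ler_wpM2l (ler0n R k.+1) l3; light_lra.
have epet : ep <= et.
  rewrite /ep /et ler_expR lerN2 mulrAC ler_wpM2r//.
  have := mulr_ge0 (ltW sg0) r00; move: sgt; light_lra.
have ep0 : 0 <= ep := expR_ge0 _.
have E2 : cabs (E ^+ 2) <= et.
  rewrite cabsX cE expr2 (le_trans _ epet)// ler_piMr//; move: Eh; light_lra.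
have E2' : 2^-1 <= cabs (1 - E ^+ 2).
  have : cabs 1 <= cabs (1 - E ^+ 2) + cabs (E ^+ 2).
    by apply: le_trans (cabsD _ _); rewrite subrK.
  rewrite cabs1 cabsX cE; have : ep ^+ 2 <= 2^-1.
    by rewrite expr2 (le_trans _ Eh)// ler_piMr//; move: Eh; light_lra.
  light_lra.
set X := (- (2 * al)) ^+ k.+1 * (b1 - b2).
(* [bvp_initial] multiplied by (-2 al)^(k+1): the Laplace integral becomes 1 up to a small error, so
   that - d Ik cancels the added d. *)
have XY : (X + d) * (1 - E ^+ 2) =
   (- (2 * al)) ^+ k.+1 * (E * K - JG) - d * ((- (2 * al)) ^+ k.+1 * Ik - 1) - d * E ^+ 2.
  have -> : (X + d) * (1 - E ^+ 2) =
    (- (2 * al)) ^+ k.+1 * ((b1 - b2) * (1 - E ^+ 2)) + d - d * E ^+ 2 by rewrite /X; ring.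
  by rewrite init JE; ring.
have cX : cabs ((- (2 * al)) ^+ k.+1) = 2 ^+ k.+1 * r ^+ k.+1.
  by rewrite cabsX cabsN c2al exprMn.
have : cabs (X + d) * cabs (1 - E ^+ 2) <=
   2 ^+ k.+1 * (2 * c * c' * (D * kap + 10 * C0) * et + 2 * c' * Ig) +
   cabs d * (k.+1%:R * 2 ^+ k * c' * et) + cabs d * et.
  rewrite -cabsM XY (le_trans (cabsB _ _))// lerD//; last by rewrite cabsM ler_wpM2l ?cabs_ge0.
  rewrite (le_trans (cabsB _ _))// lerD//; last by rewrite cabsM ler_wpM2l ?cabs_ge0.
  rewrite cabsM cX -mulrA ler_wpM2l ?exprn_ge0//.
  rewrite (le_trans (ler_wpM2l (ltW (rn k.+1)) (cabsB _ _)))// mulrDr lerD//.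
have := ler_wpM2l (cabs_ge0 (X + d)) E2'; light_lra.
Qed.

End WeylDifference.

(** * Weyl functions at large rho in the sector, and the limit formula *)

Section WeylFunction.
Context {R : realType}.
Local Notation mu := (@lebesgue_measure R).
Local Notation Re := (@complex.Re R).
Local Notation Im := (@complex.Im R).
Local Notation I0pi := (`[0, pi]%classic : set R).

Lemma cinfty_in_filter (Q : set R[i]) : Filter (cinfty_in Q).
Proof.
apply: filter_from_filter; first by exists 0.
move=> A B _ _; exists (Num.max A B) => // rho [Qrho]; rewrite gt_max => /andP[Ar Br].
by split.
Qed.

(* The solution is C + N S. *)
Lemma weyl_solution (M : R -> R -> R[i]) m (q : R -> R[i]) N (Q sg : R) (rho : R[i]) :
  integrable_kernel M -> kernel_bound M m -> 0 <= Q ->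
  (forall s, s \in I0pi -> cabs (q s) <= Q) -> weyl_function M q N ->
  0 < sg -> 0 < cabs rho -> sg * cabs rho <= Im rho -> 1 <= sg * cabs rho * pi ->
  26 * \int[mu]_(s in I0pi) (Q + m s) <= cabs rho ->
  exists y y1 y2, forced_solution M q (fun=> 0) (- ('i%C * rho) ^+ 2) 1 (N (rho ^+ 2)) y y1 y2 /\
    y pi = 0.
Proof.
move=> hM km Q0 qQ [C [S [hC [hS hN]]]] sg0 r0 sgr big big2.
have lamE : - ('i%C * rho) ^+ 2 = rho ^+ 2 by rewrite exprMn sqr_i; ring.
have ci : cabs ('i%C * rho) = cabs rho.
  by rewrite cabsM /cabs/= expr0n expr1n add0r sqrtr1 mul1r.
have Rei : Re ('i%C * rho) = - Im rho by rewrite complex_ReM /= mul0r mul1r sub0r.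
have [c0 [c1 [c2 fC]]] : exists y0 y1 y2, y0 = C (rho ^+ 2) /\
    forced_solution M q (fun=> 0) (- ('i%C * rho) ^+ 2) 1 0 y0 y1 y2.
  have [y1 [y2 f]] := cauchy_forced (hC (rho ^+ 2)).
  by exists (C (rho ^+ 2)), y1, y2; rewrite lamE.
have [s0 [s1 [s2 fS]]] : exists y0 y1 y2, y0 = S (rho ^+ 2) /\
    forced_solution M q (fun=> 0) (- ('i%C * rho) ^+ 2) 0 1 y0 y1 y2.
  have [y1 [y2 f]] := cauchy_forced (hS (rho ^+ 2)).
  by exists (S (rho ^+ 2)), y1, y2; rewrite lamE.
have [c0E fC'] := fC; have [s0E fS'] := fS.
(* Only where S(pi) is nonzero does [weyl_function] determine N. *)
have Spi : s0 pi != 0.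
  apply: (initial_value_neq0 km Q0 sg0 qQ fS' (oner_neq0 _) Rei); rewrite ci//.
set n := N (rho ^+ 2).
have nE : n = - c0 pi / s0 pi.
  by move: Spi; rewrite /n c0E s0E => Spi; exact: hN.
have := forced_comb n hM fC' fS'.
rewrite mulr0 !addr0 mulr1 !add0r.
move=> f; do 3 eexists; split; first exact: f.
by rewrite /= nE divfK// subrr.
Qed.

(** In the difference of the two Taylor expansions the terms below k cancel; order k gives the bound
    on q - qt, and order k + 1 the error after removing the leading monomial. *)
Lemma potential_difference (q qt : R -> R[i]) (k : nat) :
  analytic_on I0pi q -> model_potential q k qt ->
  exists C0 C1, [/\ 0 <= C0, 0 <= C1,
    (forall s, s \in I0pi -> cabs (q s - qt s) <= C0 * s ^+ k) &
    (forall s, s \in I0pi -> cabs (q s - qt s -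
      (cderive1n k q 0 - cderive1n k qt 0) * monomial k s) <= C1 * s ^+ k.+1)].
Proof.
move=> qa [qta qtj]; have [A A0 hA] := taylor_global k.+1 qa.
have [B B0 hB] := taylor_global k.+1 qta.
set d := _ - _.
have H1 s : s \in I0pi -> cabs (q s - qt s - d * monomial k s) <= (A + B) * s ^+ k.+1.
  move=> spi; rewrite [leRHS]mulrDl.
  apply: (le_trans _ (lerD (hA s spi) (hB s spi))); apply: (le_trans _ (cabsB _ _)).
  rewrite le_eqVlt; apply/orP; left; apply/eqP; congr cabs.
  rewrite !big_nat_recr//=.
  have -> : \sum_(0 <= i < k) cderive1n i qt 0 / i`!%:R * s%:C ^+ i =
            \sum_(0 <= i < k) cderive1n i q 0 / i`!%:R * s%:C ^+ i.
    by rewrite !big_nat; apply: eq_bigr => i /andP[_ ik]; rewrite qtj.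
  have -> : monomial k s = s%:C ^+ k / k`!%:R.
    by rewrite /monomial rmorphM rmorphXn fmorphV rmorph_nat.
  by rewrite /d; ring.
have pi0 := pi_ge0 R.
have AB0 : 0 <= A + B by exact: addr_ge0.
exists (cabs d + (A + B) * pi), (A + B); split => //.
  by apply: addr_ge0; [exact: cabs_ge0|exact: mulr_ge0].
move=> s spi; have := spi; rewrite in_I0pi => /andP[s0 sp].
rewrite -[q s - qt s](subrK (d * monomial k s)) (le_trans (cabsD _ _))// [leRHS]mulrDl addrC lerD//.
  rewrite cabsM ler_wpM2l ?cabs_ge0// /monomial cabsR ger0_norm ?divr_ge0 ?exprn_ge0//.
  by rewrite ler_pdivrMr ?ltr0n ?fact_gt0// ler_peMr ?exprn_ge0// ler1n fact_gt0.
apply: (le_trans (H1 s spi)); rewrite exprS mulrA ler_wpM2r ?exprn_ge0//.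
by rewrite ler_wpM2l ?addr_ge0.
Qed.

Lemma weyl_function_asymptotics (delta : R) (hdelta : 0 < delta < pi / 2)
    (M : R -> R -> R[i]) (hM : integrable_kernel M) (q qt : R -> R[i]) (N Nt : R[i] -> R[i]) (k : nat) :
  analytic_on `[0, pi] q -> model_potential q k qt ->
  weyl_function M q N -> weyl_function M qt Nt ->
  ((- 2 * 'i%C * rho) ^+ k.+1 * (N (rho ^+ 2) - Nt (rho ^+ 2)) : R[i]^o)
    @[rho --> cinfty_in (sector delta)]
    --> (- (cderive1n k q 0 - cderive1n k qt 0) : R[i]^o).
Proof.
move=> qa mqt hN hNt; have pi0 := pi_gt0 R.
have [sg sg0 hsg] := sector_lower_bound hdelta.
have [m km] := kernel_boundP hM; have [m0 im _] := km.
have [qta _] := mqt.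
have [Q1 Q10 qQ1] := cbmeas_bound (potential_bounded qa).
have [Q2 Q20 qtQ2] := cbmeas_bound (potential_bounded qta).
have [Q [Q0 qQ qtQ]] : exists Q, [/\ 0 <= Q, forall s, s \in I0pi -> cabs (q s) <= Q &
    forall s, s \in I0pi -> cabs (qt s) <= Q].
  exists (Q1 + Q2); split; first exact: addr_ge0.
    by move=> s /set_mem/qQ1/le_trans; apply; rewrite lerDl.
  by move=> s /set_mem/qtQ2/le_trans; apply; rewrite lerDr.
have [C0 [C1 [C00 C10 hC0 hC1]]] := potential_difference qa mqt.
set d := _ - _ in hC1 *.
have mp : measurable I0pi by exact: measurable_itv.
have iQm : (mu.-integrable I0pi (EFin \o (fun s => Q + m s))) by apply: itgD => //; exact: itg_cst.
set kap := \int[mu]_(s in I0pi) (Q + m s).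
have kap0 : 0 <= kap by apply: Rintegral_ge0 => s _; exact: addr_ge0.
pose c := expbound sg k; pose c' := expbound (sg / 2) k.+1.
have c1 : 1 <= c by exact: expbound_ge1.
have sg20 : 0 < sg / 2 by rewrite divr_gt0.
have c'1 : 1 <= c' by exact: expbound_ge1.
have c0 := le_trans ler01 c1; have c'0 := le_trans ler01 c'1.
pose D := 260 * c ^+ 5 * pi * C0; pose C2 := 4 / (sg * pi) + 130 * kap.
have D0 : 0 <= D by rewrite /D !mulr_ge0 ?exprn_ge0 ?(ltW pi0).
have C20 : 0 <= C2 by rewrite /C2 addr_ge0 ?divr_ge0 ?mulr_ge0 ?(ltW pi0) ?(ltW sg0).
pose g := fun s => D * (Q + m s) + (C0 * C2 + C1).
have g0 s : 0 <= g s := addr_ge0 (mulr_ge0 D0 (addr_ge0 Q0 (m0 s))) (addr_ge0 (mulr_ge0 C00 C20) C10).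
have ig : mu.-integrable I0pi (EFin \o g) by apply: itgD => //; [exact: itgZ|exact: itg_cst].
(* The bound of [weyl_difference_bound] as a function of |rho| alone, which makes the convergence
   uniform in the sector. *)
pose Psi r := 2 * (2 ^+ k.+1 * (2 * c * c' * (D * kap + 10 * C0) * expR (- (sg / 2 * pi * r)) +
         2 * c' * \int[mu]_(s in I0pi) (expR (- (sg / 2 * r * s)) * g s)) +
       cabs d * (k.+1%:R * 2 ^+ k * c' * expR (- (sg / 2 * pi * r))) +
       cabs d * expR (- (sg / 2 * pi * r))).
have sexp : eventually_small (fun r => expR (- (sg / 2 * pi * r))).
  by apply: eventually_small_exp; rewrite mulr_gt0.
have sPsi : eventually_small Psi.
  apply: eventually_smallZ => //; apply: eventually_smallD; last by apply: eventually_smallZ => //; exact: cabs_ge0.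
  apply: eventually_smallD; last first.
    apply: eventually_smallZ; first exact: cabs_ge0.
    by apply: eventually_smallZ => //; rewrite !mulr_ge0// exprn_ge0.
  apply: eventually_smallZ; first by rewrite exprn_ge0.
  apply: eventually_smallD; last by apply: eventually_smallZ; [exact: mulr_ge0|exact: eventually_small_exp_integral].
  apply: eventually_smallZ => //; apply: mulr_ge0; first by rewrite !mulr_ge0.
  by apply: addr_ge0; apply: mulr_ge0.
have FF := cinfty_in_filter (sector delta).
apply/cvgCP => e e0; have [A0 hA0] := sPsi e e0.
(* Three thresholds: one for Psi < e, one for absorbing the supremum, and one for e^(-t pi) <=
   1/2. *)
exists (Num.max (Num.max A0 (26 * c ^+ 5 * kap)) ((sg * pi)^-1)) => // rho [srho].
rewrite !gt_max => /andP[/andP[rA0 rkap] rsg].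
have [r0 sgr] := hsg rho srho.
have big : 1 <= sg * cabs rho * pi.
  by rewrite mulrAC -ler_pdivrMl ?mulr_gt0// mulr1 ltW.
have c5 : 1 <= c ^+ 5 by exact: exprn_ege1.
have big2 : 26 * kap <= cabs rho.
  by apply: le_trans (ltW rkap); rewrite ler_wpM2r//; move: c5; lra.
have [y [y1 [y2 [fy ypi]]]] := weyl_solution hM km Q0 qQ hN sg0 r0 sgr big big2.
have [z [z1 [z2 [fz zpi]]]] := weyl_solution hM km Q0 qtQ hNt sg0 r0 sgr big big2.
have ci : cabs ('i%C * rho) = cabs rho.
  by rewrite cabsM /cabs/= expr0n expr1n add0r sqrtr1 mul1r.
have Rei : Re ('i%C * rho) = - Im rho by rewrite complex_ReM /= mul0r mul1r sub0r.
rewrite /= -cabsN.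
have -> : - (- d - (- 2 * 'i%C * rho) ^+ k.+1 * (N (rho ^+ 2) - Nt (rho ^+ 2))) =
  (- (2 * ('i%C * rho))) ^+ k.+1 * (N (rho ^+ 2) - Nt (rho ^+ 2)) + d.
  have -> : - 2 * 'i%C * rho = - (2 * ('i%C * rho)) by ring.
  ring.
apply: le_lt_trans (hA0 _ rA0).
have := @weyl_difference_bound _ M m Q sg hM km Q0 sg0 k q qt d ('i%C * rho)
  (N (rho ^+ 2)) (Nt (rho ^+ 2)) C0 C1 (Im rho) y y1 y2 z z1 z2 qQ qtQ C00 C10 hC0 hC1
  fy ypi fz zpi Rei.
rewrite ci; apply => //; exact: ltW rkap.
Qed.

End WeylFunction.

Theorem mainTheorem1 (R : realType) (delta : R)
    (hdelta : 0 < delta < pi / 2)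
    (M : R -> R -> R[i]) (hM : integrable_kernel M)
    (q : R -> R[i]) (hq : analytic_on `[0, pi] q)
    (N : R[i] -> R[i]) (hN : weyl_function M q N) :
  let q_ k := cderive1n k q 0 in
  let rad := taylor_radius q_ in
  (forall k : nat,
     (exists qt : R -> R[i], model_potential q k qt) /\
     (forall (qt : R -> R[i]) (Nt : R[i] -> R[i]),
        model_potential q k qt -> weyl_function M qt Nt ->
        ((- 2 * 'i%C * rho) ^+ k.+1 * (N (rho ^+ 2) - Nt (rho ^+ 2)) : R[i]^o)
          @[rho --> cinfty_in (sector delta)]
          --> (- (q_ k - cderive1n k qt 0) : R[i]^o))) /\
  (0 < rad)%E /\
  (forall x : R, 0 < x <= pi -> (x%:E < rad)%E ->
     has_csum (taylor_term q_ x) (q x)) /\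
  ((rad < pi%:E)%E ->
     forall f : R -> R[i], analytic_on `]0, pi[ f ->
       (forall x : R, 0 < x -> (x%:E < rad)%E ->
          has_csum (taylor_term q_ x) (f x)) ->
       forall x : R, (rad < x%:E)%E -> x < pi -> f x = q x).
Proof.
move=> q_ rad; split; last exact: taylor_recovery.
move=> k; split; first by exists q.
by move=> qt Nt mqt hNt; exact: (weyl_function_asymptotics hdelta hM hq mqt hN hNt).
Qed.
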